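(* Let $g:\mathbb{R}\times\mathscr{P}_2(\mathbb{R})\to\mathbb{R}$ be differentiable in its first variable $x$, with derivative $g_x$, and suppose there is a constant $C_g$ such that: (1) $|g_x(x,m)-g_x(x',m)|\le C_g|x-x'|$ for all $x,x'\in\mathbb{R}$, $m\in\mathscr{P}_2(\mathbb{R})$; (2) $(g_x(x,m)-g_x(x',m))(x-x')\ge 0$ for all $x,x'\in\mathbb{R}$, $m\in\mathscr{P}_2(\mathbb{R})$; (3) $|g_x(x,m)-g_x(x,m')|\le C_g W_2(m,m')$ for all $x\in\mathbb{R}$, $m,m'\in\mathscr{P}_2(\mathbb{R})$; (4) for all $m,m'\in\mathscr{P}_2(\mathbb{R})$ and every $\gamma\in\mathscr{P}_2(\mathbb{R}^2)$ with marginals $m$ and $m'$ respectively, $\int_{\mathbb{R}^2}(g_x(x,m)-g_x(y,m'))(x-y)\,\gamma(dx,dy)\ge 0$. Then there exists a solution to the $\tilde\sigma$-MFG with initial condition $\xi_0\in\mathscr{L}^2_{\mathscr{F}_0}$.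
   Context: $\mathscr{P}_2(\mathbb{R}^d)$ is the set of Borel probability measures on $\mathbb{R}^d$ with finite second moment, and $W_2$ is the second-order Wasserstein metric on $\mathscr{P}_2(\mathbb{R})$: $W_2(m_1,m_2)=\left(\inf_\gamma\int_{\mathbb{R}^2}|x-y|^2\gamma(dx,dy)\right)^{1/2}$, the infimum being over probability measures $\gamma$ on $\mathbb{R}^2$ with marginals $m_1,m_2$. Fix an arbitrary $T>0$ and real constants $\sigma,\tilde\sigma$. On a complete probability space $(\Omega,\mathscr{F},\mathbb{P})$ let $W=(W_t)_{0\le t\le T}$ and $\tilde W=(\tilde W_t)_{0\le t\le T}$ be independent one-dimensional Brownian motions and let $\xi_0$ be a square-integrable random variable independent of $(W,\tilde W)$. $\mathscr{F}_t$ is generated by $\xi_0,(W_s)_{0\le s\le t},(\tilde W_s)_{0\le s\le t}$ and $\tilde{\mathscr{F}}_t$ is generated by $(\tilde W_s)_{0\le s\le t}$, both augmented by the $\mathbb{P}$-null sets. $\mathscr{L}^2_{\mathscr{F}_t}$ is the set of square-integrable $\mathscr{F}_t$-measurable random variables; $\mathscr{H}^2([0,T];\mathbb{R})$ is the set of $(\mathscr{F}_t)$-progressively measurable real processes $\beta$ on $[0,T]$ with $\mathbb{E}\int_0^T\beta_t^2\,dt<\infty$. For $\alpha\in\mathscr{H}^2([0,T];\mathbb{R})$ let $X^\alpha_t=\xi_0+\int_0^t\alpha_r\,dr+\sigma W_t+\tilde\sigma\tilde W_t$ and $m^\alpha_t=\mathcal{L}(X^\alpha_t\mid\tilde{\mathscr{F}}_t)$,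 the (regular) conditional law of $X_t^\alpha$ given $\tilde{\mathscr{F}}_t$, which lies in $\mathscr{P}_2(\mathbb{R})$ a.s. For $\alpha,\hat\alpha\in\mathscr{H}^2([0,T];\mathbb{R})$ put $$J(\alpha\mid m^{\hat\alpha})=\mathbb{E}\left[\int_0^T\frac{\alpha_t^2}{2}\,dt+g(X^\alpha_T,m^{\hat\alpha}_T)\right].$$ It is understood that these costs are well defined and finite: $g$ is Borel measurable and $g(X^\alpha_T,m^{\hat\alpha}_T)$ is integrable for all $\alpha,\hat\alpha\in\mathscr{H}^2([0,T];\mathbb{R})$. A solution to the $\tilde\sigma$-MFG (mean field game with common noise) with initial $\xi_0$ is a control $\hat\alpha\in\mathscr{H}^2([0,T];\mathbb{R})$ such that $J(\hat\alpha\mid m^{\hat\alpha})\le J(\alpha\mid m^{\hat\alpha})$ for all $\alpha\in\mathscr{H}^2([0,T];\mathbb{R})$ (the flow $m^{\hat\alpha}$ being held fixed). *)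

(* Defs.v *)
From HB Require Import structures.
From mathcomp Require Import all_boot all_order all_algebra.
From mathcomp Require Import all_classical all_reals all_analysis.
From mathcomp Require Import measurable_realfun.

Set Implicit Arguments.
Unset Strict Implicit.
Unset Printing Implicit Defensive.

Import Order.TTheory GRing.Theory Num.Theory.
Import numFieldNormedType.Exports.

Local Open Scope classical_set_scope.
Local Open Scope ring_scope.

Record P2 (R : realType) := MkP2 {
  P2_prob :> probability R R ;
  P2_moment : (\int[P2_prob]_x (x ^+ 2)%:E < +oo)%E }.

Definition in_P2_plane (R : realType) (gamma : probability (R * R)%type R) :=
  (\int[gamma]_z (z.1 ^+ 2 + z.2 ^+ 2)%:E < +oo)%E.

Definition coupling (R : realType) (m m' : P2 R) :
    set (probability (R * R)%type R) :=
  [set gamma | forall A : set R, measurable A ->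
     gamma (fst @^-1` A) = m A /\ gamma (snd @^-1` A) = m' A].

(* The infimum is finite, because the product measure is a coupling with finite
   cost; hence [fine] loses nothing. *)
Definition W2 (R : realType) (m m' : P2 R) : R :=
  Num.sqrt (fine (ereal_inf
    [set (\int[gamma]_z ((z.1 - z.2) ^+ 2)%:E)%E | gamma in coupling m m'])).

(* Product topology of the usual topology of R and the W2-topology of P2. *)
Definition open_RxP2 (R : realType) : set (set (R * P2 R)) :=
  [set U | forall z, U z -> exists2 e : R, 0 < e &
     forall z', `|z.1 - z'.1| < e -> W2 z.2 z'.2 < e -> U z'].

Definition borel_RxP2 (R : realType) (g : R -> P2 R -> R) :=
  forall B : set R, measurable B ->
    <<s @open_RxP2 R >> ((fun z : R * P2 R => g z.1 z.2) @^-1` B).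

(* The derivative of g in its first variable. *)
Definition g_x (R : realType) (g : R -> P2 R -> R) (x : R) (m : P2 R) : R :=
  ((g ^~ m)^`()%classic) x.

Definition indep_systems d (Omega : measurableType d) (R : realType)
    (P : probability Omega R) (G H : set (set Omega)) :=
  forall A B, G A -> H B -> P (A `&` B) = (P A * P B)%E.

Definition gen_rv d (Omega : measurableType d) (R : realType)
    (X : Omega -> R) : set (set Omega) :=
  preimage_set_system setT X measurable.

(* Generators of the sigma-algebra of (Y_s) for 0 <= s <= t. *)
Definition gen_past d (Omega : measurableType d) (R : realType)
    (Y : R -> Omega -> R) (t : R) : set (set Omega) :=
  \bigcup_(s in `[0, t]) gen_rv (Y s).

Definition brownian d (Omega : measurableType d) (R : realType)
    (P : probability Omega R) (T : R) (W : R -> Omega -> R) :=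
  [/\ forall t, 0 <= t <= T -> measurable_fun setT (W t),
      {ae P, forall w, W 0 w = 0},
      {ae P, forall w, {within `[0, T], continuous (W ^~ w)}},
      forall s t, 0 <= s -> s < t -> t <= T ->
        indep_systems P <<s gen_past W s >> (gen_rv (fun w => W t w - W s w)) &
      forall s t, 0 <= s -> s < t -> t <= T ->
        forall A : set R, measurable A ->
          P ((fun w => W t w - W s w) @^-1` A)
          = normal_prob 0 (Num.sqrt (t - s)) A].

(* Generators of the two filtrations, including the P-null sets. *)
Definition gen_F d (Omega : measurableType d) (R : realType)
    (P : probability Omega R) (xi0 : Omega -> R) (W tW : R -> Omega -> R)
    (t : R) : set (set Omega) :=
  gen_rv xi0 `|` gen_past W t `|` gen_past tW t `|` P.-negligible.

Definition gen_tF d (Omega : measurableType d) (R : realType)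
    (P : probability Omega R) (tW : R -> Omega -> R) (t : R) :
    set (set Omega) :=
  gen_past tW t `|` P.-negligible.

Definition progressive d (Omega : measurableType d) (R : realType)
    (T : R) (gen : R -> set (set Omega)) (b : R -> Omega -> R) :=
  forall t, 0 <= t <= T ->
    measurable_fun (`[0, t] `*` setT : set (R * g_sigma_algebraType (gen t)))
                   (fun z => b z.1 z.2).

Definition H2 d (Omega : measurableType d) (R : realType)
    (P : probability Omega R) (T : R) (gen : R -> set (set Omega))
    (b : R -> Omega -> R) :=
  progressive T gen b /\
  (\int[P]_w \int[lebesgue_measure]_(t in `[0%R, T]) ((b t w) ^+ 2)%:E
     < +oo)%E.

(* For a control in H2 the path r |-> alpha r w is integrable on [0, T] for
   almost every w; on the exceptional null set [Rintegral] is a default value. *)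
Definition state d (Omega : measurableType d) (R : realType)
    (sigma tsigma : R) (xi0 : Omega -> R) (W tW : R -> Omega -> R)
    (alpha : R -> Omega -> R) (t : R) (w : Omega) : R :=
  xi0 w + \int[lebesgue_measure]_(r in `[0, t]) alpha r w
    + sigma * W t w + tsigma * tW t w.

(* mu is a version of the regular conditional law of X given <<s gen >>. It is
   P2-valued everywhere, not only almost surely: this is a choice of version,
   available when <<s gen >> contains the null sets, as [gen_tF] does. *)
Definition regular_cond_law d (Omega : measurableType d) (R : realType)
    (P : probability Omega R) (gen : set (set Omega)) (X : Omega -> R)
    (mu : Omega -> P2 R) :=
  forall B : set R, measurable B ->
    measurable_fun (setT : set (g_sigma_algebraType gen)) (fun w => mu w B) /\
    forall A, <<s gen >> A -> P (A `&` X @^-1` B) = (\int[P]_(w in A) mu w B)%E.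

Definition cond_law_flow d (Omega : measurableType d) (R : realType)
    (P : probability Omega R) (T sigma tsigma : R) (xi0 : Omega -> R)
    (W tW : R -> Omega -> R) (alpha : R -> Omega -> R)
    (m : R -> Omega -> P2 R) :=
  forall t, 0 <= t <= T ->
    regular_cond_law P (gen_tF P tW t)
      (state sigma tsigma xi0 W tW alpha t) (m t).

Definition cost d (Omega : measurableType d) (R : realType)
    (P : probability Omega R) (T sigma tsigma : R) (xi0 : Omega -> R)
    (W tW : R -> Omega -> R) (g : R -> P2 R -> R)
    (alpha : R -> Omega -> R) (m : R -> Omega -> P2 R) : \bar R :=
  (\int[P]_w (\int[lebesgue_measure]_(t in `[0%R, T]) ((alpha t w) ^+ 2 / 2)%:E
    + (g (state sigma tsigma xi0 W tW alpha T w) (m T w))%:E))%E.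

(* Any two versions of the flow m agree almost surely at each time, so the
   choice of version does not affect the cost. *)
Definition mfg_solution d (Omega : measurableType d) (R : realType)
    (P : probability Omega R) (T sigma tsigma : R) (xi0 : Omega -> R)
    (W tW : R -> Omega -> R) (g : R -> P2 R -> R) (ahat : R -> Omega -> R) :=
  H2 P T (gen_F P xi0 W tW) ahat /\
  exists2 m : R -> Omega -> P2 R,
    cond_law_flow P T sigma tsigma xi0 W tW ahat m &
    forall alpha, H2 P T (gen_F P xi0 W tW) alpha ->
      (cost P T sigma tsigma xi0 W tW g ahat m
       <= cost P T sigma tsigma xi0 W tW g alpha m)%E.

(* Main.v *)
Require Import Defs.
From HB Require Import structures.
From mathcomp Require Import all_boot all_order all_algebra.
From mathcomp Require Import all_classical all_reals all_analysis.
From mathcomp Require Import measurable_realfun.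
From mathcomp Require Import ring lra.

Set Implicit Arguments.
Unset Strict Implicit.
Unset Printing Implicit Defensive.

Import Order.TTheory GRing.Theory Num.Theory.
Import numFieldNormedType.Exports.

Local Open Scope classical_set_scope.
Local Open Scope ring_scope.

(* A control [u] is optimal against the flow [m^u] as soon as
     a(u, v) := E int_0^T u_t v_t dt + E [g_x(X^u_T, m^u_T) int_0^T v_t dt] = 0
   for every control [v], since g(., m) is convex. In the semi-Hilbert space of
   controls, (3) and (1) make [a] Lipschitz in [u] and (4) makes it strongly
   monotone, so Zarantonello's theorem provides a zero.

   The monotonicity needed is E (Y - Y')(X - X') >= 0, where Y = g_x(X, m) and m
   is the conditional law of X given a sigma-algebra G. Split Omega into finitely
   many events of G on which the (discretised) conditional laws of X and X' hardly
   vary: given such an event A, they are W2-close to the laws of X and X' given A,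
   which are coupled by the law of (X, X') given A, and (4) applies to that
   coupling. *)

(** * Strongly monotone fields on a semi-Hilbert space *)

(** The law entering the cost is a random flow driven by the common noise, for which compactness is
    hard to come by; monotonicity allows a contraction instead. The constant of strong monotonicity
    is 1 and comes from the running cost: [xi0] and both noises cancel in the difference of two
    states, so X^u_T - X^v_T = int_0^T (u - v) dt, and a(u, u - v) - a(v, u - v) is the squared norm
    of u - v plus a nonnegative term. Controls stay genuine functions, since progressive
    measurability is not a property of classes modulo null sets. Hence a form that is only
    semidefinite, and limits given by a pointwise formula that serves all times at once. Applying
    (4) for each omega would call for a conditional law of the pair (X, X') whose marginals are m
    and m'; events of positive probability only need laws given an event. Discretisation makes
    finitely many events enough: a law on finitely many grid points is a vector of weights in
    [0, 1]. Its error is a conditional mean of a squared rounding error, small on average only,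
    which suffices as every limit is taken in L2. *)

Lemma le0_of_geometric (R : realType) (x K r : R) : 0 <= r < 1 ->
  (forall n, x <= K * r ^+ n) -> x <= 0.
Proof.
move=> /andP[r0 r1] h.
have c : (K * r ^+ n) @[n --> \oo] --> K * 0.
  by apply: cvgMr; apply: cvg_expr; rewrite ger0_norm.
rewrite mulr0 in c.
rewrite -(cvg_lim _ c)//; apply: limr_ge; first exact: cvgP c.
by near=> n; exact: h.
Unshelve. all: by end_near. Qed.

(** The source of every Cauchy-Schwarz inequality below. The forms are only semidefinite, so the
    leading coefficient may vanish. *)
Lemma quadratic_ge0_discr (R : realType) (a b c : R) :
  (forall t, 0 <= t ^+ 2 * a + 2 * t * b + c) -> b ^+ 2 <= a * c.
Proof.
move=> h.
have c0 : 0 <= c by have := h 0; rewrite expr0n/= !mul0r mulr0 mul0r !add0r.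
have [a0|a0|a0] := ltrgtP a 0.
- exfalso.
  (* This point is at least 1 and so large that the quadratic term outweighs the other two, which
     makes the polynomial negative. *)
  have t0 := h ((2 * `|b| + c + 1) / - a + 1).
  set t := _ / _ + 1 in t0.
  have t1 : 1 <= t by rewrite /t lerDr divr_ge0 ?oppr_ge0 ?ltW//;
    have := normr_ge0 b; lra.
  have ta : t * - a >= 2 * `|b| + c + 1.
    have -> : t * - a = 2 * `|b| + c + 1 - a by rewrite /t; field; rewrite lt_eqF.
    lra.
  have := ler_norm b; have := ler_norm (- b); rewrite normrN => b1 b2.
  have : t * (t * - a) >= t * (2 * `|b| + c + 1) by rewrite ler_pM2l//; lra.
  nra.
- have := h (- b / a).
  have -> : (- b / a) ^+ 2 * a + 2 * (- b / a) * b + c = c - b ^+ 2 / a.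
    by field; rewrite gt_eqF.
  by rewrite subr_ge0 ler_pdivrMr// mulrC.
- subst a; rewrite mul0r; have [->|b0] := eqVneq b 0; first by rewrite expr0n.
  (* With [a = 0] the polynomial is affine; it takes the value -1 here. *)
  have := h (- (c + 1) / (2 * b)).
  have -> : (- (c + 1) / (2 * b)) ^+ 2 * 0 + 2 * (- (c + 1) / (2 * b)) * b + c
    = -1 by field.
  lra.
Qed.

Section semi_hilbert.
Context (R : realType) (V : lmodType R) (S : V -> Prop) (B : V -> V -> R).
Hypothesis S0 : S 0.
Hypothesis SD : forall (k : R) u v, S u -> S v -> S (k *: u + v).
Hypothesis BC : forall u v, B u v = B v u.
Hypothesis BD : forall (k : R) u v w, S u -> S v -> S w ->
  B (k *: u + v) w = k * B u w + B v w.
Hypothesis B_ge0 : forall u, 0 <= B u u.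
(** Completeness is asked only along fast sequences. The gap between the rates [r ^+ (4 * n)] and
    [r ^+ n] pays for a limit taken pointwise almost everywhere, see [L2_complete]. *)
Hypothesis B_complete : forall (f : nat -> V) (r C : R), 0 < r < 1 ->
  (forall n, S (f n)) ->
  (forall n, B (f n.+1 - f n) (f n.+1 - f n) <= C * r ^+ (4 * n)) ->
  exists l K, S l /\ forall n, B (f n - l) (f n - l) <= K * r ^+ n.

Let SB u v : S u -> S v -> S (u - v).
Proof. by move=> su sv; rewrite addrC -scaleN1r; exact: SD. Qed.

Let SA u v : S u -> S v -> S (u + v).
Proof. by move=> su sv; rewrite -[u]scale1r; exact: SD. Qed.

Let SZ k u : S u -> S (k *: u).
Proof. by move=> su; rewrite -[_ *: _]addr0; exact: SD. Qed.

Let BZl k u w : S u -> S w -> B (k *: u) w = k * B u w.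
Proof.
move=> su sw; have b0 : B 0 w = 0.
  have := BD 1 S0 S0 sw; rewrite scaler0 addr0 mul1r => /eqP.
  by rewrite -subr_eq subrr => /eqP.
by rewrite -[k *: u]addr0 BD// b0 addr0.
Qed.

Let BDl u v w : S u -> S v -> S w -> B (u + v) w = B u w + B v w.
Proof. by move=> su sv sw; rewrite -[u in LHS]scale1r BD// mul1r. Qed.

Let BBl u v w : S u -> S v -> S w -> B (u - v) w = B u w - B v w.
Proof.
by move=> su sv sw; rewrite addrC -scaleN1r BD// mulN1r addrC.
Qed.

Let BBr u v w : S u -> S v -> S w -> B w (u - v) = B w u - B w v.
Proof. by move=> su sv sw; rewrite BC BBl// !(BC w). Qed.

Let expand t u v : S u -> S v ->
  B (t *: v + u) (t *: v + u) = t ^+ 2 * B v v + 2 * t * B u v + B u u.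
Proof.
move=> su sv; rewrite BD//; last exact: SD.
rewrite (BC v) (BC u) !BD// (BC v u); ring.
Qed.

Let cauchy_schwarz u v : S u -> S v -> B u v ^+ 2 <= B u u * B v v.
Proof.
move=> su sv; rewrite mulrC; apply: quadratic_ge0_discr => t.
by rewrite -expand.
Qed.

(** The representing element is a limit of a minimising sequence of [phi v = B v v - 2 * l v].
    Minimality need not be checked for the limit: the near-minimality of the sequence already yields
    the identity. *)
Lemma semi_hilbert_riesz (l : V -> R) (K : R) : 0 <= K ->
  (forall (k : R) u v, S u -> S v -> l (k *: u + v) = k * l u + l v) ->
  (forall v, S v -> l v ^+ 2 <= K * B v v) ->
  exists2 r, S r & forall v, S v -> l v = B r v.
Proof.
move=> K0 lD lK.
pose phi v := B v v - 2 * l v.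
pose E := [set phi v | v in [set v | S v]].
have phi_ge v : S v -> - K <= phi v.
  move=> sv; rewrite /phi; have := lK _ sv; have := B_ge0 v.
  move: (B v v) (l v) => b y b0.
  move=> Kb; suff : 2 * y <= K + b by lra.
  rewrite leNgt; apply/negP => h.
  have : (K + b) ^+ 2 < (2 * y) ^+ 2 by rewrite ltrXn2r// addr_ge0.
  have := sqr_ge0 (K - b); nra.
have lbE : has_inf E.
  split; first by exists (phi 0), 0.
  by exists (- K) => _ [v sv <-]; exact: phi_ge.
pose I := inf E.
have IE v : S v -> I <= phi v.
  by move=> sv; apply: ge_inf; [case: lbE|exists v].
have ex (n : nat) : exists v, S v /\ phi v <= I + 2^-1 ^+ (4 * n).
  have e0 : 0 < 2^-1 ^+ (4 * n) :> R by rewrite exprn_gt0// invr_gt0.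
  have [_ [v sv <-] h] := inf_adherent e0 lbE.
  by exists v; split=> //; exact: ltW.
have {ex} [f fP] := choice ex.
have Sf n : S (f n) by case: (fP n).
have fI n : phi (f n) <= I + 2^-1 ^+ (4 * n) by case: (fP n).
(* Parallelogram law: [B (u - v) (u - v)] is 2 phi(u) + 2 phi(v) - 4 phi((u + v) / 2), and the
   midpoint is no better than the infimum. Near-minimisers are thus close, which makes the sequence
   Cauchy. *)
have par u v a b : S u -> S v -> phi u <= I + a -> phi v <= I + b ->
    B (u - v) (u - v) <= 2 * (a + b).
  move=> su sv ua vb.
  have := IE (2^-1 *: (u + v)) (SZ _ (SA su sv)).
  have -> : phi (2^-1 *: (u + v)) =
      4^-1 * (B u u + 2 * B u v + B v v) - l u - l v.
    rewrite /phi BZl ?(BC (u + v)) ?BZl ?BDl// ?(BC _ (u + v)) ?BDl//;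
      try by [exact: SA|exact: SZ|apply: SZ; exact: SA].
    rewrite (BC v u) scalerDr -[2^-1 *: v]addr0 lD ?lD//;
      try by [apply: SZ|rewrite addr0; exact: SZ].
    have l0 : l 0 = 0.
      have := lD 1 0 0 S0 S0; rewrite scaler0 addr0 mul1r => /eqP.
      by rewrite -subr_eq subrr => /eqP.
    by rewrite l0; field.
  move: ua vb; rewrite /phi BBl// ?BBr// ?BBl//; last exact: SB.
  rewrite (BC v u); lra.
have r01 : 0 < (2^-1 : R) < 1 by lra.
have d n : B (f n.+1 - f n) (f n.+1 - f n) <= 4 * 2^-1 ^+ (4 * n).
  apply: le_trans (par _ _ _ _ (Sf _) (Sf _) (fI _) (fI _)) _.
  have : (2^-1 : R) ^+ (4 * n.+1) <= 2^-1 ^+ (4 * n).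
    by rewrite ler_wiXn2l ?leq_mul//; lra.
  lra.
have [r [M [Sr rM]]] := B_complete r01 Sf d.
exists r => // v sv.
suff : (l v - B r v) ^+ 2 <= 0.
  have := sqr_ge0 (l v - B r v) => s0 s1.
  by apply/eqP; rewrite -subr_eq0 -sqrf_eq0 eq_le s0 s1.
(* Moving a near-minimiser by [t *: v] gains at most its defect; the discriminant of this polynomial
   in [t] then bounds the first variation. *)
have var n t : - 2^-1 ^+ (4 * n) <=
    t ^+ 2 * B v v + 2 * t * (B (f n) v - l v).
  have := IE _ (SD t sv (Sf n)); have := fI n.
  rewrite /phi expand// lD//; lra.
have sq n : (B (f n) v - l v) ^+ 2 <= B v v * 2^-1 ^+ (4 * n).
  by apply: quadratic_ge0_discr => t; have := var n t; lra.
apply: (@le0_of_geometric _ _ (2 * M * B v v + 2 * B v v) 2^-1).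
  by lra.
move=> n.
have := sq n; have := cauchy_schwarz (SB (Sf n) Sr) sv.
rewrite BBl//.
have := rM n; have := B_ge0 v.
have : (2^-1 : R) ^+ (4 * n) <= 2^-1 ^+ n.
  by rewrite ler_wiXn2l ?leq_pmull//; lra.
move: (2^-1 ^+ (4 * n)) (2^-1 ^+ n) => p q pq bv rn.
have h : B (f n - r) (f n - r) * B v v <= M * q * B v v by rewrite ler_wpM2r.
have h' : B v v * p <= B v v * q by rewrite ler_wpM2l.
have : (l v - B r v) ^+ 2 <= 2 * (B (f n) v - B r v) ^+ 2 + 2 * (B (f n) v - l v) ^+ 2.
  have := sqr_ge0 (B (f n) v - B r v + (B (f n) v - l v)); lra.
lra.
Qed.

(* Zarantonello's theorem: [a u] is represented by a strongly monotone Lipschitz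
   field [rho u], and [u - rho u / L] is a contraction. *)
Lemma strongly_monotone_zero (a : V -> V -> R) (L : R) :
  (forall u (k : R) v w, S u -> S v -> S w ->
     a u (k *: v + w) = k * a u v + a u w) ->
  (forall u, S u ->
     exists2 K, 0 <= K & forall v, S v -> a u v ^+ 2 <= K * B v v) ->
  (forall u u' v, S u -> S u' -> S v ->
     (a u v - a u' v) ^+ 2 <= L * B (u - u') (u - u') * B v v) ->
  (forall u u', S u -> S u' ->
     B (u - u') (u - u') <= a u (u - u') - a u' (u - u')) ->
  exists2 u, S u & forall v, S v -> a u v = 0.
Proof.
move=> aD aK aL am.
(* Enlarging the Lipschitz constant is harmless, and [1 <= L] places the contraction factor in ]0,
   1[. *)
wlog L1 : L aL / 1 <= L.
  move=> h; apply: (h (`|L| + 1)); last by rewrite lerDr.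
  move=> u u' v su su' sv; apply: le_trans (aL _ _ _ su su' sv) _.
  rewrite -!mulrA ler_wpM2r// ?mulr_ge0//.
  by have := ler_norm L; lra.
have ex u : exists r, S u -> S r /\ forall v, S v -> a u v = B r v.
  have [su|nsu] := pselect (S u); last by exists u.
  have [K K0 uK] := aK u su.
  have [|r sr ur] := semi_hilbert_riesz (l := a u) (K := K) K0 _ uK; last by exists r.
  by move=> k v w sv sw; exact: aD.
have [rho rhoP] := choice ex.
have Srho u : S u -> S (rho u) by move=> /rhoP[].
have arho u v : S u -> S v -> a u v = B (rho u) v by move=> /rhoP[_]; exact.
pose T u := - L^-1 *: rho u + u.
have ST u : S u -> S (T u) by move=> su; apply: SD => //; exact: Srho.
have L0 : 0 < L by lra.
(* The computation below gives the factor 1 - 1/L. Half the gain is given up so that [q] remains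
   positive for [L = 1]. *)
pose q := 1 - (2 * L)^-1.
have i0 : 0 < L^-1 by rewrite invr_gt0.
have i1 : L^-1 <= 1 by rewrite invf_le1.
have qE : q = 1 - 2^-1 * L^-1 by rewrite /q; field; rewrite gt_eqF.
have q01 : 0 < q < 1 by rewrite qE; lra.
have contr u u' : S u -> S u' ->
    B (T u - T u') (T u - T u') <= q * B (u - u') (u - u').
  move=> su su'.
  have -> : T u - T u' = - L^-1 *: (rho u - rho u') + (u - u').
    by rewrite /T scalerBr !scaleNr; rewrite opprD addrACA opprK addrC [X in _ + X]addrC addrC.
  have sr := SB (Srho _ su) (Srho _ su'); have sd := SB su su'.
  rewrite expand//.
  have sru := Srho _ su; have sru' := Srho _ su'.
  have := am _ _ su su'; rewrite !arho// -BBl//.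
  have := aL _ _ _ su su' sr; rewrite !arho// -BBl//.
  have := B_ge0 (rho u - rho u'); have := B_ge0 (u - u').
  rewrite (BC (u - u') (rho u - rho u')).
  set N := B (u - u') _; set M := B _ (rho u - rho u'); set X := B _ (u - u').
  move=> N0 M0 h1 h2.
  (* The Lipschitz bound tested on [rho u - rho u'] itself reads M ^ 2 <= L * N * M; divide by M
     unless it is 0. *)
  have ML : M <= L * N.
    have [->|M1] := eqVneq M 0; first by rewrite mulr_ge0// ltW.
    by rewrite -(@ler_pM2r _ M) ?lt0r ?M1// -expr2.
  have : L^-1 ^+ 2 * M <= L^-1 * N.
    have -> : L^-1 * N = L^-1 ^+ 2 * (L * N) by field; rewrite gt_eqF.
    by rewrite ler_wpM2l// sqr_ge0.
  have : L^-1 * N <= L^-1 * X by rewrite ler_wpM2l// ltW.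
  have : 0 <= L^-1 * N by rewrite mulr_ge0// ltW.
  rewrite qE sqrrN; lra.
pose f n := iter n T 0.
have Sf n : S (f n) by elim: n => //= n; exact: ST.
have fS n : f n.+1 = T (f n) by [].
(* A fourth root, since squared increments decaying like [q ^+ n] must read [r ^+ (4 * n)] in
   [B_complete]. *)
pose r := Num.sqrt (Num.sqrt q).
have r4 : r ^+ 4 = q.
  by rewrite (exprM r 2 2) !sqr_sqrtr// ?sqrtr_ge0//; lra.
have r01 : 0 < r < 1.
  rewrite !sqrtr_gt0; apply/andP; split; first lra.
  by rewrite -sqrtr1 ltr_sqrt// -[ltRHS]sqrtr1 ltr_sqrt//; lra.
have d n : B (f n.+1 - f n) (f n.+1 - f n) <=
    B (f 1 - f 0) (f 1 - f 0) * r ^+ (4 * n).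
  elim: n => [|n IH]; first by rewrite muln0 expr0 mulr1.
  rewrite (fS n.+1) {2 4}(fS n); apply: le_trans (contr _ _ (Sf _) (Sf _)) _.
  rewrite mulnS exprD r4 mulrCA ler_wpM2l//; lra.
have [u [K [su uK]]] := B_complete r01 Sf d.
exists u => // v sv.
suff : a u v ^+ 2 <= 0.
  by move=> s1; apply/eqP; rewrite -sqrf_eq0 eq_le sqr_ge0 s1.
set D0 := B (f 1 - f 0) (f 1 - f 0) in d.
have D00 : 0 <= D0 by exact: B_ge0.
apply: (@le0_of_geometric _ _ (2 * (L * K * B v v) + 2 * (L ^+ 2 * D0 * B v v)) r).
  by move: r01; lra.
move=> n.
have s1 : (a (f n) v - a u v) ^+ 2 <= L * K * B v v * r ^+ n.
  apply: le_trans (aL _ _ _ (Sf n) su sv) _.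
  rewrite (_ : L * K * B v v * r ^+ n = L * (K * r ^+ n) * B v v); last by ring.
  by rewrite ler_wpM2r// ler_wpM2l// ltW.
have s2 : a (f n) v ^+ 2 <= L ^+ 2 * D0 * B v v * r ^+ n.
  have -> : a (f n) v = - L * B (f n.+1 - f n) v.
    have sr := Srho _ (Sf n).
    by rewrite fS /T addrK BZl// arho//; field; exact: lt0r_neq0.
  rewrite exprMn sqrrN.
  rewrite [leRHS](_ : _ = L ^+ 2 * (D0 * r ^+ n * B v v)); last by ring.
  rewrite ler_wpM2l ?sqr_ge0//.
  apply: le_trans (cauchy_schwarz (SB (Sf _) (Sf _)) sv) _.
  rewrite ler_wpM2r//; apply: le_trans (d n) _; rewrite ler_wpM2l//.
  by rewrite ler_wiXn2l ?leq_pmull//; move: r01; lra.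
have := sqr_ge0 (a (f n) v + (a (f n) v - a u v)).
nra.
Qed.

End semi_hilbert.

(** * Square-integrable functions *)

Section square_integrable.
Context d (T : measurableType d) (R : realType).
Variables (mu : {measure set T -> \bar R}) (D : set T).
Hypothesis mD : measurable D.

(** A predicate on functions, not a space of classes: the same function must be testable for
    measurability with respect to several sigma-algebras. *)
Definition L2 (f : T -> R) := measurable_fun D f /\
  (\int[mu]_(x in D) (f x ^+ 2)%:E < +oo)%E.

Definition ip (f g : T -> R) : R := (\int[mu]_(x in D) (f x * g x))%R.

Lemma L2_integrable_sqr f : L2 f ->
  mu.-integrable D (fun x => (f x ^+ 2)%:E).
Proof.
move=> [mf fi]; apply/integrableP; split.
  by apply/measurable_EFinP; exact: measurable_funX.
by under eq_integral do rewrite /= ger0_norm ?sqr_ge0//.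
Qed.

Lemma L2_integrableM f g : L2 f -> L2 g ->
  mu.-integrable D (fun x => (f x * g x)%:E).
Proof.
move=> lf lg.
apply: (@le_integrable _ _ _ _ _ mD _ (fun x => (f x ^+ 2 + g x ^+ 2)%:E)).
- by apply/measurable_EFinP; apply: measurable_funM; [case: lf|case: lg].
- move=> x _ /=; rewrite lee_fin normrM [leRHS]ger0_norm ?addr_ge0 ?sqr_ge0//.
  have := sqr_ge0 (`|f x| - `|g x|).
  rewrite -(real_normK (num_real (f x))) -(real_normK (num_real (g x))).
  have := sqr_ge0 `|f x|; have := sqr_ge0 `|g x|; lra.
- under eq_fun do rewrite EFinD.
  by apply: integrableD => //; exact: L2_integrable_sqr.
Qed.

Lemma integrable_sqr_L2 (f : T -> R) : measurable_fun D f ->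
  mu.-integrable D (fun x => (f x ^+ 2)%:E) -> L2 f.
Proof.
move=> mf /integrableP[_]; split=> //.
by under eq_integral do rewrite -[X in X%:E]ger0_norm ?sqr_ge0//.
Qed.

Lemma le_L2 (f g : T -> R) : measurable_fun D f -> L2 g ->
  (forall x, D x -> f x ^+ 2 <= g x ^+ 2) -> L2 f.
Proof.
move=> mf lg fg; split=> //; apply: le_lt_trans lg.2.
apply: ge0_le_integral => //.
- by move=> x _; rewrite lee_fin sqr_ge0.
- by apply/measurable_EFinP; exact: measurable_funX.
- by apply/measurable_EFinP; apply: measurable_funX; case: lg.
Qed.

Lemma L2_lin k f g : L2 f -> L2 g -> L2 (fun x => k * f x + g x).
Proof.
move=> lf lg; have mf : measurable_fun D f by case: lf.
have mg : measurable_fun D g by case: lg.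
apply: integrable_sqr_L2.
  by apply: measurable_funD => //; exact: measurable_funM.
have -> : (fun x => ((k * f x + g x) ^+ 2)%:E) =
    (fun x => ((k ^+ 2)%:E * (f x ^+ 2)%:E + ((2 * k)%:E * (f x * g x)%:E + (g x ^+ 2)%:E))%E).
  by apply/funext => x; rewrite -!EFinM -!EFinD; congr EFin; ring.
apply: integrableD => //; first by apply: integrableZl => //; exact: L2_integrable_sqr.
apply: integrableD => //; last exact: L2_integrable_sqr.
by apply: integrableZl => //; exact: L2_integrableM.
Qed.

Lemma L2D f g : L2 f -> L2 g -> L2 (fun x => f x + g x).
Proof.
by move=> lf lg; have := L2_lin 1 lf lg; under eq_fun do rewrite mul1r.
Qed.

Lemma L2B f g : L2 f -> L2 g -> L2 (fun x => f x - g x).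
Proof.
move=> lf lg; have := L2_lin (-1) lg lf.
by under eq_fun do rewrite mulN1r addrC.
Qed.

Lemma ipE f g : L2 f -> L2 g ->
  (ip f g)%:E = (\int[mu]_(x in D) (f x * g x)%:E)%E.
Proof.
move=> lf lg; rewrite fineK//.
exact: integrable_fin_num (L2_integrableM lf lg).
Qed.

Lemma ipsqrE f : L2 f -> (ip f f)%:E = (\int[mu]_(x in D) (f x ^+ 2)%:E)%E.
Proof. by move=> lf; rewrite ipE. Qed.

Lemma ipC f g : ip f g = ip g f.
Proof. by apply: eq_Rintegral => x _; rewrite mulrC. Qed.

Lemma ip_linl k f g h : L2 f -> L2 g -> L2 h ->
  ip (fun x => k * f x + g x) h = k * ip f h + ip g h.
Proof.
move=> lf lg lh; have i1 := L2_integrableM lf lh; have i2 := L2_integrableM lg lh.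
rewrite /ip; under eq_Rintegral do rewrite mulrDl -mulrA.
rewrite RintegralD//; last first.
  have -> : EFin \o (fun x => k * (f x * h x)) =
      (fun x => k%:E * (f x * h x)%:E)%E by apply/funext.
  exact: integrableZl.
by rewrite RintegralZl.
Qed.

Lemma ipDl f g h : L2 f -> L2 g -> L2 h ->
  ip (fun x => f x + g x) h = ip f h + ip g h.
Proof.
move=> lf lg lh; have := ip_linl 1 lf lg lh; rewrite mul1r => <-.
by apply: eq_Rintegral => x _; rewrite mul1r.
Qed.

Lemma ipBl f g h : L2 f -> L2 g -> L2 h ->
  ip (fun x => f x - g x) h = ip f h - ip g h.
Proof.
move=> lf lg lh; have := ip_linl (-1) lg lf lh; rewrite mulN1r addrC => <-.
by apply: eq_Rintegral => x _; rewrite mulN1r addrC.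
Qed.

Lemma ip_ge0 f : 0 <= ip f f.
Proof. by apply: Rintegral_ge0 => x _; rewrite -expr2 sqr_ge0. Qed.

Lemma ip_cauchy_schwarz f g : L2 f -> L2 g -> ip f g ^+ 2 <= ip f f * ip g g.
Proof.
move=> lf lg; rewrite mulrC; apply: quadratic_ge0_discr => t.
rewrite (_ : _ + _ = ip (fun x => t * g x + f x) (fun x => t * g x + f x)) ?ip_ge0//.
have l := L2_lin t lg lf.
rewrite ip_linl// !(ipC _ (fun x => t * g x + f x)) !ip_linl//.
rewrite (ipC g f); ring.
Qed.

Lemma ip_sqrD f g : L2 f -> L2 g ->
  ip (fun x => f x + g x) (fun x => f x + g x) = ip f f + 2 * ip f g + ip g g.
Proof.
move=> lf lg; have lfg := L2D lf lg.
rewrite (ipDl lf lg lfg) (ipC f) (ipC g) (ipDl lf lg lf) (ipDl lf lg lg).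
rewrite (ipC g f); ring.
Qed.

Lemma ip_sqrB f g : L2 f -> L2 g ->
  ip (fun x => f x - g x) (fun x => f x - g x) = ip f f - 2 * ip f g + ip g g.
Proof.
move=> lf lg; have lfg := L2B lf lg.
rewrite (ipBl lf lg lfg) (ipC f) (ipC g) (ipBl lf lg lf) (ipBl lf lg lg).
rewrite (ipC g f); ring.
Qed.

Lemma ip_sqrB_le f g : L2 f -> L2 g ->
  ip (fun x => f x - g x) (fun x => f x - g x) <= 2 * ip f f + 2 * ip g g.
Proof.
move=> lf lg; have := ip_ge0 (fun x => f x + g x).
by rewrite (ip_sqrD lf lg) (ip_sqrB lf lg); lra.
Qed.

Lemma ip_sqrD_le f g : L2 f -> L2 g ->
  ip (fun x => f x + g x) (fun x => f x + g x) <= 2 * ip f f + 2 * ip g g.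
Proof.
move=> lf lg; have := ip_ge0 (fun x => f x - g x).
by rewrite (ip_sqrD lf lg) (ip_sqrB lf lg); lra.
Qed.

End square_integrable.

Lemma geometric_sum_le (R : realType) (r : R) n : 0 < r < 1 ->
  \sum_(0 <= k < n) r ^+ k <= (1 - r)^-1.
Proof.
move=> /andP[r0 r1].
rewrite big_mkord -[leRHS]mul1r ler_pdivlMr ?subr_gt0// mulrC.
have := subrXX 1 r n; rewrite expr1n.
under eq_bigr do rewrite expr1n mul1r.
by move=> <-; rewrite gerBl exprn_ge0// ltW.
Qed.

Lemma geometric_increments_cvg (R : realType) (f : nat -> R) (c r : R) :
  0 < r < 1 -> (forall k, `|f k.+1 - f k| <= c * r ^+ k) ->
  cvgn f /\ forall n, `|f n - limn f| <= c / (1 - r) * r ^+ n.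
Proof.
move=> r01 fr; have /andP[r0 r1] := r01.
have r1' : 0 < 1 - r by rewrite subr_gt0.
have c0 : 0 <= c by have := fr 0; rewrite expr0 mulr1; apply: le_trans.
(* The factor [1 - r ^+ j], not merely 1, is what closes the induction; it is dropped in the
   limit. *)
have tel n j : `|f (n + j)%N - f n| <= c / (1 - r) * r ^+ n * (1 - r ^+ j).
  elim: j => [|j IH]; first by rewrite addn0 subrr normr0 expr0 subrr mulr0.
  rewrite (_ : f _ - f n = f (n + j).+1 - f (n + j)%N + (f (n + j)%N - f n)); last first.
    by rewrite addnS; ring.
  apply: le_trans (ler_normD _ _) _.
  apply: le_trans (lerD (fr _) IH) _.
  rewrite [leLHS](_ : _ = c / (1 - r) * r ^+ n * (1 - r ^+ j.+1))//.
  by rewrite exprD exprS; field; rewrite gt_eqF.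
have cf : cvgn f.
  have : cvgn (series (fun k => f k.+1 - f k)).
    apply: normed_cvg; apply: (@series_le_cvg _ _ (geometric c r)).
    - by move=> n; exact: normr_ge0.
    - by move=> n; rewrite /= mulr_ge0// exprn_ge0// ltW.
    - by move=> n; exact: fr.
    - by apply: is_cvg_geometric_series; rewrite gtr0_norm.
  move=> /cvg_ex[/= l cl]; apply/cvg_ex; exists (l + f 0%N).
  rewrite [X in X @ _](_ : _ = (fun n => series (fun k => f k.+1 - f k) n + f 0%N)).
    by apply: cvgD => //; exact: cvg_cst.
  by apply/funext => n; rewrite /series /= telescope_sumr// subrK.
split=> // n; rewrite distrC.
have c1 : (`|f (m + n)%N - f n|) @[m --> \oo] --> `|limn f - f n|.
  apply: cvg_norm; apply: cvgB; last exact: cvg_cst.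
  by rewrite cvg_shiftn.
rewrite -(cvg_lim _ c1)//; apply: limr_le; first exact: cvgP c1.
near=> m; rewrite addnC; apply: le_trans (tel _ _) _.
have r0' := ltW r0; have r1'' := ltW r1'.
have X0 : 0 <= c / (1 - r) * r ^+ n by rewrite mulr_ge0 ?divr_ge0 ?exprn_ge0.
by rewrite ler_piMr// gerBl exprn_ge0.
Unshelve. all: by end_near. Qed.

Section L2_complete.
Context d (T : measurableType d) (R : realType).
Variables (mu : {measure set T -> \bar R}) (D : set T).
Hypothesis mD : measurable D.

Local Notation N f := (ip mu D f f).

(* The limit is defined everywhere by the same pointwise formula, so that it is
   measurable for every sigma-algebra making all the [f n] measurable. *)
Lemma L2_complete (f : nat -> T -> R) (r C : R) : 0 < r < 1 ->
  (forall n, L2 mu D (f n)) ->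
  (forall n, N (fun x => f n.+1 x - f n x) <= C * r ^+ (4 * n)) ->
  let l := fun x => fine (limn_esup (fun n => (f n x)%:E)) in
  L2 mu D l /\
  exists K, forall n, N (fun x => f n x - l x) <= K * r ^+ n.
Proof.
move=> r01 Lf dC l; have /andP[r0 r1] := r01.
have mf n : measurable_fun D (f n) by case: (Lf n).
(* The squared increments have integral of order r ^ (4n). Dividing by r ^ (2n) leaves a summable
   series, so its sum [h] is integrable; where [h] is finite, the increments are at most sqrt(h) * r
   ^ n and the sequence converges. *)
pose u n x : \bar R := ((r ^+ (2 * n))^-1 * (f n.+1 x - f n x) ^+ 2)%:E.
have u0 n x : (0 <= u n x)%E.
  by rewrite lee_fin mulr_ge0 ?sqr_ge0// invr_ge0 exprn_ge0// ltW.
have mu_ n : measurable_fun D (u n).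
  apply/measurable_EFinP; apply: measurable_funM => //.
  by apply: measurable_funX; exact: measurable_funB.
pose h x := (\sum_(0 <= n <oo) u n x)%E.
have h0 x : (0 <= h x)%E by exact: nneseries_ge0.
have mh : measurable_fun D h.
  by apply: ge0_emeasurable_sum => //.
have C0 : 0 <= C.
  by have := dC 0%N; rewrite muln0 expr0 mulr1; apply: le_trans; exact: ip_ge0.
pose r2 := r ^+ 2.
have r201 : 0 < r2 < 1 by rewrite exprn_gt0//= exprn_ilt1// ltW.
pose M := C / (1 - r2).
have hM : (\int[mu]_(x in D) h x <= M%:E)%E.
  rewrite integral_nneseries//; apply: lime_le.
    by apply: is_cvg_nneseries => n _ _; exact: integral_ge0.
  near=> n; apply: (@le_trans _ _ (\sum_(0 <= k < n) (C * r2 ^+ k)%:E)%E).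
    apply: lee_sum => k _.
    have Lk := L2B mD (Lf k.+1) (Lf k).
    rewrite /u; under eq_integral do rewrite EFinM.
    rewrite ge0_integralZl//; last first.
    - by rewrite lee_fin invr_ge0 exprn_ge0// ltW.
    - by move=> x _; rewrite lee_fin sqr_ge0.
    - by apply/measurable_EFinP; apply: measurable_funX; exact: Lk.1.
    rewrite -ipsqrE// -EFinM lee_fin ler_pdivrMl ?exprn_gt0//.
    apply: le_trans (dC k) _.
    rewrite /r2 -exprM mulrCA -exprD.
    by rewrite (_ : 4 * k = 2 * k + 2 * k)%N// -mulnDl.
  rewrite sumEFin lee_fin -mulr_sumr /M ler_wpM2l//.
  exact: geometric_sum_le.
have M0 : 0 <= M by rewrite -lee_fin; apply: le_trans hM; exact: integral_ge0.
have ih : mu.-integrable D h.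
  apply/integrableP; split=> //.
  under eq_integral do rewrite gee0_abs//.
  by apply: le_lt_trans hM _; rewrite ltry.
pose c := (1 - r)^-1.
have c0 : 0 <= c by rewrite invr_ge0 subr_ge0 ltW.
have r0' := ltW r0.
have pt x : h x \is a fin_num -> cvgn (f ^~ x) /\ forall n,
    (f n x - l x) ^+ 2 <= (c * r ^+ n) ^+ 2 * fine (h x).
  move=> hf; pose H := fine (h x).
  have H0 : 0 <= H by exact: fine_ge0.
  have inc k : `|f k.+1 x - f k x| <= Num.sqrt H * r ^+ k.
    have : (u k x <= h x)%E.
      apply: le_trans (nneseries_lim_ge k.+1 _) => //.
      by rewrite big_nat_recr//= leeDr// sume_ge0.
    rewrite -(fineK hf) lee_fin ler_pdivrMl ?exprn_gt0// => hk.
    rewrite -sqrtr_sqr -[r ^+ k]ger0_norm ?exprn_ge0// -sqrtr_sqr -sqrtrM//.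
    by apply: ler_wsqrtr; rewrite -exprM mulnC mulrC.
  have [cf lb] := geometric_increments_cvg r01 inc; split=> // n.
  have -> : l x = limn (f ^~ x).
    rewrite /l; have e : ((f n x)%:E @[n --> \oo] --> (limn (f ^~ x))%:E)%E.
      by apply: cvg_EFin => //; exact: nearW.
    by rewrite is_cvg_limn_esupE ?(cvg_lim _ e)//; exact: cvgP e.
  rewrite -(real_normK (num_real _)) -[X in _ * X](@sqr_sqrtr _ H)//.
  rewrite -exprMn lerXn2r// ?nnegrE ?mulr_ge0 ?exprn_ge0 ?sqrtr_ge0//.
  by apply: le_trans (lb n) _; rewrite /c; lra.
have ml : measurable_fun D l.
  apply: measurableT_comp => //; apply: measurable_fun_limn_esup => n.
  exact/measurable_EFinP.
have aeh : {ae mu, forall x, D x -> h x \is a fin_num} by exact: integrable_ae.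
(* The pointwise rate carries the integrable factor [h], so integrating it gives the rate in L2. *)
have bnd n : (\int[mu]_(x in D) ((f n x - l x) ^+ 2)%:E <=
    ((c * r ^+ n) ^+ 2 * M)%:E)%E.
  apply: (@le_trans _ _ (\int[mu]_(x in D) (((c * r ^+ n) ^+ 2)%:E * h x))%E).
    apply: ae_ge0_le_integral => //.
    - by move=> x _; rewrite lee_fin sqr_ge0.
    - by apply/measurable_EFinP; apply: measurable_funX; exact: measurable_funB.
    - by move=> x _; rewrite mule_ge0// lee_fin sqr_ge0.
    - exact: measurable_funeM.
    apply: filterS aeh => x hx Dx.
    by rewrite -(fineK (hx Dx)) -EFinM lee_fin; case: (pt x (hx Dx)).
  by rewrite ge0_integralZl//= ?EFinM ?lee_wpmul2l// lee_fin sqr_ge0.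
have Lfl n : L2 mu D (fun x => f n x - l x).
  by split; [exact: measurable_funB|apply: le_lt_trans (bnd n) _; rewrite ltry].
split.
  have := L2B mD (Lf 0%N) (Lfl 0%N).
  by under eq_fun do rewrite opprB addrC subrK.
exists (c ^+ 2 * M) => n.
rewrite -lee_fin ipsqrE//; apply: le_trans (bnd n) _.
rewrite lee_fin exprMn mulrAC ler_wpM2l ?(mulr_ge0 (sqr_ge0 _) M0)//.
by rewrite -exprM ler_wiXn2l ?leq_pmulr// ltW.
Unshelve. all: by end_near. Qed.

End L2_complete.

(** * Regular conditional laws *)

Lemma ge0_integral_mrestr d (T : measurableType d) (R : realType)
    (mu : {measure set T -> \bar R}) (D : set T) (mD : measurable D)
    (f : T -> \bar R) :
  measurable_fun setT f -> (forall x, (0 <= f x)%E) ->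
  (\int[mrestr mu mD]_x f x = \int[mu]_(x in D) f x)%E.
Proof.
move=> mf f0.
rewrite (@ge0_negligible_integral _ _ _ _ setT (~` D))//=; first last.
- by rewrite /mrestr setICl measure0.
- exact: measurableC.
rewrite setTD setCK; apply: eq_measure_integral => A mA AD.
by transitivity (mu (A `&` D)); rewrite // setIidl.
Qed.

Section law.
Context d d' (T : measurableType d) (T' : measurableType d') (R : realType).

Definition law (P : probability T R) (f : T -> T')
    (mf : measurable_fun setT f) : probability T' R :=
  distribution P (mfun_Sub (mem_set mf)).

Lemma lawE (P : probability T R) f (mf : measurable_fun setT f) A :
  law P mf A = P (f @^-1` A).
Proof. by []. Qed.

Lemma ge0_integral_law (P : probability T R) f (mf : measurable_fun setT f)
    (g : T' -> \bar R) :
  measurable_fun setT g -> (forall y, (0 <= g y)%E) ->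
  (\int[law P mf]_y g y = \int[P]_x g (f x))%E.
Proof. by move=> mg g0; rewrite ge0_integral_distribution. Qed.

End law.

Section sub_sigma_algebra.
Context d (Omega : measurableType d) (R : realType) (P : probability Omega R).
Variable G : set (set Omega).
Hypothesis Gm : <<s G >> `<=` measurable.

Local Notation E := (g_sigma_algebraType G).

Lemma measurable_id_sub : measurable_fun setT (fun w : Omega => w : E).
Proof. by move=> _ A mA; rewrite setTI; exact: Gm. Qed.

Lemma measurable_fun_sub d' (T' : measurableType d') (f : Omega -> T') :
  measurable_fun (setT : set E) f -> measurable_fun setT f.
Proof. by move=> mf _ B mB; apply: Gm; exact: mf. Qed.

(** The restriction of [P] to the sigma-algebra generated by [G], as an image under the identity.
    Radon-Nikodym and Fubini applied to it return functions measurable for that smaller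
    sigma-algebra. *)
Definition subP : probability E R := law P measurable_id_sub.

Lemma ge0_integral_subP (A : set Omega) (f : Omega -> \bar R) :
  <<s G >> A -> measurable_fun (setT : set E) f -> (forall w, (0 <= f w)%E) ->
  (\int[subP]_(w in A) f w = \int[P]_(w in A) f w)%E.
Proof.
move=> GA mf f0; rewrite ge0_integral_pushforward//.
exact: measurable_funTS.
Qed.

Section cond_prob.
Variable B : set Omega.
Hypothesis mB : measurable B.

Definition joint_with (A : set E) : \bar R := P (A `&` B).

Let joint0 : joint_with set0 = 0%E.
Proof. by rewrite /joint_with set0I measure0. Qed.

Let joint_ge0 A : (0 <= joint_with A)%E. Proof. exact: measure_ge0. Qed.

Let joint_additive : semi_sigma_additive joint_with.
Proof.
move=> F mF tF mUF; rewrite /joint_with setI_bigcupl.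
apply: measure_semi_sigma_additive.
- by move=> i; apply: measurableI => //; apply: Gm; exact: mF.
- exact: trivIset_setIr.
- rewrite -setI_bigcupl; by apply: measurableI => //; exact: Gm.
Qed.

HB.instance Definition _ := isMeasure.Build _ _ _ joint_with
  joint0 joint_ge0 joint_additive.

Let joint_fin : fin_num_fun joint_with.
Proof. by move=> A mA; apply: fin_num_measure; apply: measurableI => //; exact: Gm. Qed.

HB.instance Definition _ := @Measure_isFinite.Build _ _ _ joint_with joint_fin.

(** A conditional probability of [B] is the density of [joint_with] with respect to the restriction
    of [P], which dominates it because P (A [&] B) <= P A. *)
Lemma cond_prob_exists : exists f : Omega -> R,
  [/\ measurable_fun (setT : set E) f, forall w, 0 <= f w &
      forall A, <<s G >> A -> P (A `&` B) = (\int[subP]_(w in A) (f w)%:E)%E].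
Proof.
have dom : joint_with `<< subP.
  apply/null_content_dominatesP => A mA A0; apply/eqP.
  have A0' : P A = 0%E := A0.
  rewrite eq_le measure_ge0 andbT -A0'; apply: le_measure; rewrite ?inE.
  - by apply: measurableI => //; exact: Gm.
  - exact: Gm.
  - by move=> w [].
have [f [f0 ff fi fA]] := radon_nikodym_sigma_finite dom.
exists (fine \o f); split.
- by apply: measurableT_comp => //; exact: measurable_int fi.
- by move=> w; rewrite /= fine_ge0.
- move=> A GA; rewrite -[LHS]/(joint_with A) fA//.
  by apply: eq_integral => w _; rewrite /= fineK.
Qed.

End cond_prob.

End sub_sigma_algebra.

(** An open ray is the increasing union of smaller ones. This carries comparisons made at rational
    levels over to every real level. *)
Lemma measure_ray_sup d (T : measurableType d) (R : realType)
    (mu : {measure set T -> \bar R}) (f : T -> \bar R) (x : R) (c : \bar R) :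
  measurable_fun setT f ->
  (forall y : R, (y < x)%R -> mu [set w | f w < y%:E] <= c)%E ->
  (mu [set w | f w < x%:E] <= c)%E.
Proof.
move=> mf h.
have mI (y : R) : measurable [set w | f w < y%:E]%E.
  by rewrite -[X in measurable X]setTI; exact: measurable_lte.
have -> : [set w | f w < x%:E]%E =
    \bigcup_n [set w | f w < (x - n.+1%:R^-1)%:E]%E.
  apply/seteqP; split=> w /=.
    move=> fx.
    have [y [fy yx]] : exists y : R, (f w < y%:E)%E /\ y < x.
      case: (f w) fx => [a| |]//.
        rewrite lte_fin => ax; exists ((a + x) / 2).
        by rewrite lte_fin !midf_lt.
      by move=> _; exists (x - 1); rewrite ltNyr gtrBl ltr01.
    have xy0 : 0 < x - y by rewrite subr_gt0.
    exists (Num.truncn (x - y)^-1) => //=.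
    apply: (lt_trans fy); rewrite lte_fin ltrBrDr -ltrBrDl.
    by rewrite -[ltRHS]invrK ltf_pV2 ?posrE ?invr_gt0// truncnS_gt.
  move=> [n _] /= /lt_le_trans; apply.
  by rewrite lee_fin gerBl.
have c1 := @nondecreasing_cvg_mu _ _ _ mu
  (fun n => [set w | f w < (x - n.+1%:R^-1)%:E]%E) (fun n => mI _)
  (bigcupT_measurable _ (fun n => mI _)).
have nd : nondecreasing_seq (fun n => [set w | f w < (x - n.+1%:R^-1)%:E]%E).
  move=> m n mn; apply/subsetPset => w /= /lt_le_trans.
  by apply; rewrite lee_fin lerB// lef_pV2 ?posrE// ler_nat.
rewrite -(cvg_lim _ (c1 nd))//.
apply: lime_le; first exact: cvgP (c1 nd).
by apply: nearW => n; apply: h; rewrite gtrBl invr_gt0.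
Qed.

(** Rays with real endpoints form a pi-system but never reach the point +oo, so the total masses
    have to be compared separately and [setT] is added to the system. *)
Lemma measure_rays_unique (R : realType)
    (m1 m2 : {measure set (\bar R) -> \bar R}) :
  (m1 setT < +oo)%E -> m1 setT = m2 setT ->
  (forall x : R, m1 `]-oo, x%:E[%E%classic = m2 `]-oo, x%:E[%E%classic) ->
  forall A, measurable A -> m1 A = m2 A.
Proof.
move=> m1oo mT mr A mA.
pose H := [set B : set (\bar R) | B = setT \/ exists r : R, B = `]-oo, r%:E[%classic].
apply: (@measure_unique _ _ _ H (fun=> setT)) => //.
- rewrite eqEsubset; split.
    rewrite [X in X `<=` _]ErealGenInftyO.measurableE.
    by apply: sub_smallest2r; [exact: smallest_sigma_algebra|move=> B [r ->]; right; exists r].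
  apply: smallest_sub; first exact: sigma_algebra_measurable.
  by move=> B [->//|[r ->]]; exact: emeasurable_itv.
- move=> B C [->|[r ->]] [->|[s ->]]; rewrite ?setTI ?setIT.
  + by left.
  + by right; exists s.
  + by right; exists r.
  + right; exists (Num.min r s); apply/seteqP; split=> y /=; rewrite !in_itv/= EFin_min lt_min.
      by move=> [-> ->].
    by move=> /andP[].
- by move=> _; left.
- by rewrite bigcup_const.
- by move=> B [->//|[r ->]]; exact: mr.
Qed.

(** On the set where g < f the two integrals agree over every measurable subset, one inequality
    being the hypothesis and the other pointwise; hence f = g almost everywhere there, and the set
    is null. *)
Lemma ae_le_of_integrals d (T : measurableType d) (R : realType)
    (mu : {measure set T -> \bar R}) (f g : T -> R) :
  measurable_fun setT f -> measurable_fun setT g ->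
  (forall x, 0 <= f x) -> (forall x, 0 <= g x) ->
  (\int[mu]_x (f x)%:E < +oo)%E ->
  (forall A, measurable A ->
     \int[mu]_(x in A) (f x)%:E <= \int[mu]_(x in A) (g x)%:E)%E ->
  mu [set x | g x < f x] = 0%E.
Proof.
move=> mf mg f0 g0 fi fg; set D := [set x | g x < f x].
have mD : measurable D.
  by rewrite -[X in measurable X]setTI; exact: (measurable_fun_ltr mg mf measurableT).
have := @integral_ae_eq _ _ _ mu D mD (EFin \o g) (EFin \o f).
have fint : mu.-integrable setT (EFin \o f).
  apply/integrableP; split; first exact/measurable_EFinP.
  by under eq_integral do rewrite /= ger0_norm//.
case.
- exact: integrableS fint.
- by apply/measurable_EFinP; exact: measurable_funTS.
- move=> A AD mA; apply/eqP; rewrite eq_le fg//=.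
  apply: ge0_le_integral => //.
  + by move=> x _; rewrite lee_fin.
  + by apply/measurable_EFinP; exact: measurable_funTS.
  + by apply/measurable_EFinP; exact: measurable_funTS.
  + by move=> x /AD; rewrite /D /= lee_fin => /ltW.
- move=> N [mN N0 sub]; apply/eqP; rewrite eq_le measure_ge0 andbT -N0.
  apply: le_measure; rewrite ?inE//.
  by move=> x Dx; apply: sub => /=; move=> /(_ Dx)[]; apply/eqP; rewrite gt_eqF.
Qed.

Lemma uniform_ray (R : realType) (c : R) : 0 <= c <= 1 ->
  uniform_prob (@ltr01 R) [set u | u < c] = c%:E.
Proof.
move=> /andP[c0 c1]; rewrite /uniform_prob integral_uniform_pdf.
have -> : [set u | u < c] `&` `[0, 1] = `[0, c[%classic.
  apply/seteqP; split=> u /=; rewrite !in_itv/=.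
    by move=> [-> /andP[->]].
  by move=> /andP[-> uc]; rewrite uc (le_trans (ltW uc)).
rewrite (eq_integral (cst 1%E)); last first.
  move=> u /set_mem /=; rewrite in_itv/= => /andP[u0 uc].
  by rewrite /uniform_pdf u0 (le_trans (ltW uc))// subr0 invr1.
rewrite integral_cst//= mul1e lebesgue_measure_itv/= lte_fin.
by case: ltgtP c0 => // [_ _|<- _]; rewrite ?oppr0 ?adde0.
Qed.

(** An enumeration of the rationals; codes that decode to nothing merely repeat 0. *)
Definition rat_seq (R : realType) (n : nat) : R := ratr (odflt 0 (unpickle n)).

Lemma rat_seq_dense (R : realType) (x y : R) : x < y ->
  exists n, x < rat_seq R n < y.
Proof.
move=> /rat_in_itvoo[q]; rewrite in_itv/= => xqy.
by exists (pickle q); rewrite /rat_seq pickleK.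
Qed.

Section conditional_quantile.
Context d (Omega : measurableType d) (R : realType) (P : probability Omega R).
Variable G : set (set Omega).
Hypothesis Gm : <<s G >> `<=` measurable.
Variable X : Omega -> R.
Hypothesis mX : measurable_fun setT X.

Local Notation E := (g_sigma_algebraType G).
Local Notation PG := (subP P Gm).
Local Notation rn := (rat_seq R).

Let mXr (c : R) : measurable [set w | X w < c].
Proof.
rewrite -[X in measurable X]setTI.
exact: (measurable_fun_ltr mX (measurable_cst c) measurableT).
Qed.

(** Each conditional probability is fixed only up to a null set. Over rational levels there are
    countably many violations of monotonicity or of the bound by 1, so they can be repaired
    together. *)
Lemma monotone_cond_cdf : exists F : nat -> Omega -> R,
  [/\ forall n, measurable_fun (setT : set E) (F n),
      forall n w, 0 <= F n w <= 1,
      forall n m w, rn n <= rn m -> F n w <= F m w &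
      forall n A, <<s G >> A ->
        P (A `&` [set w | X w < rn n]) = (\int[PG]_(w in A) (F n w)%:E)%E].
Proof.
have [F FP] := choice (fun n => cond_prob_exists P Gm (mXr (rn n))).
have mF n : measurable_fun (setT : set E) (F n) by case: (FP n).
have F0 n w : 0 <= F n w by case: (FP n).
have FA n A : <<s G >> A ->
    P (A `&` [set w | X w < rn n]) = (\int[PG]_(w in A) (F n w)%:E)%E.
  by case: (FP n) => _ _; exact.
have Ffin n : (\int[PG]_w (F n w)%:E < +oo)%E.
  have := FA n setT (@measurableT _ E); rewrite setTI => <-.
  by rewrite (le_lt_trans (probability_le1 _ (mXr _)))// ltry.
pose B1 n m : set E := if rn n <= rn m then [set w | F m w < F n w] else set0.
pose B2 n : set E := [set w | 1 < F n w].
have mB1 n m : measurable (B1 n m).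
  rewrite /B1; case: ifP => // _; rewrite -[X in measurable X]setTI.
  exact: (measurable_fun_ltr (mF m) (mF n) measurableT).
have mB2 n : measurable (B2 n).
  rewrite /B2 -[X in measurable X]setTI.
  exact: (measurable_fun_ltr (measurable_cst _) (mF n) measurableT).
have B10 n m : PG (B1 n m) = 0%E.
  rewrite /B1; case: ifP => [nm|_]; last exact: measure0.
  apply: ae_le_of_integrals => // A mA; rewrite -!FA//.
  apply: le_measure; rewrite ?inE; try by apply: measurableI => //; exact: Gm.
  by move=> w [Aw Xw]; split=> //; exact: lt_le_trans nm.
have B20 n : PG (B2 n) = 0%E.
  apply: (ae_le_of_integrals (g := cst 1)) => // A mA; rewrite -FA//.
  rewrite /= integral_cst// mul1e; apply: le_measure; rewrite ?inE//; last first.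
  - exact: Gm.
  - by apply: measurableI => //; exact: Gm.
pose N : set E := (\bigcup_n \bigcup_m B1 n m) `|` \bigcup_n B2 n.
have mN : measurable N.
  apply: measurableU; apply: bigcupT_measurable => // n.
  exact: bigcupT_measurable.
have N0 : PG N = 0%E.
  apply/(@negligibleP _ _ _ PG _ mN); apply: negligibleU.
    apply: negligible_bigcup => n; apply: negligible_bigcup => m.
    by apply/(@negligibleP _ _ _ PG _ (mB1 n m)); exact: B10.
  by apply: negligible_bigcup => n; apply/(@negligibleP _ _ _ PG _ (mB2 n)); exact: B20.
(* On the exceptional set, which belongs to the sigma-algebra, every level receives 0: still
   monotone, still in [0, 1], still measurable. *)
exists (fun n w => F n w * \1_(~` N) w); split.
- move=> n; apply: measurable_funM => //.
  by apply: measurable_indic; exact: measurableC.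
- move=> n w; rewrite indicE; have [wN|wN] := boolP (w \in ~` N); last first.
    by rewrite mulr0 lexx ler01.
  rewrite mulr1 F0/= leNgt; apply/negP => h.
  by move/set_mem: wN; apply; right; exists n.
- move=> n m w nm; rewrite !indicE; have [wN|wN] := boolP (w \in ~` N); last first.
    by rewrite !mulr0.
  rewrite !mulr1 leNgt; apply/negP => h; move/set_mem: wN; apply.
  by left; exists n => //; exists m => //; rewrite /B1 nm.
- move=> n A GA; rewrite FA//.
  have mA : (measurable : set (set E)) A by [].
  apply: ae_eq_integral => //.
  + by apply/measurable_EFinP; exact: measurable_funTS.
  + apply/measurable_EFinP; apply: measurable_funTS; apply: measurable_funM => //.
    by apply: measurable_indic; exact: measurableC.
  exists N; split=> // w /= /not_implyP[Aw ne]; apply: contrapT => nN.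
  by apply: ne; rewrite indicE mem_set ?mulr1.
Qed.

Local Notation U := (uniform_prob (@ltr01 R)).

(* The inverse transform: [Q w] is the quantile function of the conditional cdf,
   so that its law under the uniform probability is the conditional law. *)
Lemma conditional_quantile_exists : exists q : E * R -> R,
  measurable_fun setT q /\
  forall (f : R -> \bar R) A, measurable_fun setT f ->
    (forall x, (0 <= f x)%E) -> <<s G >> A ->
    (\int[P]_(w in A) f (X w) = \int[PG]_(w in A) \int[U]_u f (q (w, u)))%E.
Proof.
have [F [mF F01 Fmono FA]] := monotone_cond_cdf.
(* The strict inequality makes the event that [Q] lies below [x] a countable union of measurable
   sets. The infimum may be infinite. *)
pose Q (z : E * R) : \bar R := ereal_inf [set (rn n)%:E | n in [set n | z.2 < F n z.1]].
pose pi := (PG \x U)%E.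
have QE (x : R) : [set z | Q z < x%:E]%E =
    \bigcup_n (if rn n < x then [set z | z.2 < F n z.1] else set0).
  apply/seteqP; split=> z /=.
    by move=> /ereal_inf_lt[_ [n zn <-]]; rewrite lte_fin => nx; exists n; rewrite // nx.
  move=> [n _]; case: ifP => // nx /= zn.
  apply: (@le_lt_trans _ _ (rn n)%:E); last by rewrite lte_fin.
  by apply: ereal_inf_lbound; exists n.
have mS n : measurable [set z : E * R | z.2 < F n z.1].
  rewrite -[X in measurable X]setTI; apply: measurable_fun_ltr => //.
  by apply: measurableT_comp => //; exact: mF.
have mQx (x : R) : measurable [set z | Q z < x%:E]%E.
  by rewrite QE; apply: bigcupT_measurable => n; case: ifP.
have mQ : measurable_fun setT Q.
  apply: (measurability (@ErealGenInftyO.G R)).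
    exact: ErealGenInftyO.measurableE.
  move=> _ [_ [x ->] <-]; rewrite setTI.
  have -> : Q @^-1` `]-oo, x%:E[%classic = [set z | Q z < x%:E]%E.
    by apply/seteqP; split=> z /=; rewrite in_itv.
  exact: mQx.
(* By Fubini: the section at a point [w] of [A] is a ray of uniform mass [F n w]. *)
have piS A n : <<s G >> A -> pi ((A `*` setT) `&` [set z | z.2 < F n z.1]) =
    P (A `&` [set w | X w < rn n]).
  move=> GA; rewrite FA// /pi /= /product_measure1 [RHS]integral_mkcond.
  apply: eq_integral => w _ /=; rewrite patchE; case: ifPn => [wA|wA].
    rewrite -(uniform_ray (F01 n w)); congr (U _).
    by apply/seteqP; split=> u; rewrite /xsection /= inE /=; [case|split=> //; split=> //; exact: set_mem].
  rewrite (_ : xsection _ _ = set0) ?measure0//.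
  apply/seteqP; split=> u //; rewrite /xsection /= inE /= => -[[Aw _] _].
  by move: wA; rewrite mem_set.
have lepi (B C : set (E * R)) : measurable B -> measurable C -> B `<=` C ->
    (pi B <= pi C)%E.
  by move=> mB mC BC; apply: le_measure; rewrite ?inE.
exists (fine \o Q); split; first exact: measurableT_comp.
move=> f A mf f0 GA.
have mA : measurable A by exact: Gm.
have mAE : (measurable : set (set E)) A by [].
have mAT : measurable ((A : set E) `*` (setT : set R)) by exact: measurableX.
have mXe : measurable_fun setT (EFin \o X) by exact/measurable_EFinP.
(* The laws are compared in the extended reals, where [Q] takes its values. Both are integrated
   against [f \o fine], so the value that [fine] gives at infinity cannot matter. *)
pose m1 := pushforward (mrestr P mA) (mfun_Sub (mem_set mXe)).
pose m2 := pushforward (mrestr pi mAT) (mfun_Sub (mem_set mQ)).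
have m12 B : measurable B -> m1 B = m2 B.
  apply: (@measure_rays_unique _ m1 m2).
  - rewrite -[X in (X < _)%E]/(P (((EFin \o X) @^-1` setT) `&` A)) preimage_setT setTI.
    by rewrite (le_lt_trans (probability_le1 _ mA))// ltry.
  - rewrite -[LHS]/(P (((EFin \o X) @^-1` setT) `&` A)) preimage_setT setTI.
    rewrite -[RHS]/(pi ((Q @^-1` setT) `&` ((A : set E) `*` (setT : set R)))).
    rewrite preimage_setT setTI /pi product_measure1E//.
    by rewrite -[LHS]mule1; congr (_ * _)%E; exact/esym/probability_setT.
  move=> x.
  have m1E : m1 `]-oo, x%:E[%classic = P (A `&` [set w | X w < x]).
    by rewrite /m1 /pushforward /mrestr setIC; congr (P (_ `&` _)).
  have m2E (y : R) : m2 `]-oo, y%:E[%classic = mrestr pi mAT [set z | Q z < y%:E]%E.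
    by rewrite /m2 /pushforward; congr (mrestr _ _ _).
  apply: (eq_trans m1E); apply: (eq_trans _ (esym (m2E x))).
  (* For y < [rn n] < x, the event X < y lies in X < [rn n], whose mass is that of u < F n, itself
     contained in Q < x. Conversely Q < y forces u < F n by monotonicity in the level. *)
  apply/eqP; rewrite eq_le; apply/andP; split.
    have -> : P (A `&` [set w | X w < x]) = mrestr P mA [set w | (X w)%:E < x%:E]%E.
      by rewrite /mrestr setIC.
    apply: measure_ray_sup => // y yx.
    have [n /andP[yn nx]] := rat_seq_dense yx.
    apply: (@le_trans _ _ (P (A `&` [set w | X w < rn n]))).
      rewrite /mrestr setIC; apply: (@le_measure _ _ _ P); rewrite ?inE.
      - by apply: measurableI => //; exact: (mXr y).
      - by apply: measurableI => //; exact: mXr.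
      - by apply: setSI => w /=; rewrite lte_fin => Xy; exact: lt_trans yn.
    rewrite -(piS A n GA) /mrestr setIC; apply: lepi.
    - by apply: measurableI => //; exact: mS.
    - by apply: measurableI => //; exact: mQx.
    - by apply: setISS => // z zn; rewrite QE; exists n => //; rewrite nx.
  apply: measure_ray_sup => // y yx.
  have [n /andP[yn nx]] := rat_seq_dense yx.
  apply: (@le_trans _ _ (P (A `&` [set w | X w < rn n]))); last first.
    apply: (@le_measure _ _ _ P); rewrite ?inE.
    - by apply: measurableI => //; exact: mXr.
    - by apply: measurableI => //; exact: mXr.
    - by move=> w [Aw] /= Xn; split=> //; exact: lt_trans nx.
  rewrite -(piS A n GA) /mrestr setIC; apply: lepi.
  - by apply: measurableI => //; exact: mQx.
  - by apply: measurableI => //; exact: mS.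
  - apply: setISS => // z; rewrite QE => -[k _]; case: ifP => // ky /= zk.
    by apply: lt_le_trans zk _; apply: Fmono; apply: ltW; exact: lt_trans yn.
have mff : measurable_fun setT (f \o fine) by exact: measurableT_comp.
have mfQ : measurable_fun setT (fine \o Q) by exact: measurableT_comp.
transitivity (\int[mrestr P mA]_w (f \o fine) (EFin (X w)))%E.
  exact/esym/(ge0_integral_mrestr P mA (measurableT_comp mf mX) (fun w => f0 (X w))).
transitivity (\int[m1]_y (f \o fine) y)%E.
  by rewrite /m1 ge0_integral_pushforward//; move=> *; exact: f0.
transitivity (\int[m2]_y (f \o fine) y)%E.
  by apply: eq_measure_integral => B mB _; exact: m12.
transitivity (\int[mrestr pi mAT]_z f ((fine \o Q) z))%E.
  by rewrite /m2 ge0_integral_pushforward//; move=> *; exact: f0.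
rewrite (ge0_integral_mrestr pi mAT (measurableT_comp mf mfQ) (fun z => f0 _)).
rewrite integral_mkcond [RHS]integral_mkcond fubini_tonelli1//.
- apply: eq_integral => w _; rewrite /fubini_F patchE; case: ifPn => wA.
    by apply: eq_integral => u _; rewrite patchE ifT// inE; split=> //; exact: set_mem.
  apply: integral0_eq => u _; rewrite patchE ifF//; apply: contraNF wA.
  by rewrite !inE => -[].
- apply/(measurable_restrictT _ mAT); apply: measurable_funTS.
  exact: (measurableT_comp mf mfQ).
- by move=> z; rewrite patchE; case: ifP => // _; exact: f0.
Qed.

End conditional_quantile.

Definition dirac0_P2 (R : realType) : P2 R.
Proof.
apply: (@MkP2 R (dirac (0 : R))).
rewrite integral_dirac//=; last by apply/measurable_EFinP; exact: measurable_funX.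
by rewrite diracT mul1e expr0n/= ltry.
Defined.

Section regular_cond_law_existence.
Context d (Omega : measurableType d) (R : realType) (P : probability Omega R).
Variable G : set (set Omega).
Hypothesis Gm : <<s G >> `<=` measurable.

Local Notation E := (g_sigma_algebraType G).
Local Notation PG := (subP P Gm).
Local Notation U := (uniform_prob (@ltr01 R)).

(** Asked of all nonnegative integrands rather than of indicators: the rounding errors below are
    integrated against conditional laws. *)
Definition disintegrates (X : Omega -> R) (m : Omega -> P2 R) :=
  forall f : R -> \bar R, measurable_fun setT f -> (forall x, (0 <= f x)%E) ->
    measurable_fun (setT : set E) (fun w => \int[m w]_x f x)%E /\
    forall A, <<s G >> A ->
      (\int[P]_(w in A) \int[m w]_x f x = \int[P]_(w in A) f (X w))%E.

Lemma disintegrates_regular_cond_law (X : Omega -> R) m :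
  measurable_fun setT X -> disintegrates X m -> regular_cond_law P G X m.
Proof.
move=> mX dm B mB.
have f0 x : (0 <= (\1_B x)%:E :> \bar R)%E by rewrite lee_fin.
have mf : measurable_fun setT (fun x : R => (\1_B x)%:E : \bar R).
  by apply/measurable_EFinP; exact: measurable_indic.
have [mm mA] := dm _ mf f0.
have mE w : (\int[m w]_x (\1_B x)%:E)%E = m w B by rewrite integral_indic// setIT.
split.
  by apply: eq_measurable_fun mm => w _; rewrite mE.
move=> A GA; under eq_integral do rewrite -mE.
rewrite mA// setIC.
under [RHS]eq_integral do rewrite -[\1_B _]/(\1_(X @^-1` B) _).
by rewrite integral_indic//; [exact: Gm|rewrite -[X in measurable X]setTI; exact: mX].
Qed.

(** The law at [w] is the image of the uniform probability under [q (w, _)]. Its second moment [V]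
    is integrable, hence finite almost surely. *)
Lemma regular_cond_law_exists (X : Omega -> R) : measurable_fun setT X ->
  (\int[P]_w (X w ^+ 2)%:E < +oo)%E -> exists m, disintegrates X m.
Proof.
move=> mX X2.
have [q [mq qA]] := conditional_quantile_exists P Gm mX.
have mqw w : measurable_fun setT (fun u => q (w, u)).
  exact: (measurableT_comp mq (pair1_measurable _)).
pose m0 w := law U (mqw w).
have m0E w (f : R -> \bar R) : measurable_fun setT f -> (forall x, 0 <= f x)%E ->
    (\int[m0 w]_x f x = \int[U]_u f (q (w, u)))%E.
  by move=> mf f0; rewrite ge0_integral_law.
have mI (f : R -> \bar R) : measurable_fun setT f -> (forall x, 0 <= f x)%E ->
    measurable_fun (setT : set E) (fun w => \int[U]_u f (q (w, u)))%E.
  move=> mf f0.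
  apply: (@measurable_fun_fubini_tonelli_F _ _ _ _ _ U (fun z => f (q z))) => //.
  exact: measurableT_comp.
pose V w := (\int[U]_u ((q (w, u)) ^+ 2)%:E)%E.
have msq : measurable_fun setT (fun x : R => (x ^+ 2)%:E).
  by apply/measurable_EFinP; exact: measurable_funX.
have sq0 (x : R) : (0 <= (x ^+ 2)%:E)%E by rewrite lee_fin sqr_ge0.
have mV : measurable_fun (setT : set E) V by exact: (mI _ msq sq0).
have momV w : (V w < +oo)%E -> (\int[m0 w]_x (x ^+ 2)%:E < +oo)%E.
  by rewrite m0E.
(* Membership in [P2] is required at every point, so a Dirac mass replaces the law where [V] is
   infinite. That null event is measurable for the sub-sigma-algebra, as [V] is. *)
pose m w := if pselect (V w < +oo)%E is left h then MkP2 (momV w h) else dirac0_P2 R.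
exists m => f mf f0.
have mE w : (\int[m w]_x f x =
    if (V w < +oo)%E then \int[U]_u f (q (w, u)) else f 0%R)%E.
  rewrite /m; case: pselect => [h|h]; first by rewrite h /= m0E.
  by rewrite ifF ?integral_dirac ?diracT ?mul1e//; apply/negP.
split.
  under eq_fun do rewrite mE.
  apply: measurable_fun_ifT => //; last exact: mI.
  by apply: measurable_fun_lte => //; exact: measurable_cst.
move=> A GA; rewrite [RHS](qA f A mf f0 GA).
rewrite -(ge0_integral_subP P Gm GA); first last.
- by move=> w; exact: integral_ge0.
- under eq_fun do rewrite mE.
  apply: measurable_fun_ifT => //; last exact: mI.
  by apply: measurable_fun_lte => //; exact: measurable_cst.
have mAE : (measurable : set (set E)) A by [].
apply: ge0_ae_eq_integral => //.
- apply: measurable_funTS; under eq_fun do rewrite mE.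
  apply: measurable_fun_ifT => //; last exact: mI.
  by apply: measurable_fun_lte => //; exact: measurable_cst.
- by apply: measurable_funTS; exact: mI.
- by move=> w _; exact: integral_ge0.
- by move=> w _; exact: integral_ge0.
have iV : PG.-integrable setT V.
  apply/integrableP; split=> //.
  under eq_integral do rewrite gee0_abs ?integral_ge0//.
  by rewrite -(qA (fun x => (x ^+ 2)%:E) setT msq sq0)//; exact: (@measurableT _ E).
have := integrable_ae (@measurableT _ E) iV; apply: filterS => w Vw Aw.
by rewrite mE ltey_eq Vw.
Qed.

End regular_cond_law_existence.

(** * Wasserstein distance of discretised laws *)

Lemma W2_sqr_le (R : realType) (m m' : P2 R) (gamma : probability (R * R)%type R)
    (c : R) : coupling m m' gamma ->
  (\int[gamma]_z ((z.1 - z.2) ^+ 2)%:E <= c%:E)%E -> W2 m m' ^+ 2 <= c.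
Proof.
move=> cg gc; rewrite /W2; set S := [set _ | _ in _].
have S0 : (0 <= ereal_inf S)%E.
  apply: le_ereal_inf_tmp => _ [g _ <-].
  by apply: integral_ge0 => z _; rewrite lee_fin sqr_ge0.
have Sc : (ereal_inf S <= c%:E)%E.
  by apply: le_trans gc; apply: ereal_inf_lbound; exists gamma.
(* The given coupling makes the infimum finite, so [fine] in [W2] returns its true value. *)
have Sf : ereal_inf S \is a fin_num.
  by rewrite ge0_fin_numE// (le_lt_trans Sc)// ltry.
by rewrite sqr_sqrtr ?fine_ge0// -lee_fin fineK.
Qed.

Lemma W2_sqr_le_joint d (T : measurableType d) (R : realType)
    (Q : probability T R) (f g : T -> R) (m m' : P2 R) (c : R) :
  measurable_fun setT f -> measurable_fun setT g ->
  (forall A, measurable A -> m A = Q (f @^-1` A)) ->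
  (forall A, measurable A -> m' A = Q (g @^-1` A)) ->
  (\int[Q]_x ((f x - g x) ^+ 2)%:E <= c%:E)%E -> W2 m m' ^+ 2 <= c.
Proof.
move=> mf mg mE mE' h.
have mfg : measurable_fun setT (fun x => (f x, g x)) by exact: measurable_fun_pair.
apply: (@W2_sqr_le _ _ _ (law Q mfg)).
  by move=> A mA; split; apply/esym; [exact: (mE A mA)|exact: (mE' A mA)].
rewrite ge0_integral_law//; last by move=> z; rewrite lee_fin sqr_ge0.
by apply/measurable_EFinP; apply: measurable_funX; exact: measurable_funB.
Qed.

Lemma mnormalize1E d (T : measurableType d) (R : realType)
    (mu : {measure set T -> \bar R}) (P : probability T R) A :
  mu setT = 1%E -> mnormalize mu P A = mu A.
Proof. by move=> mu1; rewrite /mnormalize mu1 onee_eq0/= invr1 mule1. Qed.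

Section discrete_coupling.
Context (R : realType) (k : nat) (z : nat -> R) (p p' : nat -> R) (M delta : R).
Hypothesis p0 : forall i, 0 <= p i.
Hypothesis p0' : forall i, 0 <= p' i.
Hypothesis p1 : \sum_(i < k) p i = 1.
Hypothesis p1' : \sum_(i < k) p' i = 1.
Hypothesis pp' : forall i, (i < k)%N -> `|p i - p' i| <= delta.
Hypothesis zM : forall i, (i < k)%N -> `|z i| <= M.

Let q i := Num.min (p i) (p' i).
Let r := 1 - \sum_(i < k) q i.

Let q_ge0 i : 0 <= q i. Proof. by rewrite /q le_min p0 p0'. Qed.
Let q_le i : q i <= p i. Proof. by rewrite /q ge_min lexx. Qed.
Let q_le' i : q i <= p' i. Proof. by rewrite /q ge_min lexx orbT. Qed.

Let rE : r = \sum_(i < k) (p i - q i).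
Proof. by rewrite sumrB p1. Qed.

Let rE' : r = \sum_(i < k) (p' i - q i).
Proof. by rewrite sumrB p1'. Qed.

Let r_ge0 : 0 <= r.
Proof. by rewrite rE; apply: sumr_ge0 => i _; rewrite subr_ge0. Qed.

Let r_le : r <= k%:R * delta.
Proof.
rewrite rE; apply: (@le_trans _ _ (\sum_(i < k) delta)); last first.
  by rewrite sumr_const card_ord mulr_natl.
apply: ler_sum => i _; have := pp' (ltn_ord i); rewrite /q.
by case: (leP (p i) (p' i)) => [h|/ltW h]; [rewrite subrr; apply: le_trans|rewrite ger0_norm// subr_ge0].
Qed.

(* The common part of the two weights stays put; the rest, of mass [r], is
   coupled independently (for [r = 0] the residual weights vanish, and so does
   the junk value of the quotient). *)
Let c i j : R := (i == j)%:R * q i + (p i - q i) * (p' j - q j) / r.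

Let c_ge0 i j : 0 <= c i j.
Proof.
rewrite /c addr_ge0 ?mulr_ge0//; last by rewrite invr_ge0.
- by rewrite subr_ge0.
- by rewrite subr_ge0.
Qed.

Let resid0 (i : nat) (s : nat -> R) : (i < k)%N -> (forall i, q i <= s i) ->
  r = \sum_(i < k) (s i - q i) -> (s i - q i) * (r / r) = s i - q i.
Proof.
move=> ik qs rs; have [r0|r0] := eqVneq r 0; last by rewrite divff// mulr1.
suff -> : s i - q i = 0 by rewrite mul0r.
apply/eqP; rewrite eq_le subr_ge0 qs andbT -r0 rs (bigD1 (Ordinal ik))//= lerDl.
by apply: sumr_ge0 => j _; rewrite subr_ge0.
Qed.

Let c_row i : (i < k)%N -> \sum_(j < k) c i j = p i.
Proof.
move=> ik; rewrite /c big_split/=.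
rewrite [X in X + _](_ : _ = q i); last first.
  rewrite (bigD1 (Ordinal ik))//= eqxx mul1r big1 ?addr0// => j ji.
  by rewrite (_ : i == j = false) ?mul0r//; apply: contraNF ji => /eqP ij; apply/eqP/val_inj.
by rewrite -mulr_suml -mulr_sumr -rE' -mulrA resid0// subrKC.
Qed.

Let c_col j : (j < k)%N -> \sum_(i < k) c i j = p' j.
Proof.
move=> jk; rewrite /c big_split/=.
rewrite [X in X + _](_ : _ = q j); last first.
  rewrite (bigD1 (Ordinal jk))//= eqxx mul1r big1 ?addr0// => i ij.
  by rewrite (_ : _ == j = false) ?mul0r//; apply: contraNF ij => /eqP ij; apply/eqP/val_inj.
by rewrite -mulr_suml -mulr_suml -rE [r * _]mulrC -mulrA resid0// subrKC.
Qed.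

Let g : {measure set (R * R) -> \bar R} :=
  msum (fun i => msum (fun j => mscale (NngNum (c_ge0 i j)) (dirac (z i, z j))) k) k.

Let gE A : g A = (\sum_(i < k) \sum_(j < k) ((c i j)%:E * (\1_A (z i, z j))%:E))%E.
Proof. by []. Qed.

Let g_integral (f : R * R -> R) : measurable_fun setT f -> (forall x, 0 <= f x) ->
  (\int[g]_x (f x)%:E = (\sum_(i < k) \sum_(j < k) (c i j * f (z i, z j)))%:E)%E.
Proof.
move=> mf f0; have f0' x : setT x -> (0 <= (f x)%:E)%E by rewrite lee_fin.
have mf' : measurable_fun setT (fun x => (f x)%:E) by exact/measurable_EFinP.
rewrite ge0_integral_measure_sum// -sumEFin; apply: eq_bigr => i _.
rewrite ge0_integral_measure_sum// -sumEFin; apply: eq_bigr => j _.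
by rewrite ge0_integral_mscale//= integral_dirac//= diracT mul1e.
Qed.

(** Only the mass [r], at most [k%:R * delta], is moved, and two points of [-M, M] are at distance
    at most [2 * M]. *)
Lemma W2_discrete (m m' : P2 R) :
  (forall A, measurable A -> m A = (\sum_(i < k) (p i * \1_A (z i))%:E)%E) ->
  (forall A, measurable A -> m' A = (\sum_(i < k) (p' i * \1_A (z i))%:E)%E) ->
  W2 m m' ^+ 2 <= k%:R * delta * (2 * M) ^+ 2.
Proof.
move=> mE mE'.
have g1 : g setT = 1%E.
  rewrite gE -[RHS]/(1%:E) -p1 -sumEFin; apply: eq_bigr => i _.
  rewrite -(c_row (ltn_ord i)) -sumEFin; apply: eq_bigr => j _.
  by rewrite indicT mule1.
(* The weights already sum to 1; normalising changes nothing but provides the structure of a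
   probability. *)
pose gam : probability (R * R)%type R := mnormalize g (dirac ((0 : R), (0 : R))).
have gamE A : gam A = g A by exact: mnormalize1E.
apply: (@W2_sqr_le _ _ _ gam).
  move=> A mA; rewrite (mE A mA) (mE' A mA) !gamE !gE; split.
    apply: eq_bigr => i _; rewrite -(c_row (ltn_ord i)) mulr_suml -sumEFin.
    by apply: eq_bigr => j _.
  rewrite exchange_big/=; apply: eq_bigr => j _.
  rewrite -(c_col (ltn_ord j)) mulr_suml -sumEFin.
  by apply: eq_bigr => i _.
rewrite (eq_measure_integral g); last by move=> A mA _; exact: gamE.
rewrite g_integral; last 2 first.
- by apply: measurable_funX; exact: measurable_funB.
- by move=> x; rewrite sqr_ge0.
rewrite lee_fin /=.
apply: (@le_trans _ _ (r * (2 * M) ^+ 2)); last by rewrite ler_wpM2r ?sqr_ge0.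
have -> : r * (2 * M) ^+ 2 =
    \sum_(i < k) \sum_(j < k) ((p i - q i) * (p' j - q j) / r * (2 * M) ^+ 2).
  transitivity (r * r / r * (2 * M) ^+ 2).
    by have [->|r0] := eqVneq r 0; [rewrite !mul0r|rewrite mulfK].
  rewrite {1}rE !mulr_suml; apply: eq_bigr => i _.
  rewrite {1}rE' mulr_sumr !mulr_suml; apply: eq_bigr => j _.
  by rewrite -!mulrA.
apply: ler_sum => i _; apply: ler_sum => j _.
rewrite /c mulrDl.
have -> : (i == j :> nat)%:R * q i * (z i - z j) ^+ 2 = 0.
  by have [->|] := eqVneq (i : nat) j; rewrite ?subrr ?expr0n ?mulr0// !mul0r.
rewrite add0r ler_wpM2l//.
  by rewrite mulr_ge0 ?invr_ge0// mulr_ge0// subr_ge0.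
have M0 : 0 <= M by apply: le_trans (zM (ltn_ord i)); exact: normr_ge0.
rewrite -(real_normK (num_real (_ - _))) lerXn2r// ?nnegrE ?mulr_ge0//.
apply: le_trans (ler_normB _ _) _.
have := zM (ltn_ord i); have := zM (ltn_ord j); lra.
Qed.

End discrete_coupling.

Lemma truncn_eqP (R : realType) (y : R) (a : nat) : 0 <= y ->
  (Num.truncn y == a) = (a%:R <= y < a.+1%:R).
Proof.
move=> y0; apply/eqP/idP => [<-|]; first exact: truncn_itv.
exact: truncn_def.
Qed.

(** Each [N%:R * f i] is rounded down to an integer, and [V] records the vector of results. Equal
    integer parts keep two values within 1/N of each other. *)
Lemma finite_oscillation_partition d (E : measurableType d) (R : realType)
    (k : nat) (f : nat -> E -> R) (N : nat) : (0 < N)%N ->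
  (forall i, measurable_fun setT (f i)) -> (forall i w, 0 <= f i w <= 1) ->
  exists (I : finType) (V : E -> I), (forall v, measurable (V @^-1` [set v])) /\
    forall w w', V w = V w' -> forall i, (i < k)%N -> `|f i w - f i w'| <= N%:R^-1.
Proof.
move=> N0 mf f01; have N0' : 0 < N%:R :> R by rewrite ltr0n.
elim: k => [|k [I [V [mV Vosc]]]].
  exists unit, (fun=> tt); split=> // -[]; rewrite (_ : _ @^-1` _ = setT)//.
  by apply/seteqP.
pose t w := Num.truncn (N%:R * f k w).
have y0 w : 0 <= N%:R * f k w by rewrite mulr_ge0//; case/andP: (f01 k w).
(* The value [N] does occur, when [f k w = 1]; hence [N.+1] possible integers. *)
have tN w : (t w < N.+1)%N.
  rewrite -(@ltr_nat R); have /andP[tw _] := truncn_itv (y0 w).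
  apply: le_lt_trans tw _; apply: (@le_lt_trans _ _ N%:R); last by rewrite ltr_nat.
  by rewrite ler_piMr//; case/andP: (f01 k w).
exists (I * 'I_N.+1)%type, (fun w => (V w, inord (t w))); split.
  move=> [v a].
  have -> : (fun w => (V w, inord (t w) : 'I_N.+1)) @^-1` [set (v, a)] =
      V @^-1` [set v] `&` (fun w => N%:R * f k w) @^-1` `[a%:R, a.+1%:R[.
    apply/seteqP; split=> w /=.
      by move=> [-> <-]; split=> //; rewrite inordK// in_itv/= -truncn_eqP.
    move=> [->]; rewrite in_itv/= -truncn_eqP// => /eqP ta; congr pair.
    by apply: val_inj; rewrite /= inordK.
  apply: measurableI => //; rewrite -[X in measurable X]setTI.
  by apply: measurable_funM => //; exact: measurable_itv.
move=> w w' [Vw tw] i; rewrite ltnS leq_eqVlt => /predU1P[->|]; last exact: Vosc.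
have {}tw : t w = t w' by rewrite -(inordK (tN w)) tw inordK.
have /andP[h1 h2] := truncn_itv (y0 w); have /andP[] := truncn_itv (y0 w').
rewrite -/(t w') -tw => h3 h4.
rewrite -[leRHS]mul1r ler_pdivlMr// -[X in _ * X]gtr0_norm// -normrM.
rewrite mulrBl ![f k _ * _]mulrC ler_norml; move: h1 h2 h3 h4.
rewrite -/(t w) -natr1; lra.
Qed.

(** * Rounding to a finite grid *)

Section discretization.
Context (R : realType) (n : nat).
Local Notation N := (n.+1%:R : R).

Definition grid (i : nat) : R := i%:R / N - N.
Definition grid_size := (2 * (n.+1 * n.+1))%N.
(** With N = [n.+1] both as range and as inverse mesh, [-N, N[ is cut into 2 N^2 intervals and
    rounded down to their left ends. Outside every indicator vanishes and the value is 0, itself a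
    grid point. *)
Definition disc (x : R) : R :=
  \sum_(i < grid_size) grid i * \1_(`[grid i, grid i.+1[%classic) x.

Let N0 : 0 < N. Proof. by []. Qed.

Lemma measurable_disc : measurable_fun setT disc.
Proof.
apply: measurable_sum => i; exact: measurable_funM.
Qed.

Let grid_itv i x : (x \in (`[grid i, grid i.+1[ : interval R)) =
  (i%:R <= (x + N) * N < i.+1%:R).
Proof.
by rewrite in_itv/= /grid lerBlDr ltrBrDr ler_pdivrMr// ltr_pdivlMr.
Qed.

Let size_grid : grid_size%:R = (N + N) * N.
Proof. by rewrite /grid_size !natrM; ring. Qed.

Lemma disc_in x : - N <= x < N -> exists2 j, (j < grid_size)%N &
  disc x = grid j /\ (x - disc x) ^+ 2 <= N^-1 ^+ 2.
Proof.
move=> /andP[xN Nx]; have y0 : 0 <= (x + N) * N by rewrite mulr_ge0//; lra.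
pose j := Num.truncn ((x + N) * N).
have /andP[j1 j2] := truncn_itv y0; rewrite -/j in j1 j2.
have jk : (j < grid_size)%N.
  rewrite -(ltr_nat R) size_grid; apply: le_lt_trans j1 _.
  by rewrite ltr_pM2r//; lra.
have dj : disc x = grid j.
  rewrite /disc (bigD1 (Ordinal jk))//= big1 ?addr0.
    by rewrite indicE mem_set ?mulr1//= grid_itv j1.
  move=> i ij; rewrite indicE memNset ?mulr0//= grid_itv -truncn_eqP//.
  by move=> /eqP ji; move/eqP: ij; apply; apply: val_inj; rewrite /= -ji.
exists j => //; split=> //; rewrite dj -(real_normK (num_real _)).
rewrite lerXn2r// ?nnegrE ?invr_ge0//.
have : j%:R / N <= x + N by rewrite ler_pdivrMr.
have : x + N < j%:R / N + N^-1.
  have -> : j%:R / N + N^-1 = (j%:R + 1) / N by rewrite mulrDl mul1r.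
  by rewrite ltr_pdivlMr// natr1.
rewrite /grid ler_norml.
by move: (n.+1%:R^-1) (j%:R / n.+1%:R) => u v h1 h2; move: (n.+1%:R) h1 h2 => N' h1 h2; lra.
Qed.

Lemma disc_out x : ~~ (- N <= x < N) -> disc x = 0.
Proof.
move=> xN; rewrite /disc big1// => i _; rewrite indicE memNset ?mulr0//=.
rewrite grid_itv => /andP[i1 i2]; move/negP: xN; apply.
have y0 : 0 <= (x + N) * N by apply: le_trans i1.
have y1 : (x + N) * N < (N + N) * N.
  by rewrite -size_grid; apply: lt_le_trans i2 _; rewrite ler_nat.
move: y0 y1; rewrite pmulr_lge0// ltr_pM2r//; lra.
Qed.

Lemma disc_grid x : exists2 j, (j < grid_size)%N & disc x = grid j.
Proof.
have [/disc_in[j jk []]|/disc_out ->] := boolP (- N <= x < N); first by exists j.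
(* The grid point with this index is 0, the value of [disc] outside the range. *)
exists (n.+1 * n.+1)%N; first by rewrite /grid_size mul2n -addnn -[ltnLHS]addn0 ltn_add2l.
by rewrite /grid natrM mulfK ?subrr.
Qed.

Lemma grid_inj : injective grid.
Proof.
move=> i j /addIr /divIf -/(_ (lt0r_neq0 N0)) /eqP.
by rewrite eqr_nat => /eqP.
Qed.

Lemma grid_bound i : (i < grid_size)%N -> `|grid i| <= N.
Proof.
move=> ik; have i0 : 0 <= i%:R / N by rewrite divr_ge0.
have : i%:R / N <= N + N.
  by rewrite ler_pdivrMr// -size_grid ler_nat ltnW.
by rewrite /grid ler_norml; move: (n.+1%:R) N0 (i%:R / n.+1%:R) i0 => v v0 u u0; lra.
Qed.

(** The bound is uniform in [n]: it is the dominating function in [disc_L2_cvg], and it makes the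
    rounding error integrable against every element of [P2]. *)
Lemma disc_err x : (x - disc x) ^+ 2 <= 1 + x ^+ 2.
Proof.
have [/disc_in[j _ [_]]|/disc_out ->] := boolP (- N <= x < N).
  have i1 : N^-1 <= 1 by rewrite invf_le1// ler1n.
  have i0 : 0 <= N^-1 by rewrite invr_ge0.
  have := sqr_ge0 x; have : N^-1 ^+ 2 <= 1 by rewrite expr_le1.
  by move: (N^-1 ^+ 2) => u; lra.
by rewrite subr0 lerDr.
Qed.

Lemma disc_moment (m : P2 R) :
  (\int[law m measurable_disc]_x (x ^+ 2)%:E < +oo)%E.
Proof.
rewrite ge0_integral_law//=; last 2 first.
- by apply/measurable_EFinP; exact: measurable_funX.
- by move=> x; rewrite lee_fin sqr_ge0.
apply: (@le_lt_trans _ _ (\int[m]_x (N ^+ 2)%:E)%E).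
  apply: ge0_le_integral => //.
  - by move=> x _; rewrite lee_fin sqr_ge0.
  - by apply/measurable_EFinP; apply: measurable_funX; exact: measurable_disc.
  - move=> x _; rewrite lee_fin -(real_normK (num_real (disc x))) lerXn2r ?nnegrE//.
    by have [j jk ->] := disc_grid x; exact: grid_bound.
by rewrite integral_cst//= probability_setT mule1 ltry.
Qed.

Definition disc_P2 (m : P2 R) : P2 R := MkP2 (disc_moment m).

(** A preimage and not the interval itself: the cell of the grid point 0 also contains everything
    outside the range, so that the cells cover the line. *)
Definition cell i : set R := disc @^-1` [set grid i].

Lemma measurable_cell i : measurable (cell i).
Proof. by rewrite -[X in measurable X]setTI; apply: measurable_disc. Qed.

Lemma disc_P2E (m : P2 R) A : measurable A ->
  disc_P2 m A = (\sum_(i < grid_size) (fine (m (cell i)) * \1_A (grid i))%:E)%E.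
Proof.
move=> mA; rewrite /= /law /=.
transitivity (m (disc @^-1` A)) => //.
have mdA : measurable (disc @^-1` A).
  by rewrite -[X in measurable X]setTI; exact: measurable_disc.
transitivity (\int[m]_x (\1_(disc @^-1` A) x)%:E)%E.
  by rewrite integral_indic// setIT.
transitivity (\int[m]_x (\sum_(i < grid_size) (\1_A (grid i) * \1_(cell i) x)%:E))%E.
  apply: eq_integral => x _; have [j jk dj] := disc_grid x.
  rewrite sumEFin (bigD1 (Ordinal jk))//= big1 ?addr0; last first.
    move=> i ij; rewrite [\1_(cell _) _]indicE memNset ?mulr0// /cell /= dj => /grid_inj ji.
    by move/eqP: ij; apply; apply: val_inj.
  rewrite [\1_(cell _) _]indicE mem_set ?mulr1//.
  by rewrite -dj.
rewrite ge0_integral_sum//; last first.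
  move=> i; apply/measurable_EFinP; apply: measurable_funM => //.
  by apply: measurable_indic; exact: measurable_cell.
apply: eq_bigr => i _.
under eq_integral do rewrite EFinM.
rewrite ge0_integralZl//=; last first.
  by apply/measurable_EFinP; apply: measurable_indic; exact: measurable_cell.
rewrite integral_indic//; last exact: measurable_cell.
rewrite setIT EFinM muleC fineK//; apply: fin_num_measure; exact: measurable_cell.
Qed.

Lemma W2_disc (m : P2 R) c :
  (\int[m]_x ((x - disc x) ^+ 2)%:E <= c%:E)%E -> W2 m (disc_P2 m) ^+ 2 <= c.
Proof.
apply: (@W2_sqr_le_joint _ _ _ m (fun x => x) disc) => //; exact: measurable_disc.
Qed.

Lemma W2_disc_disc (m m' : P2 R) delta :
  (forall i, (i < grid_size)%N ->
     `|fine (m (cell i)) - fine (m' (cell i))| <= delta) ->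
  W2 (disc_P2 m) (disc_P2 m') ^+ 2 <= grid_size%:R * delta * (2 * N) ^+ 2.
Proof.
move=> h; have s1 (m0 : P2 R) : \sum_(i < grid_size) fine (m0 (cell i)) = 1.
  have := disc_P2E m0 measurableT; rewrite probability_setT sumEFin => -[->].
  by apply: eq_bigr => i _; rewrite indicT mulr1.
apply: (@W2_discrete _ _ grid (fun i => fine (m (cell i))) (fun i => fine (m' (cell i)))) => //.
- by move=> i; exact: fine_ge0.
- by move=> i; exact: fine_ge0.
- exact: grid_bound.
- by move=> A mA; exact: disc_P2E.
- by move=> A mA; exact: disc_P2E.
Qed.

End discretization.

Lemma disc_L2_cvg d (T : measurableType d) (R : realType) (P : probability T R)
    (X : T -> R) : L2 P setT X ->
  (\int[P]_w ((X w - disc n (X w)) ^+ 2)%:E @[n --> \oo] --> 0)%E.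
Proof.
move=> lX; have mX := lX.1.
have mD n : measurable_fun setT (fun w => ((X w - disc n (X w)) ^+ 2)%:E).
  apply/measurable_EFinP; apply: measurable_funX; apply: measurable_funB => //.
  exact: (measurableT_comp (measurable_disc n) mX).
have iX := L2_integrable_sqr lX.
have := @dominated_cvg _ _ _ P setT (measurableT)
  (fun n w => ((X w - disc n (X w)) ^+ 2)%:E) (cst 0%E) (fun w => (1 + X w ^+ 2)%:E).
rewrite integral0; apply=> //.
- move=> w _ /=; apply: cvg_EFin; first exact: nearW.
  apply/cvgrPdist_le => e e0.
  near=> n; rewrite /= sub0r normrN ger0_norm ?sqr_ge0//.
  have Xn : - n.+1%:R <= X w < n.+1%:R.
    have : `|X w| < n.+1%:R.
      apply: lt_le_trans (truncnS_gt _) _; rewrite ler_nat ltnS.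
      by near: n; exact: nbhs_infty_ge.
    by rewrite ltr_norml => /andP[/ltW -> ->].
  have [j _ [_ h]] := disc_in Xn; apply: le_trans h _.
  apply: (@le_trans _ _ n.+1%:R^-1).
    by rewrite expr2 ler_piMr// invf_le1// ler1n.
  rewrite -[leRHS]invrK lef_pV2 ?posrE ?invr_gt0//.
  apply: le_trans (ltW (truncnS_gt _)) _; rewrite ler_nat ltnS.
  by near: n; exact: nbhs_infty_ge.
- have -> : (fun w => (1 + X w ^+ 2)%:E) = (fun w => 1%:E + (X w ^+ 2)%:E)%E by [].
  apply: integrableD => //.
  exact: (finite_measure_integrable_cst P 1).
- by move=> n w _; rewrite gee0_abs ?lee_fin ?sqr_ge0// disc_err.
Unshelve. all: by end_near. Qed.

(** * Drifts driven by a conditional law *)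

Section finite_measure_L2.
Context d (T : measurableType d) (R : realType) (P : probability T R).

Lemma L2_cst (D : set T) (c : R) : measurable D -> L2 P D (fun=> c).
Proof.
move=> mD; split; first exact: measurable_cst.
rewrite integral_cst// lte_mul_pinfty ?lee_fin ?sqr_ge0//.
by rewrite (le_lt_trans (probability_le1 _ mD))// ltry.
Qed.

Lemma L2_norm D (f : T -> R) : measurable D -> L2 P D f ->
  L2 P D (fun x => `|f x|).
Proof.
move=> mD [mf f2]; split; first exact: measurableT_comp.
by under eq_integral do rewrite real_normK ?num_real//.
Qed.

Lemma L2_subset (A : set T) (f : T -> R) : measurable A -> L2 P setT f -> L2 P A f.
Proof.
move=> mA [mf f2]; split; first exact: measurable_funTS.
apply: le_lt_trans f2; apply: ge0_subset_integral => //.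
  by apply/measurable_EFinP; exact: measurable_funX.
by move=> x _; rewrite lee_fin sqr_ge0.
Qed.

Lemma L2_affine_bound (f g : T -> R) (K L : R) : measurable_fun setT f ->
  L2 P setT g -> (forall x, `|f x| <= K + L * `|g x|) -> L2 P setT f.
Proof.
move=> mf lg fg.
apply: (@le_L2 _ _ _ P setT measurableT f (fun x => L * `|g x| + K)) => //.
  by apply: L2_lin => //; [exact: L2_norm|exact: L2_cst].
move=> x _; rewrite -(real_normK (num_real (f x))).
rewrite -[leRHS](real_normK (num_real _)).
rewrite lerXn2r ?nnegrE// addrC.
by apply: le_trans (fg x) _; exact: ler_norm.
Qed.

End finite_measure_L2.

(** * Conditioning on events and on finite partitions *)

Section conditioning.
Context d (T : measurableType d) (R : realType) (P : probability T R).
Variables (A : set T) (mA : measurable A).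

(** For a null event [mnormalize] falls back on [P]. This default keeps second moments finite, so
    that [atom_law] needs no case distinction. *)
Definition cond_proba : probability T R := mnormalize (mrestr P mA) P.

Lemma cond_proba0 : P A = 0%E -> cond_proba = P :> (set T -> \bar R).
Proof. by move=> A0; rewrite /cond_proba /= /mnormalize /= /mrestr setTI A0 eqxx. Qed.

Let PA_fin : P A \is a fin_num. Proof. exact: fin_num_measure. Qed.

Lemma cond_probaE B : P A != 0%E ->
  cond_proba B = (P (B `&` A) * (fine (P A))^-1%:E)%E.
Proof.
move=> A0; rewrite /cond_proba /= /mnormalize /= /mrestr setTI ifF//.
by rewrite (negbTE A0)/=; apply: contraTF PA_fin => /eqP ->.
Qed.

Lemma ge0_integral_cond_proba (f : T -> \bar R) : P A != 0%E ->
  measurable_fun setT f -> (forall x, (0 <= f x)%E) ->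
  (\int[cond_proba]_x f x = (fine (P A))^-1%:E * \int[P]_(x in A) f x)%E.
Proof.
move=> A0 mf f0.
have c0 : 0 <= (fine (P A))^-1 by rewrite invr_ge0 fine_ge0.
rewrite -(ge0_integral_mrestr P mA mf f0).
rewrite -(@ge0_integral_mscale _ _ _ (mrestr P mA) setT measurableT (NngNum c0) f)//.
apply: eq_measure_integral => B mB _; apply: (eq_trans (cond_probaE B A0)).
by rewrite /mscale/= /mrestr muleC.
Qed.

(** The integrand has no sign. Its positive and negative parts are both divided by P A, and
    integrability makes them finite, so the sign of their difference is preserved. *)
Lemma cond_proba_integral_ge0 d' (T' : measurableType d') (Z : T -> T')
    (mZ : measurable_fun setT Z) (f : T' -> R) : P A != 0%E ->
  measurable_fun setT f -> P.-integrable A (fun x => (f (Z x))%:E) ->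
  (0 <= \int[law cond_proba mZ]_z (f z)%:E)%E ->
  (0 <= \int[P]_(x in A) (f (Z x))%:E)%E.
Proof.
move=> A0 mf fi.
have mf' : measurable_fun setT (fun z => (f z)%:E) by exact/measurable_EFinP.
rewrite integralE [X in _ -> (0 <= X)%E]integralE.
have mfp := measurable_funepos mf'; have mfn := measurable_funeneg mf'.
rewrite !ge0_integral_law// !ge0_integral_cond_proba//; first last.
- exact: (measurableT_comp mfp mZ).
- exact: (measurableT_comp mfn mZ).
have ip := integrable_pos_fin_num mA fi.
have in_ := integrable_neg_fin_num mA fi.
have c0 : 0 < (fine (P A))^-1.
  by rewrite invr_gt0 lt0r fine_ge0// andbT fine_eq0.
move: ip in_; set Ip := integral _ _ _; set In := integral _ _ _ => ip in_.
rewrite [X in (_ * X - _)%E](_ : _ = Ip); last first.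
  by apply: eq_integral => x _; rewrite !funeposE.
rewrite [X in (_ - _ * X)%E](_ : _ = In); last first.
  by apply: eq_integral => x _; rewrite !funenegE.
rewrite -(fineK ip) -(fineK in_) -!EFinM -!EFinB !lee_fin !subr_ge0.
by rewrite ler_pM2l.
Qed.

End conditioning.

Section atoms.
Context d (T : measurableType d) (R : realType) (P : probability T R).
Context (I : finType) (V : T -> I).
Hypothesis mV : forall v, measurable (V @^-1` [set v]).

Lemma ge0_integral_atoms (f : T -> \bar R) : measurable_fun setT f ->
  (forall x, (0 <= f x)%E) ->
  (\int[P]_x f x = \sum_(v <- enum I) \int[P]_(x in V @^-1` [set v]) f x)%E.
Proof.
move=> mf f0.
rewrite -(@ge0_integral_bigsetU _ _ _ P _ (fun v => V @^-1` [set v]) f (enum I))//.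
- congr (integral _ _ _); apply/esym/seteqP; split=> // x _.
  rewrite -bigcup_seq; exists (V x) => //=.
  by rewrite mem_enum.
- exact: enum_uniq.
- by move=> u v _ _ [x [/= <- <-]].
- exact: measurable_funTS.
Qed.

Lemma ge0_le_integral_atoms (f g : T -> \bar R) : measurable_fun setT f ->
  measurable_fun setT g -> (forall x, (0 <= f x)%E) -> (forall x, (0 <= g x)%E) ->
  (forall v, \int[P]_(x in V @^-1` [set v]) f x <=
     \int[P]_(x in V @^-1` [set v]) g x)%E ->
  (\int[P]_x f x <= \int[P]_x g x)%E.
Proof.
by move=> mf mg f0 g0 fg; rewrite !ge0_integral_atoms//; exact: lee_sum.
Qed.

Lemma integral_atoms_ge0 (f : T -> \bar R) : P.-integrable setT f ->
  (forall v, 0 <= \int[P]_(x in V @^-1` [set v]) f x)%E ->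
  (0 <= \int[P]_x f x)%E.
Proof.
move=> fi h; have mf := measurable_int _ fi.
rewrite integralE sube_ge0; last first.
  by rewrite (integrable_neg_fin_num measurableT fi).
apply: ge0_le_integral_atoms => //.
- exact: measurable_funeneg.
- exact: measurable_funepos.
move=> v; have := h v; rewrite integralE sube_ge0//.
have fiv : P.-integrable (V @^-1` [set v]) f by apply: integrableS fi.
by rewrite (integrable_neg_fin_num (mV v) fiv).
Qed.

Lemma measurable_fun_atoms (f : I -> T -> R) :
  (forall v, measurable_fun setT (f v)) -> measurable_fun setT (fun x => f (V x) x).
Proof.
move=> mf.
rewrite (_ : (fun _ => _) = (fun x => \sum_(v <- enum I) f v x * \1_(V @^-1` [set v]) x)).
  apply: measurable_sum => v; exact: measurable_funM.
apply/funext => x; rewrite big_enum/= (bigD1 (V x))//= big1 ?addr0.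
  by rewrite indicE mem_set// mulr1.
move=> v vx; rewrite indicE memNset ?mulr0// => /= e.
by rewrite e eqxx in vx.
Qed.

End atoms.

Section weakly_monotone_drift.
Context (R : realType) (phi : R -> P2 R -> R) (Cg : R).
Hypothesis lip_x : forall x x' m, `|phi x m - phi x' m| <= Cg * `|x - x'|.
Hypothesis lip_m : forall x m m', `|phi x m - phi x m'| <= Cg * W2 m m'.
Hypothesis weak_mono : forall (m m' : P2 R) (gamma : probability (R * R)%type R),
  in_P2_plane gamma -> coupling m m' gamma ->
  (0 <= \int[gamma]_z ((phi z.1 m - phi z.2 m') * (z.1 - z.2))%:E)%E.

Let Cg0 : 0 <= Cg.
Proof.
have := lip_x 1 0 (dirac0_P2 R); rewrite subr0 normr1 mulr1.
by apply: le_trans; exact: normr_ge0.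
Qed.

Lemma lipschitz_measurable m : measurable_fun setT (phi ^~ m).
Proof.
apply: continuous_measurable_fun => x; apply/cvgrPdist_lt => e e0.
near=> y; apply: le_lt_trans (lip_x _ _ _) _.
apply: (@le_lt_trans _ _ ((Cg + 1) * `|x - y|)).
  by rewrite ler_wpM2r// lerDl.
rewrite -ltr_pdivlMl; last by rewrite ltr_wpDl.
near: y; apply: cvgr_dist_lt; first exact: cvg_id.
by rewrite mulr_gt0// invr_gt0 ltr_wpDl.
Unshelve. all: by end_near. Qed.

Context d (Omega : measurableType d) (P : probability Omega R).

Lemma lipschitz_L2 m (X : Omega -> R) : L2 P setT X ->
  L2 P setT (fun w => phi (X w) m).
Proof.
move=> lX; apply: (L2_affine_bound (K := `|phi 0 m|) (L := Cg) _ lX).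
  exact: (measurableT_comp (lipschitz_measurable m) lX.1).
move=> w; rewrite addrC -lerBlDr; apply: le_trans (lerB_dist _ _) _.
by have := lip_x (X w) 0 m; rewrite subr0.
Qed.

Section atom_law.
Variables (A : set Omega) (mA : measurable A).

Lemma atom_moment (X : Omega -> R) (lX : L2 P setT X) :
  (\int[law (cond_proba P mA) lX.1]_x (x ^+ 2)%:E < +oo)%E.
Proof.
have msq : measurable_fun setT (fun x : R => (x ^+ 2)%:E).
  by apply/measurable_EFinP; exact: measurable_funX.
have mX2 : measurable_fun setT (fun w => (X w ^+ 2)%:E).
  by apply/measurable_EFinP; apply: measurable_funX; exact: lX.1.
rewrite ge0_integral_law//; last by move=> x; rewrite lee_fin sqr_ge0.
have [A0|A0] := eqVneq (P A) 0%E.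
  rewrite (eq_measure_integral P); first exact: lX.2.
  by move=> B mB _; exact: (congr1 (fun f => f B) (cond_proba0 mA A0)).
rewrite ge0_integral_cond_proba//; last by move=> x; rewrite lee_fin sqr_ge0.
have [_ lA] := L2_subset mA lX.
by rewrite lte_mul_pinfty// lee_fin invr_ge0 fine_ge0.
Qed.

Definition atom_law X (lX : L2 P setT X) : P2 R := MkP2 (atom_moment lX).

Context (X X' : Omega -> R) (lX : L2 P setT X) (lX' : L2 P setT X').
Local Notation mu := (atom_law lX).
Local Notation mu' := (atom_law lX').

Lemma atom_weak_mono :
  (0 <= \int[P]_(w in A)
     ((phi (X w) mu - phi (X' w) mu') * (X w - X' w))%:E)%E.
Proof.
have lp := lipschitz_L2 mu lX; have lp' := lipschitz_L2 mu' lX'.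
have lD := L2B measurableT lX lX'; have lpD := L2B measurableT lp lp'.
have ipD := L2_integrableM measurableT lpD lD.
have ipA : P.-integrable A
    (fun w => ((phi (X w) mu - phi (X' w) mu') * (X w - X' w))%:E).
  by apply: integrableS ipD.
have [A0|A0] := eqVneq (P A) 0%E.
  by rewrite null_set_integral//; exact: measurable_int ipA.
have mXX : measurable_fun setT (fun w => (X w, X' w)).
  by apply: measurable_fun_pair; [exact: lX.1|exact: lX'.1].
apply: (cond_proba_integral_ge0 (mA := mA) (mZ := mXX)
  (f := fun z => (phi z.1 mu - phi z.2 mu') * (z.1 - z.2))) => //.
- apply: measurable_funM; last exact: measurable_funB.
  apply: measurable_funB.
    exact: (measurableT_comp (lipschitz_measurable mu) measurable_fst).
  exact: (measurableT_comp (lipschitz_measurable mu') measurable_snd).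
- apply: weak_mono; last by move=> B mB; split.
  have mq1 : measurable_fun setT (fun z : R * R => (z.1 ^+ 2 + z.2 ^+ 2)%:E).
    by apply/measurable_EFinP; apply: measurable_funD; exact: measurable_funX.
  rewrite /in_P2_plane ge0_integral_law//; last first.
    by move=> z; rewrite lee_fin addr_ge0 ?sqr_ge0.
  rewrite ge0_integral_cond_proba//; first last.
  + by move=> z; rewrite lee_fin addr_ge0 ?sqr_ge0.
  + exact: (measurableT_comp mq1 mXX).
  rewrite lte_mul_pinfty ?lee_fin ?invr_ge0 ?fine_ge0//.
  under eq_integral do rewrite EFinD.
  rewrite ge0_integralD//.
  + by apply: lte_add_pinfty; [have [] := L2_subset mA lX|have [] := L2_subset mA lX'].
  + by move=> w _; rewrite lee_fin sqr_ge0.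
  + by apply/measurable_EFinP; apply: measurable_funX; have [] := L2_subset mA lX.
  + by move=> w _; rewrite lee_fin sqr_ge0.
  + by apply/measurable_EFinP; apply: measurable_funX; have [] := L2_subset mA lX'.
Qed.

(** The joint law of [X] and [X'] given [A] is one coupling of the two laws. The factor P A turns
    the bound into one that can be summed over atoms. *)
Lemma atom_W2 : P A != 0%E ->
  ((W2 mu mu' ^+ 2)%:E * P A <= \int[P]_(w in A) ((X w - X' w) ^+ 2)%:E)%E.
Proof.
move=> A0; have lD := L2B measurableT lX lX'.
have [mDA DA] := L2_subset mA lD.
have fA : P A \is a fin_num by exact: fin_num_measure.
have pA : 0 < fine (P A) by rewrite lt0r fine_ge0// andbT fine_eq0.
have iA : (\int[P]_(w in A) ((X w - X' w) ^+ 2)%:E)%E \is a fin_num.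
  by rewrite ge0_fin_numE// integral_ge0// => w _; rewrite lee_fin sqr_ge0.
rewrite -(fineK fA) -(fineK iA) -EFinM lee_fin -ler_pdivlMr//.
apply: (@W2_sqr_le_joint _ _ _ (cond_proba P mA) X X').
- exact: lX.1.
- exact: lX'.1.
- by [].
- by [].
rewrite ge0_integral_cond_proba//; last 2 first.
- by apply/measurable_EFinP; apply: measurable_funX; exact: lD.1.
- by move=> w; rewrite lee_fin sqr_ge0.
by rewrite mulrC EFinM fineK.
Qed.

End atom_law.

Section conditional_laws.
Variables (G : set (set Omega)) (Gm : <<s G >> `<=` measurable).
Local Notation E := (g_sigma_algebraType G).

Section one_law.
Context (X : Omega -> R) (lX : L2 P setT X) (m : Omega -> P2 R).
Hypothesis dm : disintegrates P G X m.

Let rm := disintegrates_regular_cond_law Gm lX.1 dm.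

Lemma measurable_cell_weight (n i : nat) :
  measurable_fun (setT : set E) (fun w => fine (m w (cell n i))).
Proof.
apply: measurableT_comp => //.
by have [] := rm (measurable_cell n i).
Qed.

Lemma cell_weight01 (n i : nat) w : 0 <= fine (m w (cell n i)) <= 1.
Proof.
rewrite fine_ge0//= -lee_fin fineK; first exact: probability_le1 (measurable_cell n i).
by apply: fin_num_measure; exact: measurable_cell.
Qed.

Section one_atom.
Variables (A : set Omega) (mA : measurable A).
Hypothesis GA : <<s G >> A.
Hypothesis A0 : P A != 0%E.

Let fA : P A \is a fin_num. Proof. exact: fin_num_measure. Qed.

Let pA : 0 < fine (P A). Proof. by rewrite lt0r fine_ge0// andbT fine_eq0. Qed.

(** The probability of a cell given [A] is the mean over [A] of the conditional weights, and a mean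
    lies within the oscillation of each value. *)
Lemma atom_cell_weight (n i : nat) (delta : R) :
  (forall w w', A w -> A w' ->
     `|fine (m w (cell n i)) - fine (m w' (cell n i))| <= delta) ->
  forall w, A w ->
    `|fine (m w (cell n i)) - fine (atom_law mA lX (cell n i))| <= delta.
Proof.
move=> osc w Aw; set p := fun w => fine (m w (cell n i)).
have mc : measurable (cell n i : set R) by exact: measurable_cell.
have mp : measurable_fun setT p.
  exact: (measurable_fun_sub Gm (measurable_cell_weight n i)).
have ip : P.-integrable A (EFin \o p).
  apply: measurable_bounded_integrable => //.
  - by rewrite -ge0_fin_numE.
  - exact: measurable_funTS.
  - exists 1; split=> // M M1 x Ax; apply: ltW; apply: le_lt_trans M1.
    by have /andP[p0 p1] := cell_weight01 n i x; rewrite ger0_norm.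
have icst (c : R) : P.-integrable A (EFin \o cst c).
  exact: (finite_measure_integrable_cst P c mA).
(* Averaging identity: the defining property of the conditional law, applied to the event [A] of the
   sub-sigma-algebra. *)
have pE : \int[P]_(x in A) p x = fine (atom_law mA lX (cell n i)) * fine (P A).
  have [_ /(_ _ GA) h] := rm mc.
  have aw : atom_law mA lX (cell n i) =
      (P (X @^-1` cell n i `&` A) * (fine (P A))^-1%:E)%E.
    exact: (cond_probaE mA _ A0).
  have JE : (\int[P]_(x in A) (p x)%:E = \int[P]_(x in A) m x (cell n i))%E.
    by apply: eq_integral => x _; rewrite /p fineK//; exact: fin_num_measure.
  have Jf : (\int[P]_(x in A) m x (cell n i))%E \is a fin_num.
    by rewrite -JE; exact: integrable_fin_num ip.
  by rewrite aw setIC h /Rintegral JE fineM//= mulfVK// gt_eqF.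
have up : \int[P]_(x in A) p x <= \int[P]_(x in A) (p w + delta).
  apply: le_Rintegral => //; first exact: icst.
  by move=> x Ax; have := osc _ _ Ax Aw; rewrite -/(p x) -/(p w) => /ler_normlW; rewrite lerBlDl.
have dn : \int[P]_(x in A) (p w - delta) <= \int[P]_(x in A) p x.
  apply: le_Rintegral => //; first exact: icst.
  by move=> x Ax; have := osc _ _ Aw Ax; rewrite -/(p x) -/(p w) => /ler_normlW; rewrite lerBlDr lerBlDl.
move: up dn; rewrite !Rintegral_cst// pE !ler_pM2r// => up dn.
by rewrite ler_norml -/(p w); lra.
Qed.

Let lip_sqr (t W c : R) : 0 <= W -> `|t| <= Cg * W -> W ^+ 2 <= c ->
  t ^+ 2 <= Cg ^+ 2 * c.
Proof.
move=> W0 tW Wc; rewrite -(real_normK (num_real t)).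
apply: (@le_trans _ _ ((Cg * W) ^+ 2)).
  by rewrite lerXn2r ?nnegrE// mulr_ge0.
by rewrite exprMn ler_wpM2l ?sqr_ge0.
Qed.

(** Passing from [m w] to the law given [A] takes three steps through their discretisations, whence
    the factor 3. The middle step costs [K]. Each outer one costs a mean squared rounding error, and
    both integrate over [A] to the same quantity, whence the factor 2. *)
Lemma atom_drift_error (n : nat) (delta : R) :
  measurable_fun setT (fun w => phi (X w) (m w)) -> 0 <= delta ->
  (forall i, (i < grid_size n)%N -> forall w w', A w -> A w' ->
     `|fine (m w (cell n i)) - fine (m w' (cell n i))| <= delta) ->
  (\int[P]_(w in A) ((phi (X w) (m w) - phi (X w) (atom_law mA lX)) ^+ 2)%:E <=
   \int[P]_(w in A) (3 * Cg ^+ 2 * (2 * (X w - disc n (X w)) ^+ 2 +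
      (grid_size n)%:R * delta * (2 * n.+1%:R) ^+ 2))%:E)%E.
Proof.
move=> mY delta0 osc; set mu := atom_law mA lX.
set K := _ * delta * _.
have K0 : 0 <= K by rewrite !mulr_ge0 ?sqr_ge0.
pose er (x : R) : \bar R := ((x - disc n x) ^+ 2)%:E.
have mer : measurable_fun setT er.
  apply/measurable_EFinP; apply: measurable_funX; apply: measurable_funB => //.
  exact: measurable_disc.
have er0 x : (0 <= er x)%E by rewrite lee_fin sqr_ge0.
have mXer : measurable_fun setT (fun w => er (X w)) by exact: (measurableT_comp mer lX.1).
have [mE EA] := dm mer er0.
pose e w := (\int[m w]_x er x)%E.
have e0 w : (0 <= e w)%E by exact: integral_ge0.
have efin (nu : P2 R) : (\int[nu]_x er x)%E \is a fin_num.
  rewrite ge0_fin_numE; last exact: integral_ge0.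
  apply: (@le_lt_trans _ _ (\int[nu]_x (1%:E + (x ^+ 2)%:E))%E).
    apply: ge0_le_integral => //.
    - by apply: emeasurable_funD => //; apply/measurable_EFinP; exact: measurable_funX.
    - by move=> x _; rewrite -EFinD lee_fin disc_err.
  rewrite ge0_integralD//.
  - apply: lte_add_pinfty; last exact: P2_moment.
    by rewrite integral_cst//= probability_setT mule1 ltry.
  - by move=> x _; rewrite lee_fin sqr_ge0.
  - by apply/measurable_EFinP; exact: measurable_funX.
pose I := (\int[P]_(w in A) er (X w))%E.
have I0 : (0 <= I)%E by exact: integral_ge0.
have muE : (\int[mu]_x er x)%E = ((fine (P A))^-1%:E * I)%E.
  by rewrite ge0_integral_law// ge0_integral_cond_proba.
pose eA := fine (\int[mu]_x er x)%E.
have eA0 : 0 <= eA by apply: fine_ge0; exact: integral_ge0.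
(* The constant [eA] is the mean over [A] of the squared rounding error of [X], so it has the same
   integral over [A] as the conditional error [e]. *)
have eAI : (eA%:E * P A)%E = I.
  by rewrite /eA fineK// muE -[in LHS](fineK fA) muleAC -EFinM mulVf ?mul1e// gt_eqF.
have pt w : A w -> (phi (X w) (m w) - phi (X w) mu) ^+ 2 <=
    3 * Cg ^+ 2 * (fine (e w) + (K + eA)).
  move=> Aw.
  have t1 : (phi (X w) (m w) - phi (X w) (disc_P2 n (m w))) ^+ 2 <= Cg ^+ 2 * fine (e w).
    apply: (lip_sqr (W := W2 (m w) (disc_P2 n (m w)))) => //; first exact: sqrtr_ge0.
    by apply: W2_disc; rewrite fineK// efin.
  have t2 : (phi (X w) (disc_P2 n (m w)) - phi (X w) (disc_P2 n mu)) ^+ 2 <= Cg ^+ 2 * K.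
    apply: (lip_sqr (W := W2 (disc_P2 n (m w)) (disc_P2 n mu))) => //; first exact: sqrtr_ge0.
    apply: W2_disc_disc => i ik; apply: atom_cell_weight => // w1 w2 A1 A2.
    exact: osc.
  have t3 : (phi (X w) mu - phi (X w) (disc_P2 n mu)) ^+ 2 <= Cg ^+ 2 * eA.
    apply: (lip_sqr (W := W2 mu (disc_P2 n mu))) => //; first exact: sqrtr_ge0.
    by apply: W2_disc; rewrite fineK// efin.
  move: t1 t2 t3; set a := phi _ (m w); set b := phi _ (disc_P2 n (m w)).
  set c := phi _ (disc_P2 n mu); set f := phi _ mu => t1 t2 t3.
  have : (a - f) ^+ 2 <= 3 * ((a - b) ^+ 2 + (b - c) ^+ 2 + (f - c) ^+ 2).
    have := sqr_ge0 ((a - b) - (b - c)); have := sqr_ge0 ((a - b) - (c - f)).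
    have := sqr_ge0 ((b - c) - (c - f)); lra.
  lra.
have c0 : 0 <= 3 * Cg ^+ 2 by rewrite mulr_ge0// sqr_ge0.
have KA0 : 0 <= K + eA by rewrite addr_ge0.
have meA : measurable_fun A e.
  by apply: measurable_funTS; exact: (measurable_fun_sub Gm mE).
apply: (@le_trans _ _ (\int[P]_(w in A) ((3 * Cg ^+ 2)%:E * (e w + (K + eA)%:E)))%E).
  apply: ge0_le_integral => //.
  - by move=> w _; rewrite lee_fin sqr_ge0.
  - apply/measurable_EFinP; apply: measurable_funTS; apply: measurable_funX.
    apply: measurable_funB => //.
    exact: (measurableT_comp (lipschitz_measurable mu) lX.1).
  - by apply: measurable_funeM; apply: emeasurable_funD.
  - by move=> w Aw; rewrite -(fineK (efin (m w) : e w \is a fin_num)) -EFinD -EFinM lee_fin; exact: pt.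
rewrite ge0_integralZl//; last 2 first.
- by apply: emeasurable_funD.
- by move=> w _; rewrite adde_ge0// lee_fin.
under [leRHS]eq_integral do rewrite EFinM.
rewrite ge0_integralZl//; last 2 first.
- apply/measurable_EFinP; apply: measurable_funD => //; apply: measurable_funM => //.
  by apply: measurable_funTS; apply/measurable_EFinP.
- by move=> w _; rewrite lee_fin addr_ge0// mulr_ge0// sqr_ge0.
apply: lee_wpmul2l; first by rewrite lee_fin.
rewrite ge0_integralD//.
rewrite integral_cst// -/e EA// -/I.
under [leRHS]eq_integral do rewrite EFinD EFinM.
rewrite ge0_integralD//; last 2 first.
- by move=> w _; rewrite -EFinM lee_fin mulr_ge0// sqr_ge0.
- by apply: measurable_funeM; exact: measurable_funTS.
rewrite ge0_integralZl//; last 2 first.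
- exact: measurable_funTS.
- by move=> w _; rewrite lee_fin sqr_ge0.
rewrite integral_cst// -/I EFinD ge0_muleDl ?lee_fin// eAI.
have -> : (2%:E * I = I + I)%E.
  by rewrite -[X in (_ = X + X)%E]mul1e -ge0_muleDl// -EFinD.
by rewrite addeA addeAC.
Qed.

End one_atom.

End one_law.

Context (X X' : Omega -> R) (lX : L2 P setT X) (lX' : L2 P setT X').
Context (m m' : Omega -> P2 R).
Hypothesis dm : disintegrates P G X m.
Hypothesis dm' : disintegrates P G X' m'.
Let Y w := phi (X w) (m w).
Let Y' w := phi (X' w) (m' w).
Hypothesis mY : measurable_fun setT Y.
Hypothesis mY' : measurable_fun setT Y'.

Local Notation ipP f g := (ip P setT f g).

Section fixed_partition.
Variables (n : nat) (delta : R) (I : finType) (V : Omega -> I).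
Hypothesis delta0 : 0 <= delta.
Hypothesis GV : forall v, <<s G >> (V @^-1` [set v]).

Let mV v : measurable (V @^-1` [set v]). Proof. exact: Gm. Qed.

(* [phi (X, m)] with the conditional law [m] replaced, on each atom of the
   partition, by the law of [X] given that atom. *)
Definition step_drift (X0 : Omega -> R) (lX0 : L2 P setT X0) (w : Omega) : R :=
  phi (X0 w) (atom_law (mV (V w)) lX0).

Lemma step_drift_L2 X0 (lX0 : L2 P setT X0) : L2 P setT (step_drift lX0).
Proof.
apply: (L2_affine_bound
  (K := \sum_(v <- enum I) `|phi 0 (atom_law (mV v) lX0)|) (L := Cg) _ lX0).
  apply: (measurable_fun_atoms mV (f := fun v w => phi (X0 w) (atom_law (mV v) lX0))).
  by move=> v; exact: (measurableT_comp (lipschitz_measurable _) lX0.1).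
move=> w; rewrite /step_drift; set mu := atom_law _ _.
have := lip_x (X0 w) 0 mu; rewrite subr0.
have : `|phi 0 mu| <= \sum_(v <- enum I) `|phi 0 (atom_law (mV v) lX0)|.
  by rewrite big_enum/= (bigD1 (V w))//= lerDl sumr_ge0.
have := lerB_dist (phi (X0 w) mu) (phi 0 mu); lra.
Qed.

Lemma step_drift_error X0 (lX0 : L2 P setT X0) m0 : disintegrates P G X0 m0 ->
  measurable_fun setT (fun w => phi (X0 w) (m0 w)) ->
  (forall i, (i < grid_size n)%N -> forall w w', V w = V w' ->
     `|fine (m0 w (cell n i)) - fine (m0 w' (cell n i))| <= delta) ->
  (\int[P]_w ((phi (X0 w) (m0 w) - step_drift lX0 w) ^+ 2)%:E <=
   \int[P]_w (3 * Cg ^+ 2 * (2 * (X0 w - disc n (X0 w)) ^+ 2 +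
      (grid_size n)%:R * delta * (2 * n.+1%:R) ^+ 2))%:E)%E.
Proof.
move=> dm0 mY0 osc.
have mf : measurable_fun setT (fun w => ((phi (X0 w) (m0 w) - step_drift lX0 w) ^+ 2)%:E).
  apply/measurable_EFinP; apply: measurable_funX; apply: measurable_funB => //.
  exact: (step_drift_L2 lX0).1.
have mg : measurable_fun setT (fun w => (3 * Cg ^+ 2 * (2 * (X0 w - disc n (X0 w)) ^+ 2 +
      (grid_size n)%:R * delta * (2 * n.+1%:R) ^+ 2))%:E).
  apply/measurable_EFinP; apply: measurable_funM => //; apply: measurable_funD => //.
  apply: measurable_funM => //; apply: measurable_funX; apply: measurable_funB.
    exact: lX0.1.
  exact: (measurableT_comp (measurable_disc n) lX0.1).
apply: (ge0_le_integral_atoms mV mf mg).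
- by move=> w; rewrite lee_fin sqr_ge0.
- move=> w; rewrite lee_fin; apply: mulr_ge0; first by rewrite mulr_ge0// sqr_ge0.
  by apply: addr_ge0; [rewrite mulr_ge0 ?sqr_ge0|rewrite !mulr_ge0 ?sqr_ge0].
move=> v; have [A0|A0] := eqVneq (P (V @^-1` [set v])) 0%E.
  rewrite null_set_integral//; last exact: measurable_funTS.
  rewrite null_set_integral//; exact: measurable_funTS.
have := atom_drift_error lX0 dm0 (mV v) (GV v) A0 mY0 delta0.
move=> /(_ n) err; apply: le_trans (err _); last first.
  by move=> i ik w w' /= wv wv'; apply: osc => //; rewrite wv wv'.
rewrite le_eqVlt; apply/orP; left; apply/eqP; apply: eq_integral => w /set_mem /= wv.
by rewrite /step_drift wv.
Qed.

Lemma step_drift_mono :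
  0 <= ipP (fun w => step_drift lX w - step_drift lX' w) (fun w => X w - X' w).
Proof.
have lb := L2B measurableT (step_drift_L2 lX) (step_drift_L2 lX').
have lD := L2B measurableT lX lX'.
rewrite -lee_fin ipE//; apply: (integral_atoms_ge0 mV).
  exact: L2_integrableM.
move=> v; have := atom_weak_mono (mV v) lX lX'.
congr (_ <= _)%E; apply: eq_integral => w /set_mem /= wv.
by rewrite /step_drift wv.
Qed.

(** Splitting the difference in the space and in the law variable gives 2 Cg^2 times a sum of two
    squares. By [atom_W2] the distance of the laws costs no more than the distance of the states,
    which doubles the constant. *)
Lemma step_drift_lip :
  ipP (fun w => step_drift lX w - step_drift lX' w)
      (fun w => step_drift lX w - step_drift lX' w) <=
  4 * Cg ^+ 2 * ipP (fun w => X w - X' w) (fun w => X w - X' w).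
Proof.
have lb := L2B measurableT (step_drift_L2 lX) (step_drift_L2 lX').
have lD := L2B measurableT lX lX'.
have c0 : 0 <= 4 * Cg ^+ 2 by rewrite mulr_ge0// sqr_ge0.
have c20 : 0 <= 2 * Cg ^+ 2 by rewrite mulr_ge0// sqr_ge0.
have mD2 : measurable_fun setT (fun w => ((X w - X' w) ^+ 2)%:E).
  by apply/measurable_EFinP; apply: measurable_funX; exact: lD.1.
rewrite -lee_fin EFinM !ipsqrE// -ge0_integralZl//; last by move=> w _; rewrite lee_fin sqr_ge0.
apply: (ge0_le_integral_atoms mV).
- by apply/measurable_EFinP; apply: measurable_funX; exact: lb.1.
- exact: measurable_funeM.
- by move=> w; rewrite lee_fin sqr_ge0.
- by move=> w; rewrite -EFinM lee_fin mulr_ge0// sqr_ge0.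
move=> v; set A := V @^-1` [set v]; have mA : measurable A := mV v.
set mu := atom_law (mV v) lX; set mu' := atom_law (mV v) lX'.
have mD2A : measurable_fun A (fun w => ((X w - X' w) ^+ 2)%:E) by exact: measurable_funTS.
have [A0|A0] := eqVneq (P A) 0%E.
  rewrite null_set_integral//; last first.
    by apply: measurable_funTS; apply/measurable_EFinP; apply: measurable_funX; exact: lb.1.
  by rewrite null_set_integral//; exact: measurable_funeM.
pose W := W2 mu mu' ^+ 2.
apply: (@le_trans _ _ (\int[P]_(w in A)
    ((2 * Cg ^+ 2)%:E * (((X w - X' w) ^+ 2)%:E + W%:E)))%E).
  apply: ge0_le_integral => //.
  - by move=> w _; rewrite lee_fin sqr_ge0.
  - by apply: measurable_funTS; apply/measurable_EFinP; apply: measurable_funX; exact: lb.1.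
  - by apply: measurable_funeM; apply: emeasurable_funD.
  move=> w /= wv; rewrite -EFinD -EFinM lee_fin /step_drift wv -/mu -/mu' /W.
  have W0 : 0 <= W2 mu mu' by exact: sqrtr_ge0.
  have h1 := lip_x (X w) (X' w) mu; have h2 := lip_m (X' w) mu mu'.
  set a := phi (X w) mu in h1 *; set b := phi (X' w) mu in h1 h2 *.
  set c := phi (X' w) mu' in h2 *.
  have s1 : (a - b) ^+ 2 <= Cg ^+ 2 * (X w - X' w) ^+ 2.
    rewrite -(real_normK (num_real (a - b))) -(real_normK (num_real (X w - X' w))).
    by rewrite -exprMn lerXn2r ?nnegrE// mulr_ge0.
  have s2 : (b - c) ^+ 2 <= Cg ^+ 2 * W2 mu mu' ^+ 2.
    rewrite -(real_normK (num_real (b - c))).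
    by rewrite -exprMn lerXn2r ?nnegrE// mulr_ge0.
  have := sqr_ge0 ((a - b) - (b - c)); lra.
rewrite ge0_integralZl//; last 2 first.
- exact: emeasurable_funD.
- by move=> w _; rewrite -EFinD lee_fin addr_ge0 ?sqr_ge0.
rewrite ge0_integralZl//; try by move=> w _; rewrite lee_fin sqr_ge0.
rewrite ge0_integralD//; try by move=> w _; rewrite lee_fin sqr_ge0.
rewrite integral_cst//.
have -> : ((4 * Cg ^+ 2)%:E = (2 * Cg ^+ 2)%:E * 2%:E)%E.
  by rewrite -EFinM; congr EFin; ring.
rewrite -muleA; apply: lee_wpmul2l; first by rewrite lee_fin.
set J := integral _ _ _.
have J0 : (0 <= J)%E by apply: integral_ge0 => w _; rewrite lee_fin sqr_ge0.
have -> : (2%:E * J = J + J)%E.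
  by rewrite -[X in (_ = X + X)%E]mul1e -ge0_muleDl// -EFinD.
by rewrite leeD2l//; exact: atom_W2.
Qed.

End fixed_partition.

(** The grid is chosen first, fine enough for both states, and then a partition fine enough for that
    grid. Monotonicity and the Lipschitz bound hold for the true [X] and [X'] at every stage, so
    only the drifts have to be passed to the limit. *)
Lemma step_drift_approx (eta : R) : 0 < eta -> exists b b' : Omega -> R,
  [/\ L2 P setT b, L2 P setT b',
      (\int[P]_w ((Y w - b w) ^+ 2)%:E <= eta%:E)%E,
      (\int[P]_w ((Y' w - b' w) ^+ 2)%:E <= eta%:E)%E &
      0 <= ipP (fun w => b w - b' w) (fun w => X w - X' w) /\
      ipP (fun w => b w - b' w) (fun w => b w - b' w) <=
      4 * Cg ^+ 2 * ipP (fun w => X w - X' w) (fun w => X w - X' w)].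
Proof.
(* The error bound totals 3 Cg^2 (2 eps + eps) = 9 Cg^2 eps; the added 1 keeps the denominator
   positive when [Cg] is 0. *)
move=> eta0; pose eps := eta / (9 * Cg ^+ 2 + 1).
have den0 : 0 < 9 * Cg ^+ 2 + 1 by rewrite ltr_wpDl// mulr_ge0// sqr_ge0.
have eps0 : 0 < eps by rewrite divr_gt0.
have [n [nX nX']] : exists n,
    (\int[P]_w ((X w - disc n (X w)) ^+ 2)%:E <= eps%:E)%E /\
    (\int[P]_w ((X' w - disc n (X' w)) ^+ 2)%:E <= eps%:E)%E.
  have small Z : L2 P setT Z ->
      \forall n \near \oo, (\int[P]_w ((Z w - disc n (Z w)) ^+ 2)%:E <= eps%:E)%E.
    move=> lZ; have c := disc_L2_cvg lZ.
    move/fine_cvgP: c => [cf cr].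
    move/cvgr_lt: cr => /(_ eps eps0); apply: filterS2 cf => k fk lk.
    by rewrite -(fineK fk) lee_fin; exact: ltW.
  near \oo => n; exists n; split.
    by near: n; exact: small.
  by near: n; exact: small.
pose C := (grid_size n)%:R * (2 * n.+1%:R) ^+ 2 / eps.
pose N := (Num.truncn C).+1.
have NC : C < N%:R by exact: truncnS_gt.
pose delta : R := N%:R^-1.
have N0 : 0 < N%:R :> R by rewrite ltr0n.
have delta0 : 0 <= delta by rewrite invr_ge0 ltW.
have Kd : (grid_size n)%:R * delta * (2 * n.+1%:R) ^+ 2 <= eps.
  rewrite mulrAC ler_pdivrMr//.
  by rewrite [leRHS]mulrC; apply: ltW; rewrite -ltr_pdivrMr.
pose gs := grid_size n.
(* One partition must serve both conditional laws: the cell weights of [m] are listed first, those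
   of [m'] from index [gs] on. *)
pose f (j : nat) (w : g_sigma_algebraType G) : R :=
  if (j < gs)%N then fine (m w (cell n j)) else fine (m' w (cell n (j - gs))).
have mf j : measurable_fun setT (f j).
  rewrite /f; case: (j < gs)%N; first exact: (measurable_cell_weight lX dm).
  exact: (measurable_cell_weight lX' dm').
have f01 j w : 0 <= f j w <= 1 by rewrite /f; case: ifP => _; exact: cell_weight01.
have [I [V [GV Vosc]]] := finite_oscillation_partition (gs + gs) (ltn0Sn _ : (0 < N)%N) mf f01.
have bound Z (lZ : L2 P setT Z) :
    (\int[P]_w ((Z w - disc n (Z w)) ^+ 2)%:E <= eps%:E)%E ->
    (\int[P]_w (3 * Cg ^+ 2 * (2 * (Z w - disc n (Z w)) ^+ 2 +
      (grid_size n)%:R * delta * (2 * n.+1%:R) ^+ 2))%:E <= eta%:E)%E.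
  move=> hZ.
  have K0 : 0 <= (grid_size n)%:R * delta * (2 * n.+1%:R) ^+ 2.
    by rewrite !mulr_ge0 ?sqr_ge0.
  have mZ : measurable_fun setT (fun w => ((Z w - disc n (Z w)) ^+ 2)%:E).
    apply/measurable_EFinP; apply: measurable_funX; apply: measurable_funB.
      exact: lZ.1.
    exact: (measurableT_comp (measurable_disc n) lZ.1).
  set K := _ * delta * _ in K0 *.
  rewrite (eq_integral (fun w => ((3 * Cg ^+ 2)%:E *
      (2%:E * ((Z w - disc n (Z w)) ^+ 2)%:E + K%:E))%E)); last first.
    by move=> w _.
  rewrite ge0_integralZl//; last 3 first.
  - by apply: emeasurable_funD => //; exact: measurable_funeM.
  - by move=> w _; rewrite -EFinM -EFinD lee_fin addr_ge0// mulr_ge0// sqr_ge0.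
  - by rewrite lee_fin mulr_ge0// sqr_ge0.
  rewrite ge0_integralD//; last 2 first.
  - by move=> w _; rewrite -EFinM lee_fin mulr_ge0// sqr_ge0.
  - exact: measurable_funeM.
  rewrite ge0_integralZl//; last by move=> w _; rewrite lee_fin sqr_ge0.
  rewrite integral_cst//= probability_setT mule1.
  apply: (@le_trans _ _ ((3 * Cg ^+ 2)%:E * (2%:E * eps%:E + eps%:E))%E).
    apply: lee_wpmul2l; first by rewrite lee_fin mulr_ge0// sqr_ge0.
    by apply: leeD; [exact: lee_wpmul2l|rewrite lee_fin].
  have -> : ((3 * Cg ^+ 2)%:E * (2%:E * eps%:E + eps%:E) = (9 * Cg ^+ 2 * eps)%:E)%E.
    by rewrite -[LHS]/((3 * Cg ^+ 2 * (2 * eps + eps))%:E); congr EFin; ring.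
  rewrite lee_fin.
  rewrite /eps mulrA ler_pdivrMr// mulrC ler_wpM2l ?(ltW eta0)//; lra.
exists (step_drift GV lX), (step_drift GV lX'); split.
- exact: step_drift_L2.
- exact: step_drift_L2.
- apply: le_trans (bound _ lX nX); apply: (step_drift_error delta0 GV lX dm mY).
  move=> i ik w w' ww'; have := Vosc _ _ ww' i; rewrite /f ik; apply.
  exact: ltn_addr.
- apply: le_trans (bound _ lX' nX'); apply: (step_drift_error delta0 GV lX' dm' mY').
  move=> i ik w w' ww'; have := Vosc _ _ ww' (gs + i)%N.
  have gi : (gs + i < gs)%N = false by rewrite ltnNge leq_addr.
  by rewrite /f gi addKn; apply; rewrite ltn_add2l.
- split; [exact: step_drift_mono|exact: step_drift_lip].
Unshelve. all: by end_near. Qed.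

(** The limit of [step_drift_approx]. Square-integrability of [Y] and [Y'] is also obtained here,
    from a single approximation at finite distance. *)
Lemma weak_monotone_drift :
  [/\ L2 P setT Y, L2 P setT Y',
      0 <= ipP (fun w => Y w - Y' w) (fun w => X w - X' w) &
      ipP (fun w => Y w - Y' w) (fun w => Y w - Y' w) <=
      8 * Cg ^+ 2 * ipP (fun w => X w - X' w) (fun w => X w - X' w)].
Proof.
have L2close (Z b : Omega -> R) (eta : R) : measurable_fun setT Z -> L2 P setT b ->
    (\int[P]_w ((Z w - b w) ^+ 2)%:E <= eta%:E)%E ->
    L2 P setT (fun w => Z w - b w) /\ L2 P setT Z.
  move=> mZ lb h.
  have lZb : L2 P setT (fun w => Z w - b w).
    split; first by apply: measurable_funB => //; exact: lb.1.
    by apply: le_lt_trans h _; rewrite ltry.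
  split=> //; have := L2D measurableT lZb lb.
  by under eq_fun do rewrite subrK.
have [lY lY'] : L2 P setT Y /\ L2 P setT Y'.
  have [b [b' [lb lb' h h' _]]] := step_drift_approx ltr01.
  by split; [have [] := L2close _ _ _ mY lb h|have [] := L2close _ _ _ mY' lb' h'].
have lD := L2B measurableT lX lX'; have lYD := L2B measurableT lY lY'.
pose ND := ipP (fun w => X w - X' w) (fun w => X w - X' w).
have ND0 : 0 <= ND by exact: ip_ge0.
(* Write Y - Y' as a remainder of squared norm at most 4 eta^2 plus the difference of step drifts.
   Applying (s + t)^2 <= 2 s^2 + 2 t^2 doubles the Lipschitz constant from 4 to 8. *)
have main (eta : R) : 0 < eta ->
    - (eta + 4 * ND * eta) <= ipP (fun w => Y w - Y' w) (fun w => X w - X' w) /\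
    ipP (fun w => Y w - Y' w) (fun w => Y w - Y' w) <= 8 * Cg ^+ 2 * ND + 8 * eta ^+ 2.
  move=> eta0; have eta20 : 0 < eta ^+ 2 by rewrite exprn_gt0.
  have [b [b' [lb lb' h h' [mono lip]]]] := step_drift_approx eta20.
  have [lr _] := L2close _ _ _ mY lb h; have [lr' _] := L2close _ _ _ mY' lb' h'.
  have lbD := L2B measurableT lb lb'.
  have Nr : ipP (fun w => Y w - b w) (fun w => Y w - b w) <= eta ^+ 2.
    by rewrite -lee_fin ipsqrE.
  have Nr' : ipP (fun w => Y' w - b' w) (fun w => Y' w - b' w) <= eta ^+ 2.
    by rewrite -lee_fin ipsqrE.
  set r := fun w => Y w - b w in lr Nr; set r' := fun w => Y' w - b' w in lr' Nr'.
  have lrD : L2 P setT (fun w => r w - r' w) := L2B measurableT lr lr'.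
  set bD := fun w => b w - b' w in mono lip lbD.
  set D := fun w => X w - X' w in lD mono lip ND ND0 *.
  have YE : (fun w => Y w - Y' w) = (fun w => (r w - r' w) + bD w).
    by apply/funext => w; rewrite /r /r' /bD; ring.
  have NrD : ipP (fun w => r w - r' w) (fun w => r w - r' w) <= 4 * eta ^+ 2.
    by have := ip_sqrB_le measurableT lr lr'; move: Nr Nr'; rewrite -/r -/r'; lra.
  have cs := ip_cauchy_schwarz measurableT lrD lD.
  split.
    rewrite YE ipDl//; move: cs mono; rewrite -/ND.
    set x := ipP (fun w => r w - r' w) D; set y := ipP bD D => cs y0.
    have : x ^+ 2 <= 4 * ND * eta ^+ 2.
      apply: le_trans cs _; rewrite [leRHS](_ : _ = 4 * eta ^+ 2 * ND); last by ring.
      by rewrite ler_wpM2r.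
    (* The bound 2 eta sqrt(ND) is replaced by the larger eta + 4 ND eta, which avoids a square root
       and still tends to 0. *)
    move=> x2; suff : - (eta + 4 * ND * eta) <= x by lra.
    have t0 : 0 <= eta + 4 * ND * eta by rewrite addr_ge0 ?mulr_ge0// ltW.
    rewrite leNgt; apply/negP => xt.
    have : (eta + 4 * ND * eta) ^+ 2 < x ^+ 2.
      by rewrite -[ltRHS]sqrrN ltrXn2r ?nnegrE//; lra.
    have : (eta + 4 * ND * eta) ^+ 2 = eta ^+ 2 + 8 * (ND * eta ^+ 2) + 16 * (ND * eta) ^+ 2 by ring.
    have := sqr_ge0 (ND * eta); have : 0 <= ND * eta ^+ 2 by rewrite mulr_ge0// ltW.
    lra.
  rewrite YE; have := ip_sqrD_le measurableT lrD lbD.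
  move: NrD lip; rewrite -/ND; lra.
split=> //.
  rewrite leNgt; apply/negP => neg; set z := ipP _ _ in main neg.
  (* With this choice the allowed error is half of -z, so [z] would be at least z/2, impossible for
     a negative number. *)
  pose eta := - z / (2 * (1 + 4 * ND)).
  have d0 : 0 < 2 * (1 + 4 * ND) by lra.
  have e0 : 0 < eta by rewrite divr_gt0//; lra.
  have [h _] := main eta e0.
  have e1 : eta * (2 * (1 + 4 * ND)) = - z by rewrite /eta divfK// gt_eqF.
  lra.
rewrite -/ND leNgt; apply/negP => gt.
set z := ipP (fun w => Y w - Y' w) (fun w => Y w - Y' w) in main gt.
(* The error 8 eta^2 then equals half of the supposed excess. *)
pose eta2 := (z - 8 * Cg ^+ 2 * ND) / 16.
have e0 : 0 < eta2 by rewrite divr_gt0//; lra.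
have se0 : 0 < Num.sqrt eta2 by rewrite sqrtr_gt0.
by have [_] := main _ se0; rewrite (sqr_sqrtr (ltW e0)) /eta2; lra.
Qed.

End conditional_laws.

End weakly_monotone_drift.

(** * Controls and states *)

Section ae_equal.
Context d (T : measurableType d) (R : realType) (mu : {measure set T -> \bar R}).

Lemma ip_ae_eq (f f' h : T -> R) : L2 mu setT f -> L2 mu setT f' ->
  L2 mu setT h -> {ae mu, forall x, f x = f' x} -> ip mu setT f h = ip mu setT f' h.
Proof.
move=> lf lf' lh ff'; apply: EFin_inj; rewrite !ipE//.
apply: ae_eq_integral => //.
- by apply/measurable_EFinP; apply: measurable_funM; [exact: lf.1|exact: lh.1].
- by apply/measurable_EFinP; apply: measurable_funM; [exact: lf'.1|exact: lh.1].
- by move: ff'; apply: filterS => x -> _.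
Qed.

Lemma ip_ae_eqr (f f' h : T -> R) : L2 mu setT f -> L2 mu setT f' ->
  L2 mu setT h -> {ae mu, forall x, f x = f' x} -> ip mu setT h f = ip mu setT h f'.
Proof. by move=> lf lf' lh ff'; rewrite ipC (ip_ae_eq lf lf' lh ff') ipC. Qed.

Lemma ip_linr k (f g h : T -> R) : L2 mu setT f -> L2 mu setT g -> L2 mu setT h ->
  ip mu setT f (fun x => k * g x + h x) = k * ip mu setT f g + ip mu setT f h.
Proof.
move=> lf lg lh; rewrite ipC (ip_linl measurableT k lg lh lf).
by congr (_ * _ + _); rewrite ipC.
Qed.

Lemma ipBr (f g h : T -> R) : L2 mu setT f -> L2 mu setT g -> L2 mu setT h ->
  ip mu setT f (fun x => g x - h x) = ip mu setT f g - ip mu setT f h.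
Proof.
move=> lf lg lh; rewrite ipC (ipBl measurableT lg lh lf).
by congr (_ - _); rewrite ipC.
Qed.

Lemma ipsqr_ae_eq (f f' : T -> R) : L2 mu setT f -> L2 mu setT f' ->
  {ae mu, forall x, f x = f' x} -> ip mu setT f f = ip mu setT f' f'.
Proof.
by move=> lf lf' ff'; rewrite (ip_ae_eq lf lf' lf)// ipC (ip_ae_eq lf lf' lf').
Qed.

Lemma L2_ae_eq (f f' : T -> R) : measurable_fun setT f' -> L2 mu setT f ->
  {ae mu, forall x, f x = f' x} -> L2 mu setT f'.
Proof.
move=> mf' lf ff'; split=> //; have [mf] := lf; congr (_ < _)%E.
apply: ae_eq_integral => //.
- by apply/measurable_EFinP; exact: measurable_funX.
- by apply/measurable_EFinP; exact: measurable_funX.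
- by move: ff'; apply: filterS => x -> _.
Qed.

Lemma L2_scale (k : R) (f : T -> R) : L2 mu setT f -> L2 mu setT (fun x => k * f x).
Proof.
move=> lf; have l0 : L2 mu setT (fun=> 0 : R).
  split=> //; under eq_integral do rewrite expr0n/=.
  by rewrite integral0 ltry.
by have := L2_lin measurableT k lf l0; under eq_fun do rewrite addr0.
Qed.

End ae_equal.

Section time_integral.
Context d (Omega : measurableType d) (R : realType) (P : probability Omega R).
Local Notation mu := (@lebesgue_measure R).
Local Notation M := (mu \x P)%E.
Variables (A : set R) (c : R).
Hypothesis mA : measurable A.
Hypothesis muA : mu A = c%:E.

Definition supported_in (f : R * Omega -> R) := forall z, ~ A z.1 -> f z = 0.

Definition time_integral (f : R * Omega -> R) (w : Omega) : R :=
  (\int[mu]_r f (r, w))%R.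

Lemma indic_sqr (T : Type) (B : set T) x : (\1_B x : R) ^+ 2 = \1_B x.
Proof. by rewrite indicE; case: (x \in B); rewrite ?expr1n ?expr0n. Qed.

Lemma L2_indic : L2 mu setT (\1_A : R -> R).
Proof.
split=> //; under eq_integral => x _ do rewrite indic_sqr.
by rewrite integral_indic// setIT (_ : _ A = c%:E)// ltry.
Qed.

Lemma ip_indic : ip mu setT (\1_A : R -> R) \1_A = c.
Proof.
apply: EFin_inj; rewrite (ipsqrE measurableT L2_indic).
under eq_integral => x _ do rewrite indic_sqr.
by rewrite integral_indic// setIT.
Qed.

Lemma L2_section (f : R * Omega -> R) (w : Omega) : measurable_fun setT f ->
  (\int[mu]_r (f (r, w) ^+ 2)%:E < +oo)%E -> L2 mu setT (fun r => f (r, w)).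
Proof. by move=> mf fw; split=> //; exact: measurableT_comp. Qed.

Lemma ae_L2_section (f : R * Omega -> R) : L2 M setT f ->
  {ae P, forall w, L2 mu setT (fun r => f (r, w))}.
Proof.
move=> lf; have := ae_integrable2 (L2_integrable_sqr lf).
apply: filterS => w /integrableP[_ fw]; apply: L2_section; first exact: lf.1.
apply: le_lt_trans fw; rewrite le_eqVlt; apply/orP; left; apply/eqP.
by apply: eq_integral => r _; rewrite gee0_abs// lee_fin sqr_ge0.
Qed.

Lemma time_integralE (f : R * Omega -> R) w : supported_in f ->
  time_integral f w = ip mu setT (fun r => f (r, w)) \1_A.
Proof.
move=> sf; rewrite /time_integral /ip /Rintegral; congr fine.
apply: eq_integral => r _; congr EFin; rewrite indicE.
have [_|Ar] := boolP (r \in A); first by rewrite mulr1.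
by rewrite mulr0 sf//= => Ar'; move: Ar; rewrite notin_setE; exact.
Qed.

(** The support has finite measure, so the function is its own product with a square-integrable
    indicator. *)
Lemma integrable_supported (f : R * Omega -> R) : supported_in f ->
  L2 M setT f -> M.-integrable setT (EFin \o f).
Proof.
move=> sf lf; pose h := \1_(A `*` setT) : R * Omega -> R.
have mAT : measurable (A `*` (setT : set Omega)) by exact: measurableX.
have lh : L2 M setT h.
  split; first exact: measurable_indic.
  under eq_integral => x _ do rewrite indic_sqr.
  rewrite integral_indic// setIT.
  apply: (@le_lt_trans _ _ c%:E); last exact: ltry.
  rewrite le_eqVlt; apply/orP; left; apply/eqP.
  transitivity (mu A * P setT)%E; first exact: product_measure1E.
  by rewrite muA probability_setT mule1.
have := L2_integrableM measurableT lf lh; apply: eq_integrable => // z _.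
rewrite /h indicE; have [_|Az] := boolP (z \in _); first by rewrite mulr1.
rewrite mulr0 /= sf// => Azz; move: Az; rewrite notin_setE; apply.
by split.
Qed.

Lemma measurable_time_integral (f : R * Omega -> R) : supported_in f ->
  L2 M setT f -> measurable_fun setT (time_integral f).
Proof.
move=> sf lf; apply: measurableT_comp => //.
exact: (measurable_fubini_G (integrable_supported sf lf)).
Qed.

Lemma time_integral_sqr_le (f : R * Omega -> R) w : supported_in f ->
  L2 mu setT (fun r => f (r, w)) ->
  ((time_integral f w ^+ 2)%:E <= c%:E * \int[mu]_r (f (r, w) ^+ 2)%:E)%E.
Proof.
move=> sf lfw; rewrite time_integralE// -(ipsqrE measurableT lfw) -EFinM lee_fin.
have := ip_cauchy_schwarz measurableT lfw L2_indic.
by rewrite ip_indic mulrC.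
Qed.

Lemma muA_ge0 : 0 <= c. Proof. by rewrite -lee_fin -muA. Qed.

Lemma fubini_sqr (f : R * Omega -> R) : measurable_fun setT f ->
  (\int[M]_z (f z ^+ 2)%:E = \int[P]_w \int[mu]_r (f (r, w) ^+ 2)%:E)%E.
Proof.
move=> mf; have mf2 : measurable_fun setT (fun z => (f z ^+ 2)%:E).
  by apply/measurable_EFinP; exact: measurable_funX.
have f20 z : (0 <= (f z ^+ 2)%:E)%E by rewrite lee_fin sqr_ge0.
by rewrite fubini_tonelli1// (@fubini_tonelli _ _ _ _ _ mu P _ mf2 f20).
Qed.

Lemma measurable_int_sqr (f : R * Omega -> R) : measurable_fun setT f ->
  measurable_fun setT (fun w => \int[mu]_r (f (r, w) ^+ 2)%:E)%E.
Proof.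
move=> mf; apply: (@measurable_fun_fubini_tonelli_G _ _ _ _ _ mu (fun z => (f z ^+ 2)%:E)).
- by apply/measurable_EFinP; exact: measurable_funX.
- by move=> z; rewrite lee_fin sqr_ge0.
Qed.

(** Cauchy-Schwarz in time against the indicator of [A], whose squared norm is the length [c],
    followed by Tonelli. *)
Lemma time_integral_L2 (f : R * Omega -> R) : supported_in f ->
  L2 M setT f -> L2 P setT (time_integral f) /\
  ip P setT (time_integral f) (time_integral f) <= c * ip M setT f f.
Proof.
move=> sf lf; have mI := measurable_time_integral sf lf.
have h : (\int[P]_w (time_integral f w ^+ 2)%:E <= (c * ip M setT f f)%:E)%E.
  rewrite EFinM (ipsqrE measurableT lf) fubini_sqr; last exact: lf.1.
  have i0 w : (0 <= \int[mu]_r (f (r, w) ^+ 2)%:E)%E.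
    by apply: integral_ge0 => r _; rewrite lee_fin sqr_ge0.
  have mi := measurable_int_sqr lf.1.
  rewrite -ge0_integralZl ?lee_fin ?muA_ge0//.
  apply: ae_ge0_le_integral => //.
  - by move=> w _; rewrite lee_fin sqr_ge0.
  - by apply/measurable_EFinP; exact: measurable_funX.
  - by move=> w _; rewrite mule_ge0// lee_fin muA_ge0.
  - exact: measurable_funeM.
  - have := ae_L2_section lf; apply: filterS => w lw _.
    exact: time_integral_sqr_le.
have l : L2 P setT (time_integral f).
  by split=> //; apply: le_lt_trans h _; rewrite ltry.
by split=> //; rewrite -lee_fin ipsqrE.
Qed.

(** Almost surely only: on the null set of paths that are not square-integrable the integrals may be
    default values, which need not add up. *)
Lemma time_integral_lin k (f g : R * Omega -> R) :
  supported_in f -> supported_in g -> L2 M setT f -> L2 M setT g ->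
  {ae P, forall w, time_integral (fun z => k * f z + g z) w =
     k * time_integral f w + time_integral g w}.
Proof.
move=> sf sg lf lg; have := ae_L2_section lf; have := ae_L2_section lg.
apply: filterS2 => w lgw lfw; rewrite !time_integralE//; last first.
  by move=> z Az; rewrite sf// sg// mulr0 addr0.
by rewrite -(ip_linl measurableT k lfw lgw L2_indic).
Qed.

End time_integral.

(** * Second moments of Gaussian laws and of Brownian motion *)

Section normal_second_moment.
Context (R : realType).
Local Notation mu := (@lebesgue_measure R).

(** The change of variables is stated with an abstract Radon-Nikodym derivative; it agrees almost
    everywhere with the explicit density, both having the same integrals. *)
Lemma ge0_integral_normal_prob (s : R) (f : R -> \bar R) : measurable_fun setT f ->
  (forall x, 0 <= f x)%E ->
  (\int[normal_prob 0 s]_x f x = \int[mu]_x (f x * (normal_pdf 0 s x)%:E))%E.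
Proof.
move=> mf f0; have dom := @normal_prob_dominates R 0 s.
rewrite -(Radon_Nikodym_SigmaFinite.change_of_variables dom)//.
apply: ae_eq_integral => //.
- apply: emeasurable_funM => //; apply: (measurable_int mu).
  exact: Radon_Nikodym_SigmaFinite.f_integrable.
- apply: emeasurable_funM => //; apply/measurable_EFinP.
  exact: measurable_normal_pdf.
- apply: ae_eqe_mul2l.
  apply: integral_ae_eq => //.
  + exact: Radon_Nikodym_SigmaFinite.f_integrable.
  + by apply/measurable_EFinP; exact: measurable_normal_pdf.
  + by move=> E _ mE; rewrite -Radon_Nikodym_SigmaFinite.f_integral.
Qed.

(** With y = x^2 / (4 s^2) the claim is 4 s^2 y exp(-2y) <= 4 s^2 exp(-y), that is y <= exp(y): half
    of the exponent absorbs the square and leaves a Gaussian of doubled variance. *)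
Lemma sqr_normal_fun_le (s x : R) : s != 0 ->
  x ^+ 2 * normal_fun 0 s x <= 4 * s ^+ 2 * normal_fun 0 (Num.sqrt 2 * s) x.
Proof.
move=> s0; rewrite /normal_fun subr0 exprMn sqr_sqrtr//.
have s2 : 0 < s ^+ 2 by rewrite exprn_even_gt0.
move: (s ^+ 2) s2 (x ^+ 2) => u u0 v.
have yE : v / (2 * u *+ 2) = v / u / 4.
  by rewrite -mulr_natr !invfM !mulrA; lra.
have yE' : v / (u *+ 2) = v / u / 4 + v / u / 4.
  by rewrite -mulr_natr invfM mulrA; lra.
rewrite !mulNr yE yE'.
have -> : v = 4 * u * (v / u / 4) by rewrite mulrC !mulrA; field; lra.
have -> : 4 * u * (v / u / 4) / u / 4 = v / u / 4.
  by congr (_ / 4); field; lra.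
move: (v / u / 4) => y.
rewrite opprD expRD mulrA -mulrA -[leRHS]mulr1 -!mulrA ler_pM2l ?ltr0n// ler_pM2l//.
rewrite mulrCA ler_pM2l ?expR_gt0//.
rewrite expRN ler_pdivrMr ?expR_gt0// mul1r.
by apply: le_trans (expR_ge1Dx y); lra.
Qed.

Lemma normal_second_moment (s : R) : s != 0 ->
  (\int[normal_prob 0 s]_x (x ^+ 2)%:E < +oo)%E.
Proof.
move=> s0; rewrite ge0_integral_normal_prob; last 2 first.
- by apply/measurable_EFinP; exact: measurable_funX.
- by move=> x; rewrite lee_fin sqr_ge0.
have s20 : Num.sqrt 2 * s != 0 by rewrite mulf_neq0// gt_eqF// sqrtr_gt0.
pose t := Num.sqrt 2 * s.
(* The ratio of the normalising constants converts the bound on unnormalised Gaussians into one on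
   densities. *)
pose K := normal_peak s * (4 * s ^+ 2) / normal_peak t.
have K0 : 0 <= K by rewrite divr_ge0 ?normal_peak_ge0// mulr_ge0 ?normal_peak_ge0// mulr_ge0 ?sqr_ge0.
apply: (@le_lt_trans _ _ (\int[mu]_x (K%:E * (normal_pdf 0 t x)%:E))%E).
  apply: ge0_le_integral => //.
  - by move=> x _; rewrite -EFinM lee_fin mulr_ge0 ?sqr_ge0 ?normal_pdf_ge0.
  - apply/measurable_EFinP; apply: measurable_funM; first exact: measurable_funX.
    exact: measurable_normal_pdf.
  - by apply: measurable_funeM; apply/measurable_EFinP; exact: measurable_normal_pdf.
  - move=> x _; rewrite -!EFinM lee_fin !normal_pdfE// /K.
    rewrite mulrCA -!mulrA ler_wpM2l ?normal_peak_ge0//.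
    rewrite mulKf ?gt_eqF ?normal_peak_gt0// !mulrA.
    by have := sqr_normal_fun_le x s0; rewrite !expr2 !mulrA.
rewrite ge0_integralZl//.
- by rewrite integral_normal_pdf mule1 ltry.
- by apply/measurable_EFinP; exact: measurable_normal_pdf.
- by move=> x _; rewrite lee_fin normal_pdf_ge0.
Qed.

End normal_second_moment.

Section brownian_second_moment.
Context d (Omega : measurableType d) (R : realType) (P : probability Omega R).

(** Almost surely W_t is the increment from time 0, hence Gaussian; time 0 is separate, since
    increments are prescribed for s < t only. *)
Lemma brownian_L2 (T : R) (W : R -> Omega -> R) (t : R) : brownian P T W ->
  0 <= t <= T -> L2 P setT (W t).
Proof.
move=> [mW W0 _ _ Wn] tT; have mWt := mW t tT; have /andP[t0 tT'] := tT.
have T0 : 0 <= T by exact: le_trans tT'.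
have mW0 : measurable_fun setT (W 0) by apply: mW; rewrite lexx.
have [->|tn0] := eqVneq t 0.
  apply: (@L2_ae_eq _ _ _ P (fun=> 0)) => //; first exact: L2_cst.
  by move: W0; apply: filterS => w ->.
have {tn0}tp : 0 < t by rewrite lt0r tn0.
have mD : measurable_fun setT (fun w => W t w - W 0 w) by exact: measurable_funB.
have lD : L2 P setT (fun w => W t w - W 0 w).
  split=> //.
  pose D w : measurableTypeR R := W t w - W 0 w.
  have mD' : measurable_fun setT D by exact: mD.
  have mf : measurable_fun setT (fun x : measurableTypeR R => (x ^+ 2)%:E).
    by apply/measurable_EFinP; exact: measurable_funX.
  have f0 (x : R) : (0 <= (x ^+ 2)%:E)%E by rewrite lee_fin sqr_ge0.
  rewrite -(ge0_integral_law P mD' mf f0).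
  have t1 : Num.sqrt t != 0 by rewrite gt_eqF// sqrtr_gt0.
  have E (A : set R) : measurable A -> law P mD' A = normal_prob 0 (Num.sqrt t) A.
    move=> mA; have := Wn 0 t (lexx _) tp tT' A mA; rewrite subr0 => <-.
    exact: lawE.
  apply: le_lt_trans (normal_second_moment t1).
  rewrite le_eqVlt; apply/orP; left; apply/eqP.
  apply: eq_measure_integral.
  by move=> A mA _; exact: E.
apply: (L2_ae_eq mWt lD).
by move: W0; apply: filterS => w ->; rewrite subr0.
Qed.

End brownian_second_moment.

Section controls.
Context d (Omega : measurableType d) (R : realType) (P : probability Omega R).
Variables (T : R) (gen : R -> set (set Omega)).
Hypothesis gen_measurable : forall t, 0 <= t <= T -> <<s gen t >> `<=` measurable.
Hypothesis T_ge0 : 0 <= T.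
Local Notation mu := (@lebesgue_measure R).
Local Notation M := (mu \x P)%E.
Local Notation I := `[0, T]%classic.

(* Controls are kept as square-integrable functions on all of [R * Omega] that
   vanish outside [0, T]. *)
Definition control (f : R * Omega -> R) :=
  [/\ progressive T gen (fun t w => f (t, w)), L2 M setT f & supported_in I f].

Definition control_of (b : R -> Omega -> R) : R * Omega -> R :=
  (fun z => b z.1 z.2) \_ (I `*` setT).

Let TT : 0 <= T <= T. Proof. by rewrite T_ge0 lexx. Qed.

Let mI : measurable I. Proof. exact: measurable_itv. Qed.

Let mIT : measurable (I `*` setT : set (R * Omega)).
Proof. exact: measurableX. Qed.

Lemma lebesgue_itv0 (t : R) : 0 <= t -> mu `[0, t]%classic = t%:E.
Proof.
move=> t0; rewrite lebesgue_measure_itv/= lte_fin oppr0 adde0.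
by case: ltgtP t0 => // <-.
Qed.

Lemma control_of_in (b : R -> Omega -> R) t w : 0 <= t <= T ->
  control_of b (t, w) = b t w.
Proof.
by move=> tT; rewrite /control_of patchE ifT// inE; split=> //=; rewrite in_itv.
Qed.

Lemma control_of_out (b : R -> Omega -> R) t w : ~ (0 <= t <= T) ->
  control_of b (t, w) = 0.
Proof.
move=> tT; rewrite /control_of patchE ifF//; apply/negP; rewrite inE => -[/=].
by rewrite in_itv.
Qed.

Lemma progressive_measurable (b : R -> Omega -> R) : progressive T gen b ->
  measurable_fun (I `*` setT : set (R * Omega)) (fun z => b z.1 z.2).
Proof.
move=> /(_ T TT) mb.
pose E := g_sigma_algebraType (gen T).
pose j (z : R * Omega) : R * E := (z.1, z.2).
have mj : measurable_fun setT j.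
  apply/measurable_fun_pairP; split; first exact: measurable_fst.
  exact: (measurableT_comp (measurable_id_sub (gen_measurable TT)) measurable_snd).
have := @measurable_comp _ _ _ _ _ _ (I `*` setT) _ (I `*` setT) j _ _ mb.
apply; first by exact: measurableX.
  by move=> _ [z [zI _] <-].
exact: measurable_funTS.
Qed.

Lemma eq_progressive (b b' : R -> Omega -> R) :
  (forall t w, 0 <= t <= T -> b t w = b' t w) ->
  progressive T gen b -> progressive T gen b'.
Proof.
move=> bb' pb t tT; refine (eq_measurable_fun _ _ (pb t tT)).
move=> [s w]; rewrite inE => -[/=]; rewrite in_itv/= => /andP[s0 st] _.
by rewrite bb'// s0/= (le_trans st)//; have /andP[] := tT.
Qed.

Lemma integral_sqr_control_of (b : R -> Omega -> R) w :
  (\int[mu]_r ((control_of b (r, w)) ^+ 2)%:E = \int[mu]_(r in `[0%R, T]) ((b r w) ^+ 2)%:E)%E.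
Proof.
rewrite [RHS]integral_mkcond; apply: eq_integral => r _.
rewrite patchE; have [|rI] := boolP (r \in I).
  by rewrite inE/= in_itv/= => rT; rewrite control_of_in.
rewrite control_of_out ?expr0n//= => rT; move: rI; rewrite notin_setE; apply.
by rewrite /= in_itv.
Qed.

Lemma control_of_control (b : R -> Omega -> R) : H2 P T gen b ->
  control (control_of b).
Proof.
move=> [pb b2].
have mf : measurable_fun setT (control_of b).
  by apply/measurable_restrict => //; rewrite setTI; exact: progressive_measurable.
split.
- by apply: eq_progressive pb => t w tT; rewrite control_of_in.
- split; first exact: mf.
  rewrite (fubini_sqr P mf).
  by under eq_integral do rewrite integral_sqr_control_of.
- move=> [t w] /= tI; rewrite control_of_out// => tT; apply: tI; rewrite in_itv.
Qed.

Lemma control_H2 (f : R * Omega -> R) : control f -> H2 P T gen (fun t w => f (t, w)).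
Proof.
move=> [pf [mf f2] sf]; split; first exact: pf.
move: f2; rewrite (fubini_sqr P mf); apply: le_lt_trans.
rewrite le_eqVlt; apply/orP; left; apply/eqP; apply: eq_integral => w _; symmetry.
rewrite -(integral_sqr_control_of (fun t w => f (t, w))).
apply: eq_integral => r _; have [rT|rT] := pselect (0 <= r <= T).
  by rewrite control_of_in.
rewrite control_of_out// sf//= in_itv/=; exact/negP.
Qed.

Lemma control_lin k (f g : R * Omega -> R) : control f -> control g ->
  control (fun z => k * f z + g z).
Proof.
move=> [pf lf sf] [pg lg sg]; split.
- move=> t tT; apply: measurable_funD; last exact: pg.
  by apply: measurable_funM; [exact: measurable_cst|exact: pf].
- exact: L2_lin.
- by move=> z zI; rewrite sf// sg// mulr0 addr0.
Qed.

Lemma constant_H2 (c : R) : H2 P T gen (fun _ _ => c).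
Proof.
split; first by move=> t tT; exact: measurable_cst.
have -> : (\int[mu]_(_ in I) (c ^+ 2)%:E = (c ^+ 2 * T)%:E)%E.
  by rewrite integral_cst// [X in (_ * X)%E]lebesgue_itv0.
by rewrite integral_cst// [X in (_ * X)%E]probability_setT mule1 ltry.
Qed.

Lemma control_complete (f : nat -> R * Omega -> R) (r C : R) : 0 < r < 1 ->
  (forall n, control (f n)) ->
  (forall n, ip M setT (fun z => f n.+1 z - f n z) (fun z => f n.+1 z - f n z)
     <= C * r ^+ (4 * n)) ->
  exists l K, control l /\
    forall n, ip M setT (fun z => f n z - l z) (fun z => f n z - l z) <= K * r ^+ n.
Proof.
move=> r01 cf fC.
have lf n : L2 M setT (f n) by have [] := cf n.
have [ll [K lK]] := L2_complete measurableT r01 lf fC.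
(* The witness has to be the explicit limit of [L2_complete]: restricted to [0, t] it is measurable
   for the sigma-algebra at time t, for every t at once. *)
exists (fun x => fine (limn_esup (fun n => (f n x)%:E))), K; split=> //; split=> //.
- move=> t tT; have mD : measurable (`[0, t]%classic `*` setT : set (R * g_sigma_algebraType (gen t))).
    by apply: measurableX => //; exact: measurable_itv.
  apply: (@measurable_comp _ _ _ _ _ _ setT) => //.
  apply: measurable_fun_limn_esup => n; apply/measurable_EFinP.
  by have [pf _ _] := cf n; exact: (pf t tT).
- move=> z zI.
  have -> : (fun n => (f n z)%:E) = (fun=> 0%E).
    by apply/funext => n; have [_ _ ->] := cf n.
  have c0 : (fun=> 0%E : \bar R) @ \oo --> (0%E : \bar R) by exact: cvg_cst.
  by rewrite is_cvg_limn_esupE ?(cvg_lim _ c0)//; exact: (cvgP _ c0).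
Qed.

Lemma control_time_integral (f : R * Omega -> R) w : control f ->
  time_integral f w = \int[mu]_(r in `[0%R, T]) f (r, w).
Proof.
move=> [_ _ sf]; rewrite /time_integral [RHS]Rintegral_mkcond.
congr fine; apply: eq_integral => r _; congr EFin.
by rewrite patchE; case: (boolP (r \in I)) => //; rewrite notin_setE => rI; exact: sf.
Qed.

Lemma partial_integral_L2 (f : R * Omega -> R) t : control f -> 0 <= t <= T ->
  L2 P setT (fun w => \int[mu]_(r in `[0, t]) f (r, w)).
Proof.
move=> [_ lf _] /andP[t0 _]; pose h := f \_ (`[0, t]%classic `*` setT).
have mt : measurable `[0, t]%classic by exact: measurable_itv.
have mtT : measurable (`[0, t]%classic `*` setT : set (R * Omega)) by exact: measurableX.
have lh : L2 M setT h.
  apply: (le_L2 measurableT _ lf) => [|z _].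
    apply/measurable_restrict => //; rewrite setTI; apply: measurable_funTS.
    exact: lf.1.
  by rewrite /h patchE; case: ifP => // _; rewrite expr0n sqr_ge0.
have sh : supported_in `[0, t]%classic h.
  by move=> z zt; rewrite /h patchE ifF//; apply/negP; rewrite inE => -[].
have [+ _] := time_integral_L2 mt (lebesgue_itv0 t0) sh lh.
congr (L2 _ _ _); apply/funext => w; rewrite /time_integral [RHS]Rintegral_mkcond.
congr fine; apply: eq_integral => r _; congr EFin; rewrite /h !patchE.
suff -> : ((r, w) \in `[0, t]%classic `*` setT) = (r \in `[0, t]%classic) by [].
by apply/idP/idP; rewrite !inE/= => // -[].
Qed.

End controls.

(** * Optimality and equilibrium *)

Section derivative.
Context (R : realType) (f : R -> R).
Hypothesis df : forall x, derivable f x 1.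

(** Only a sequence of increments is kept, because measurability passes to limits of sequences. *)
Lemma difference_quotient_cvg (x : R) :
  (f (x + n.+1%:R^-1) - f x) * n.+1%:R @[n --> \oo] --> (f^`()%classic) x.
Proof.
have h0 : (fun n : nat => n.+1%:R^-1 : R) @ \oo --> (0 : R)^'.
  move=> U [e /= e0 eU]; have := @cvg_harmonic R.
  move=> /cvgrPdist_lt /(_ e e0); apply: filterS => n /= ne; exact: eU.
have dx : h^-1 *: ((f \o shift x) (h *: (1 : R)) - f x) @[h --> (0 : R)^'] -->
    (f^`()%classic) x.
  by rewrite derive1E; exact: (@df x).
have := cvg_comp _ _ h0 dx; apply: cvg_trans.
apply: near_eq_cvg; apply: nearW => n /=.
rewrite invrK; change (n.+1%:R * (f (n.+1%:R^-1 * 1 + x) - f x) =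
  (f (x + n.+1%:R^-1) - f x) * n.+1%:R).
by rewrite mulr1 mulrC [x + _]addrC.
Qed.

(** The mean value theorem gives a slope at an intermediate point, and the monotone derivative
    compares it with the slope at [x]. *)
Lemma convex_tangent_le (x y : R) :
  (forall u v, 0 <= ((f^`()%classic) u - (f^`()%classic) v) * (u - v)) ->
  (f^`()%classic) x * (y - x) <= f y - f x.
Proof.
move=> mono.
have der (z : R) : is_derive z (1 : R) f ((f^`()%classic) z).
  by rewrite derive1E; exact/derivableP.
have cf : continuous f by move=> z; exact/differentiable_continuous/derivable1_diffP.
have mvt a b : a < b -> exists2 c, c \in `]a, b[ & f b - f a = (f^`()%classic) c * (b - a).
  by move=> ab; apply: MVT => //; exact: continuous_subspaceT.
have [xy|yx|->] := ltgtP x y; last by rewrite !subrr mulr0.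
- have [c + ->] := mvt _ _ xy; rewrite in_itv/= => /andP[xc _].
  rewrite ler_wpM2r ?subr_ge0 ?(ltW xy)//; have := mono c x.
  by rewrite pmulr_lge0 ?subr_gt0// subr_ge0.
- have [c + e] := mvt _ _ yx; rewrite in_itv/= => /andP[_ cx].
  rewrite -[y - x]opprB mulrN -[leRHS]opprB lerN2 e.
  rewrite ler_wpM2r ?subr_ge0 ?(ltW yx)//; have := mono x c.
  by rewrite pmulr_lge0 ?subr_gt0// subr_ge0.
Qed.

End derivative.

Lemma ae_measurable_funR d (T : measurableType d) (R : realType)
    (mu : {measure set T -> \bar R}) (f g : T -> R) : measure_is_complete mu ->
  {ae mu, forall x, f x = g x} -> measurable_fun setT f -> measurable_fun setT g.
Proof.
move=> cmu fg mf; apply/measurable_EFinP.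
apply: (@ae_measurable_fun _ _ _ mu cmu _ (EFin \o f)); last exact/measurable_EFinP.
by move: fg; apply: filterS => x /= -> _.
Qed.

Section quadratic_bounds.
Context (R : realDomainType).

(** In use, [x] and [y] are the two terms of a(u, v), [a] and [b] the squared norms of u and v, [c]
    that of the drift, [e] that of the time integral of v, and [t] is the horizon. *)
Lemma sqr_sum_le1 (x y a b c e t : R) : x ^+ 2 <= a * b -> y ^+ 2 <= c * e ->
  0 <= c -> e <= t * b -> (x + y) ^+ 2 <= 2 * (a + t * c) * b.
Proof.
move=> xab yce c0 etb; have := ler_wpM2l c0 etb; have := sqr_ge0 (x - y); lra.
Qed.

(** The same roles for the differences belonging to two controls, with [k] for [Cg]. The Lipschitz
    constant is 2 (1 + 8 k^2 t * t). *)
Lemma sqr_sum_le2 (x y a b c e k t : R) : x ^+ 2 <= a * b -> y ^+ 2 <= c * e ->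
  0 <= c -> 0 <= e -> c <= 8 * k ^+ 2 * t * a -> e <= t * b ->
  (x + y) ^+ 2 <= (2 + 16 * k ^+ 2 * t ^+ 2) * a * b.
Proof.
move=> xab yce c0 e0 ck etb; have := ler_pM c0 e0 ck etb.
have := sqr_ge0 (x - y); lra.
Qed.

End quadratic_bounds.

(** Here [nu] and [na] are the squared norms of the critical control and of its competitor, [p]
    their product and [q] the linearised terminal gain. The costs differ by at least half the
    squared norm of the difference of the controls. *)
Lemma first_order_gap (R : realFieldType) (nu na p q gu ga : R) :
  p - nu + q = 0 -> 0 <= na - 2 * p + nu -> q <= ga - gu ->
  nu / 2 + gu <= na / 2 + ga.
Proof. lra. Qed.

Section filtrations.
Context d (Omega : measurableType d) (R : realType) (P : probability Omega R).
Hypothesis P_complete : measure_is_complete P.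
Variables (T : R) (xi0 : Omega -> R) (W tW : R -> Omega -> R).
Hypothesis mxi0 : measurable_fun setT xi0.
Hypothesis mW : forall t, 0 <= t <= T -> measurable_fun setT (W t).
Hypothesis mtW : forall t, 0 <= t <= T -> measurable_fun setT (tW t).

Let gen_rv_measurable (X : Omega -> R) : measurable_fun setT X ->
  gen_rv X `<=` measurable.
Proof. by move=> mX _ [B mB <-]; exact: mX. Qed.

Let gen_past_measurable (Y : R -> Omega -> R) t : 0 <= t <= T ->
  (forall s, 0 <= s <= T -> measurable_fun setT (Y s)) ->
  gen_past Y t `<=` measurable.
Proof.
move=> /andP[_ tT] mY A [s /=]; rewrite in_itv/= => /andP[s0 st].
by apply: gen_rv_measurable; apply: mY; rewrite s0 (le_trans st tT).
Qed.

Lemma gen_F_measurable t : 0 <= t <= T -> <<s gen_F P xi0 W tW t >> `<=` measurable.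
Proof.
move=> tT; apply: smallest_sub; first exact: sigma_algebra_measurable.
move=> A [[[|]|]|].
- exact: gen_rv_measurable.
- exact: gen_past_measurable.
- exact: gen_past_measurable.
- exact: P_complete.
Qed.

Lemma gen_tF_measurable t : 0 <= t <= T -> <<s gen_tF P tW t >> `<=` measurable.
Proof.
move=> tT; apply: smallest_sub; first exact: sigma_algebra_measurable.
move=> A [|]; [exact: gen_past_measurable|exact: P_complete].
Qed.

End filtrations.

Section mean_field_game.
Context (R : realType) d (Omega : measurableType d) (P : probability Omega R).
Variables (T sigma tsigma : R) (W tW : R -> Omega -> R) (xi0 : Omega -> R).
Hypothesis P_complete : measure_is_complete P.
Hypothesis T_gt0 : 0 < T.
Hypothesis W_BM : brownian P T W.
Hypothesis tW_BM : brownian P T tW.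
Hypothesis xi0_meas : measurable_fun setT xi0.
Hypothesis xi0_L2 : (\int[P]_w ((xi0 w) ^+ 2)%:E < +oo)%E.
Local Notation mu := (@lebesgue_measure R).
Local Notation M := (mu \x P)%E.
Local Notation gF := (gen_F P xi0 W tW).
Local Notation ctrl := (control P T gF).
Local Notation state u := (state sigma tsigma xi0 W tW (fun t w => u (t, w))).
Local Notation ipM := (ip M setT).
Local Notation ipP := (ip P setT).

Let mW t : 0 <= t <= T -> measurable_fun setT (W t).
Proof. by have [+ _ _ _ _] := W_BM; exact. Qed.

Let mtW t : 0 <= t <= T -> measurable_fun setT (tW t).
Proof. by have [+ _ _ _ _] := tW_BM; exact. Qed.

Let gFm t (tT : 0 <= t <= T) := gen_F_measurable P_complete xi0_meas mW mtW tT.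
Let gtFm t (tT : 0 <= t <= T) := gen_tF_measurable P_complete mtW tT.

Let T0 : 0 <= T. Proof. exact: ltW. Qed.
Let TT : 0 <= T <= T. Proof. by rewrite T0 lexx. Qed.
Let mI : measurable `[0, T]%classic. Proof. exact: measurable_itv. Qed.
Let muI := lebesgue_itv0 T0.

Lemma state_L2 u t : ctrl u -> 0 <= t <= T -> L2 P setT (state u t).
Proof.
move=> cu tT; rewrite /Defs.state.
apply: L2D => //; last by apply: L2_scale; exact: brownian_L2 tW_BM tT.
apply: L2D => //; last by apply: L2_scale; exact: brownian_L2 W_BM tT.
apply: L2D => //; exact: (partial_integral_L2 cu tT).
Qed.

Let stateE u w : ctrl u ->
  state u T w = xi0 w + time_integral u w + sigma * W T w + tsigma * tW T w.
Proof. by move=> cu; rewrite (control_time_integral _ cu). Qed.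

Lemma drift_L2 u : ctrl u -> L2 P setT (time_integral u) /\
  ipP (time_integral u) (time_integral u) <= T * ipM u u.
Proof. by move=> [_ lu su]; exact: (time_integral_L2 mI muI su lu). Qed.

Lemma state_lin k u v : ctrl u -> ctrl v ->
  {ae P, forall w, state (fun z => k * v z + u z) T w = k * time_integral v w + state u T w}.
Proof.
move=> cu cv; have [_ lu su] := cu; have [_ lv sv] := cv.
have := time_integral_lin mI muI k sv su lv lu.
apply: filterS => w e.
by rewrite (stateE w (control_lin k cv cu)) (stateE w cu) e; lra.
Qed.

Lemma controlB u v : ctrl u -> ctrl v -> ctrl (fun z => u z - v z).
Proof.
move=> cu cv; have := control_lin (-1) cv cu.
by under eq_fun do rewrite mulN1r addrC.
Qed.

(** Initial value and noises cancel. The monotonicity estimate, which speaks of states, thereby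
    becomes one on the pairing of the drift with the difference of the controls. *)
Lemma state_diff u v : ctrl u -> ctrl v ->
  {ae P, forall w, time_integral (fun z => u z - v z) w = state u T w - state v T w}.
Proof.
move=> cu cv; have [_ lu su] := cu; have [_ lv sv] := cv.
have := time_integral_lin mI muI (-1) sv su lv lu.
under [X in time_integral X]eq_fun do rewrite mulN1r addrC.
by apply: filterS => w e; rewrite !stateE// e; lra.
Qed.

Lemma cond_flow_exists u : ctrl u -> exists m : R -> Omega -> P2 R,
  forall t, 0 <= t <= T -> disintegrates P (gen_tF P tW t) (state u t) (m t).
Proof.
move=> cu.
have /choice[m dm] : forall t, exists mt, 0 <= t <= T ->
  disintegrates P (gen_tF P tW t) (state u t) mt; last by exists m.
move=> t; have [tT|] := pselect (0 <= t <= T); last by exists (fun=> dirac0_P2 R).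
have [mX X2] := state_L2 cu tT.
by have [mt] := regular_cond_law_exists (gtFm tT) mX X2; exists mt.
Qed.

Lemma disintegrates_flow u (m : R -> Omega -> P2 R) : ctrl u ->
  (forall t, 0 <= t <= T -> disintegrates P (gen_tF P tW t) (state u t) (m t)) ->
  cond_law_flow P T sigma tsigma xi0 W tW (fun t w => u (t, w)) m.
Proof.
move=> cu dm t tT; apply: (disintegrates_regular_cond_law (gtFm tT)).
- by have [] := state_L2 cu tT.
- exact: dm.
Qed.

Variables (g : R -> P2 R -> R) (Cg : R).
Hypothesis g_integrable : forall (alpha ahat : R -> Omega -> R) (m : R -> Omega -> P2 R),
  H2 P T gF alpha -> H2 P T gF ahat ->
  cond_law_flow P T sigma tsigma xi0 W tW ahat m ->
  P.-integrable setT
    (fun w => (g (Defs.state sigma tsigma xi0 W tW alpha T w) (m T w))%:E).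
Hypothesis g_derivable : forall (x : R) (m : P2 R), derivable (g ^~ m) x 1.
Hypothesis gx_lip_x : forall (x x' : R) (m : P2 R),
  `|g_x g x m - g_x g x' m| <= Cg * `|x - x'|.
Hypothesis gx_mono_x : forall (x x' : R) (m : P2 R),
  0 <= (g_x g x m - g_x g x' m) * (x - x').
Hypothesis gx_lip_m : forall (x : R) (m m' : P2 R),
  `|g_x g x m - g_x g x m'| <= Cg * W2 m m'.
Hypothesis gx_weak_mono : forall (m m' : P2 R) (gamma : probability (R * R)%type R),
  in_P2_plane gamma -> coupling m m' gamma ->
  (0 <= \int[gamma]_z ((g_x g z.1 m - g_x g z.2 m') * (z.1 - z.2))%:E)%E.

Lemma g_state_integrable u v m : ctrl u -> ctrl v ->
  cond_law_flow P T sigma tsigma xi0 W tW (fun t w => u (t, w)) m ->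
  P.-integrable setT (EFin \o (fun w => g (state v T w) (m T w))).
Proof.
by move=> cu cv mm; apply: (g_integrable _ _ mm); exact: control_H2.
Qed.

(* The shift of a control by [n.+1^-1 / T] shifts the terminal state by
   [n.+1^-1], so that [g_integrable] provides the difference quotients of [g]. *)
Lemma gx_state_measurable u m : ctrl u ->
  cond_law_flow P T sigma tsigma xi0 W tW (fun t w => u (t, w)) m ->
  measurable_fun setT (fun w => g_x g (state u T w) (m T w)).
Proof.
move=> cu mm; pose one := control_of T (fun (_ : R) (_ : Omega) => 1 : R).
have c1 : ctrl one by apply: control_of_control => //; exact: constant_H2.
have I1 w : time_integral one w = T.
  rewrite (control_time_integral _ c1).
  transitivity (\int[mu]_(r in `[0, T]) (1 : R)).
    apply: eq_Rintegral => r; rewrite inE/= in_itv/= => rT.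
    by rewrite /one control_of_in.
  by rewrite Rintegral_cst// mul1r [X in fine X]muI.
pose k n : R := n.+1%:R^-1 / T.
have kT n : k n * T = n.+1%:R^-1 by rewrite /k divfK// gt_eqF.
pose q n w := (g (state u T w + n.+1%:R^-1) (m T w) - g (state u T w) (m T w)) * n.+1%:R.
apply: (@measurable_fun_cvg _ _ _ _ q); last first.
  by move=> w _; exact: (@difference_quotient_cvg R (g ^~ (m T w)) (g_derivable ^~ (m T w)) _).
move=> n; have cn : ctrl (fun z => k n * one z + u z) by exact: control_lin.
pose h w := (g (state (fun z => k n * one z + u z) T w) (m T w) - g (state u T w) (m T w)) * n.+1%:R.
(* The shifted state is the state plus 1/(n+1) only almost surely; completeness of [P] makes the
   true quotient measurable nevertheless. *)
apply: (@ae_measurable_funR _ _ _ P h) => //.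
  have := state_lin (k n) cu c1; apply: filterS => w.
  by rewrite /h /q I1 kT => ->; rewrite [X in g X]addrC.
apply: measurable_funM => //; apply: measurable_funB; apply/measurable_EFinP.
- exact: (measurable_int _ (g_state_integrable cu cn mm)).
- exact: (measurable_int _ (g_state_integrable cu cu mm)).
Qed.

(** [weak_monotone_drift] at the terminal time, rewritten in terms of controls; the factor [T] comes
    from bounding a time integral by the norm of its integrand. *)
Lemma gx_state_estimates u v mu_ mv_ : ctrl u -> ctrl v ->
  (forall t, 0 <= t <= T -> disintegrates P (gen_tF P tW t) (state u t) (mu_ t)) ->
  (forall t, 0 <= t <= T -> disintegrates P (gen_tF P tW t) (state v t) (mv_ t)) ->
  let G w := g_x g (state u T w) (mu_ T w) in
  let G' w := g_x g (state v T w) (mv_ T w) in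
  let I w := time_integral (fun z => u z - v z) w in
  [/\ L2 P setT G, L2 P setT G', 0 <= ipP (fun w => G w - G' w) I &
    ipP (fun w => G w - G' w) (fun w => G w - G' w) <=
      8 * Cg ^+ 2 * T * ipM (fun z => u z - v z) (fun z => u z - v z)].
Proof.
move=> cu cv du dv G G' I.
have lX := state_L2 cu TT; have lX' := state_L2 cv TT.
have mG := gx_state_measurable cu (disintegrates_flow cu du).
have mG' := gx_state_measurable cv (disintegrates_flow cv dv).
have [lG lG' GX GG] := weak_monotone_drift gx_lip_x gx_lip_m gx_weak_mono (gtFm TT)
  lX lX' (du T TT) (dv T TT) mG mG'.
have [lI NI] := drift_L2 (controlB cu cv).
have lD := L2B measurableT lX lX'; have lGD := L2B measurableT lG lG'.
have e := state_diff cu cv.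
split; [exact: lG|exact: lG'| |].
  by rewrite (ip_ae_eqr lI lD lGD e).
apply: le_trans GG _; rewrite -(ipsqr_ae_eq lI lD e) -[leRHS]mulrA ler_wpM2l//.
by rewrite mulr_ge0// sqr_ge0.
Qed.

Lemma cost_finite u a m : ctrl u -> ctrl a ->
  cond_law_flow P T sigma tsigma xi0 W tW (fun t w => u (t, w)) m ->
  cost P T sigma tsigma xi0 W tW g (fun t w => a (t, w)) m =
  (ipM a a / 2 + \int[P]_w g (state a T w) (m T w))%:E.
Proof.
move=> cu ca mm; have [_ la sa] := ca.
have ig := g_state_integrable cu ca mm.
rewrite /cost; pose A w := (\int[mu]_r (a (r, w) ^+ 2)%:E)%E.
have A0 w : (0 <= A w)%E by apply: integral_ge0 => r _; rewrite lee_fin sqr_ge0.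
have mA : measurable_fun setT A by apply: measurable_int_sqr; exact: la.1.
have AE w : (\int[mu]_(t in `[0%R, T]) (a (t, w) ^+ 2 / 2)%:E = (2^-1)%:E * A w)%E.
  rewrite integral_mkcond /A -ge0_integralZl//.
  - apply: eq_integral => r _; rewrite patchE; case: ifPn; first by rewrite -EFinM mulrC.
    by rewrite notin_setE => rI; rewrite sa// expr0n mule0.
  - apply/measurable_EFinP; apply: measurable_funX; apply: measurableT_comp => //.
    exact: la.1.
  - by move=> r _; rewrite lee_fin sqr_ge0.
under eq_integral do rewrite AE.
have IA : (\int[P]_w ((2^-1)%:E * A w) = (ipM a a / 2)%:E)%E.
  by rewrite ge0_integralZl// mulrC EFinM (ipsqrE measurableT la) fubini_sqr//; exact: la.1.
have iA : P.-integrable setT (fun w => (2^-1)%:E * A w)%E.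
  apply/integrableP; split; first exact: measurable_funeM.
  under eq_integral do rewrite gee0_abs ?mule_ge0//.
  by rewrite IA ltry.
rewrite integralD//= IA EFinD; congr (_ + _)%E.
by rewrite /Rintegral fineK//; exact: integrable_fin_num.
Qed.

Lemma critical_control_optimal u m : ctrl u ->
  cond_law_flow P T sigma tsigma xi0 W tW (fun t w => u (t, w)) m ->
  L2 P setT (fun w => g_x g (state u T w) (m T w)) ->
  (forall v, ctrl v ->
     ipM u v + ipP (fun w => g_x g (state u T w) (m T w)) (time_integral v) = 0) ->
  forall a, ctrl a -> (cost P T sigma tsigma xi0 W tW g (fun t w => u (t, w)) m <=
    cost P T sigma tsigma xi0 W tW g (fun t w => a (t, w)) m)%E.
Proof.
move=> cu mm lG crit a ca.
rewrite (cost_finite cu cu mm) (cost_finite cu ca mm) lee_fin.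
have [_ lu _] := cu; have [_ la _] := ca.
have ccD := controlB ca cu.
pose G w := g_x g (state u T w) (m T w).
have lG' : L2 P setT G by exact: lG.
have e0 : ipM u (fun z => a z - u z) + ipP G (time_integral (fun z => a z - u z)) = 0.
  exact: crit.
have lX := state_L2 cu TT; have lX' := state_L2 ca TT.
have [lI _] := drift_L2 ccD; have lD := L2B measurableT lX' lX.
have e1 := ip_ae_eqr lI lD lG' (state_diff ca cu).
have e2 := ipBr lu la lu.
have iu := g_state_integrable cu cu mm; have ia := g_state_integrable cu ca mm.
have : ipP G (fun w => state a T w - state u T w) <=
    \int[P]_w g (state a T w) (m T w) - \int[P]_w g (state u T w) (m T w).
  rewrite -RintegralB//; apply: le_Rintegral => //.
  - exact: (L2_integrableM measurableT lG' lD).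
  - exact: (integrableB measurableT ia iu).
  - move=> w _; apply: (@convex_tangent_le R (g ^~ (m T w)) (g_derivable ^~ (m T w))).
    by move=> x y; exact: gx_mono_x.
have := ip_ge0 M setT (fun z => a z - u z); rewrite (ip_sqrB measurableT la lu).
have e3 : ipM u a = ipM a u := ipC _ _ _ _.
move: e0; rewrite e1 e2 e3; exact: first_order_gap.
Qed.

(** Optimality is proved among controls vanishing outside [0, T]; this extends it to arbitrary
    competitors in [H2]. *)
Lemma cost_control_of alpha m :
  cost P T sigma tsigma xi0 W tW g (fun t w => control_of T alpha (t, w)) m =
  cost P T sigma tsigma xi0 W tW g alpha m.
Proof.
rewrite /cost; apply: eq_integral => w _; congr (_ + (g _ _)%:E)%E.
  by apply: eq_integral => r; rewrite inE/= in_itv/= => rT; rewrite control_of_in.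
rewrite /Defs.state; congr (_ + _ + _ + _).
by apply: eq_Rintegral => r; rewrite inE/= in_itv/= => rT; rewrite control_of_in.
Qed.

Lemma control0 : ctrl (fun=> 0).
Proof.
have := control_of_control gFm T0 (@constant_H2 _ _ _ P _ gF T0 0).
by congr control; apply/funext => z; rewrite /control_of patchE; case: ifP.
Qed.

Lemma equilibrium_exists : exists ahat, mfg_solution P T sigma tsigma xi0 W tW g ahat.
Proof.
have exm u : exists m : R -> Omega -> P2 R, ctrl u -> forall t, 0 <= t <= T ->
    disintegrates P (gen_tF P tW t) (state u t) (m t).
  have [cu|ncu] := pselect (ctrl u); last by exists (fun _ _ => dirac0_P2 R).
  by have [m dm] := cond_flow_exists cu; exists m.
have [m dm] := choice exm.
pose G u w := g_x g (state u T w) (m u T w).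
have est u v (cu : ctrl u) (cv : ctrl v) := gx_state_estimates cu cv (dm _ cu) (dm _ cv).
have lG u : ctrl u -> L2 P setT (G u) by move=> cu; have [] := est u u cu cu.
have lc u : ctrl u -> L2 M setT u by case.
(* Functions into [R^o] carry the module structure that the abstract theorem expects. The dependence
   on the first argument is nonlinear, through the flow [m u] chosen for each control. *)
pose a (u v : R * Omega -> R^o) : R := ipM u v + ipP (G u) (time_integral v).
have [u cu crit] : exists2 u, ctrl u & forall v, ctrl v -> a u v = 0.
  apply: (@strongly_monotone_zero R (R * Omega -> R^o) ctrl ipM _ _ _ _ _ _ a
    (2 + 16 * Cg ^+ 2 * T ^+ 2)).
  - exact: control0.
  - by move=> k u v cu cv; exact: control_lin.
  - by move=> u v; exact: ipC.
  - by move=> k u v w /lc cu /lc cv /lc cw; exact: ip_linl.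
  - by move=> u; exact: ip_ge0.
  - by move=> f r C r01 cf fC; apply: (control_complete r01 cf fC).
  - move=> u k v w cu cv cw.
    have [lv sv] : L2 M setT v /\ supported_in `[0, T]%classic v by case: cv.
    have [lw sw] : L2 M setT w /\ supported_in `[0, T]%classic w by case: cw.
    have [lIv _] := drift_L2 cv; have [lIw _] := drift_L2 cw.
    have [lI _] := drift_L2 (control_lin k cv cw).
    have e := time_integral_lin mI muI k sv sw lv lw.
    have e1 : ipM u (k *: v + w) = k * ipM u v + ipM u w := ip_linr k (lc _ cu) lv lw.
    have e2 : ipP (G u) (time_integral (k *: v + w)) =
        k * ipP (G u) (time_integral v) + ipP (G u) (time_integral w).
      rewrite -(ip_linr k (lG _ cu) lIv lIw).
      exact: (ip_ae_eqr lI (L2_lin measurableT k lIv lIw) (lG _ cu) e).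
    by rewrite /a e1 e2 mulrDr addrACA.
  - move=> u cu; exists (2 * (ipM u u + T * ipP (G u) (G u))).
      by rewrite mulr_ge0// addr_ge0 ?ip_ge0// mulr_ge0// ip_ge0.
    move=> v cv; have [lI NI] := drift_L2 cv.
    have c1 := ip_cauchy_schwarz measurableT (lc _ cu) (lc _ cv).
    have c2 := ip_cauchy_schwarz measurableT (lG _ cu) lI.
    exact: (sqr_sum_le1 c1 c2 (ip_ge0 _ _ _) NI).
  - move=> u u' v cu cu' cv; have [lI NI] := drift_L2 cv.
    have [_ _ _ GG] := est u u' cu cu'.
    have lGD := L2B measurableT (lG _ cu) (lG _ cu').
    have luD := L2B measurableT (lc _ cu) (lc _ cu').
    have c1 := ip_cauchy_schwarz measurableT luD (lc _ cv).
    have c2 := ip_cauchy_schwarz measurableT lGD lI.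
    have e : a u v - a u' v = ipM (fun z => u z - u' z) v +
        ipP (fun w => G u w - G u' w) (time_integral v).
      rewrite /a (ipBl measurableT (lc _ cu) (lc _ cu') (lc _ cv)).
      by rewrite (ipBl measurableT (lG _ cu) (lG _ cu') lI) opprD addrACA.
    have NDE : ipM (u - u') (u - u') = ipM (fun z => u z - u' z) (fun z => u z - u' z) by [].
    rewrite e NDE.
    exact: (sqr_sum_le2 c1 c2 (ip_ge0 _ _ _) (ip_ge0 _ _ _) GG NI).
  - move=> u u' cu cu'; have cD := controlB cu cu'.
    have [lI _] := drift_L2 cD; have [_ _ GI _] := est u u' cu cu'.
    have luD := L2B measurableT (lc _ cu) (lc _ cu').
    have e : a u (u - u') - a u' (u - u') =
        ipM (u - u') (u - u') + ipP (fun w => G u w - G u' w)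
          (time_integral (fun z => u z - u' z)).
      have e1 : ipM (u - u') (u - u') = ipM u (u - u') - ipM u' (u - u') :=
        ipBl measurableT (lc _ cu) (lc _ cu') luD.
      rewrite e1 (ipBl measurableT (lG _ cu) (lG _ cu') lI) /a.
      have e3 : (u - u' : R * Omega -> R^o) = (fun z => u z - u' z) by [].
      by rewrite e3 opprD addrACA.
    by rewrite e lerDl.
exists (fun t w => u (t, w)); split; first exact: control_H2.
have mm := disintegrates_flow cu (dm _ cu).
exists (m u); first exact: mm.
move=> alpha H2alpha.
have ca := control_of_control gFm T0 H2alpha.
by rewrite -(cost_control_of alpha); exact: (critical_control_optimal cu mm (lG u cu) crit ca).
Qed.

End mean_field_game.

Theorem theorem4p4 (R : realType) (d : measure_display)
    (Omega : measurableType d) (P : probability Omega R)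
    (T sigma tsigma : R) (W tW : R -> Omega -> R) (xi0 : Omega -> R)
    (g : R -> P2 R -> R) (Cg : R)
    (P_complete : measure_is_complete P)
    (T_gt0 : 0 < T)
    (W_BM : brownian P T W)
    (tW_BM : brownian P T tW)
    (W_indep_tW : indep_systems P <<s gen_past W T >> <<s gen_past tW T >>)
    (xi0_meas : measurable_fun setT xi0)
    (xi0_L2 : (\int[P]_w ((xi0 w) ^+ 2)%:E < +oo)%E)
    (xi0_indep :
       indep_systems P (gen_rv xi0) <<s gen_past W T `|` gen_past tW T >>)
    (g_borel : borel_RxP2 g)
    (g_integrable : forall (alpha ahat : R -> Omega -> R)
         (m : R -> Omega -> P2 R),
       H2 P T (gen_F P xi0 W tW) alpha ->
       H2 P T (gen_F P xi0 W tW) ahat ->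
       cond_law_flow P T sigma tsigma xi0 W tW ahat m ->
       P.-integrable setT
         (fun w => (g (state sigma tsigma xi0 W tW alpha T w) (m T w))%:E))
    (g_derivable : forall (x : R) (m : P2 R), derivable (g ^~ m) x 1)
    (gx_lip_x : forall (x x' : R) (m : P2 R),
       `|g_x g x m - g_x g x' m| <= Cg * `|x - x'|)
    (gx_mono_x : forall (x x' : R) (m : P2 R),
       0 <= (g_x g x m - g_x g x' m) * (x - x'))
    (gx_lip_m : forall (x : R) (m m' : P2 R),
       `|g_x g x m - g_x g x m'| <= Cg * W2 m m')
    (gx_weak_mono : forall (m m' : P2 R) (gamma : probability (R * R)%type R),
       in_P2_plane gamma -> coupling m m' gamma ->
       (0 <= \int[gamma]_z
               ((g_x g z.1 m - g_x g z.2 m') * (z.1 - z.2))%:E)%E) :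
  exists ahat : R -> Omega -> R,
    mfg_solution P T sigma tsigma xi0 W tW g ahat.
Proof.
exact: (equilibrium_exists P_complete T_gt0 W_BM tW_BM xi0_meas xi0_L2
  g_integrable g_derivable gx_lip_x gx_mono_x gx_lip_m gx_weak_mono).
Qed.
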